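(* Let $\mathfrak g=\mathfrak{osp}(1\vert2)$, $\mathfrak g_0=\mathfrak{sl}(2)$. (1) $L_{-3/2}(\mathfrak g)$ has the structure of an irreducible $\mathcal V^{(2)}$-module $(L_{-3/2}(\mathfrak g),\mathcal Y^{N=4}_{L_{-3/2}(\mathfrak g)}(\cdot,z))$, uniquely determined by $$\mathcal Y^{N=4}_{L_{-3/2}(\mathfrak g)}(v,z)=v(z)\quad(v\in L_{-3/2}(\mathfrak g_0)),$$ $$\mathcal Y^{N=4}_{L_{-3/2}(\mathfrak g)}(G^+,z)=x(z)-z\big(\tfrac d{dz}x(z)-(L_{sug}(-1)x)(z)\big),$$ $$\mathcal Y^{N=4}_{L_{-3/2}(\mathfrak g)}(\overline G^+,z)=-\tfrac d{dz}x(z)+(L_{sug}(-1)x)(z),$$ $$\mathcal Y^{N=4}_{L_{-3/2}(\mathfrak g)}(G^-,z)=-y(z)+z\big(\tfrac d{dz}y(z)-(L_{sug}(-1)y)(z)\big),$$ $$\mathcal Y^{N=4}_{L_{-3/2}(\mathfrak g)}(\overline G^-,z)=-\tfrac d{dz}y(z)+(L_{sug}(-1)y)(z),$$ where $v(z)=Y_{L_{-3/2}(\mathfrak g)}(v,z)$ for $v\in L_{-3/2}(\mathfrak g)$. (2) $\mathcal V^{(2)}$ has the structure of an irreducible $L_{-3/2}(\mathfrak g)$-module $(\mathcal V^{(2)},\mathcal Y^{\mathfrak g}_{\mathcal V^{(2)}}(\cdot,z))$, uniquely determined by $$\mathcal Y^{\mathfrak g}_{\mathcal V^{(2)}}(v,z)=v(z)\quad(v\in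 L_{-3/2}(\mathfrak g_0)),$$ $$\mathcal Y^{\mathfrak g}_{\mathcal V^{(2)}}(x,z)=G^+(z)-z\,\overline G^+(z),\qquad \mathcal Y^{\mathfrak g}_{\mathcal V^{(2)}}(y,z)=-G^-(z)-z\,\overline G^-(z),$$ where $v(z)=Y_{\mathcal V^{(2)}}(v,z)$ for $v\in\mathcal V^{(2)}$.
   Context: Everything is over $\mathbb C$. $\mathfrak{osp}(1\vert2)$ has even part $\mathrm{span}\{e,f,h\}\cong\mathfrak{sl}(2)$, odd part $\mathrm{span}\{x,y\}$, relations $[e,f]=h$, $[h,e]=2e$, $[h,f]=-2f$, $[h,x]=x$, $[e,x]=0$, $[f,x]=-y$, $[h,y]=-y$, $[e,y]=-x$, $[f,y]=0$, $\{x,x\}=2e$, $\{x,y\}=h$, $\{y,y\}=-2f$, and form $(e,f)=(f,e)=1$, $(h,h)=2$, $(x,y)=-(y,x)=2$. $L_k(\mathfrak g)$ is the unique simple (graded) quotient of the universal affine vertex superalgebra $V^k(\mathfrak g)$; it is known that $e,f,h$ generate a copy of $L_{-3/2}(\mathfrak g_0)$ in $L_{-3/2}(\mathfrak g)$. $\omega_{sug}=(e(-1)f(-1)+f(-1)e(-1)+\tfrac12h(-1)^2){\bf 1}$ is the Sugawara Virasoro vector of $L_{-3/2}(\mathfrak g_0)$, and $L_{sug}(n)=(\omega_{sug})_{n+1}$. (On $L_{-3/2}(\mathfrak g)$, $L_{sug}(-1)$ differs from the translation operator.) $\mathcal V^{(2)}$ is the small $N=4$ superconformal vertex algebra at $c=-9$,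 i.e. the minimal affine $W$-algebra $\mathcal W_{1/2}(\mathfrak{psl}(2\vert2),f_\theta)$. It is realized as follows. $F$ is the Clifford vertex superalgebra with odd generators $\Psi^\pm$, $[\Psi^+(r),\Psi^-(s)]_+=\delta_{r+s,0}$, $[\Psi^\pm(r),\Psi^\pm(s)]_+=0$, $r,s\in\tfrac12+\mathbb Z$, $D$ its translation operator, $F\cong V_{\mathbb Z\alpha}$ with $\langle\alpha,\alpha\rangle=1$, $\Psi^\pm=e^{\pm\alpha}$. $\mathcal{SF}(1)=\mathrm{Ker}_F\Psi^-(\tfrac12)$ is generated by $a^+=\Psi^-$, $a^-=D\Psi^+$ and has conformal vector $\omega_{sf}=\Psi^+(-\tfrac32)\Psi^-(-\tfrac12){\bf 1}$. $\Pi(0)^{1/2}=M(1)\otimes\mathbb C[\mathbb Z\tfrac c2]$ with $M(1)$ the Heisenberg vertex algebra generated by $c,d$, $\langle c,c\rangle=\langle d,d\rangle=0$, $\langle c,d\rangle=2$. With $k=-\tfrac32$, $\mu=\frac d2+\frac k4c$, $\nu=\frac d2-\frac k4c$, $\mathcal V^{(2)}$ is the vertex subalgebra of $\mathcal{SF}(1)\otimes\Pi(0)^{1/2}$ generated by $e=e^c$, $h=2\mu(-1)$, $f=[(k+2)\omega_{sf}-\nu(-1)^2-(k+1)\nu(-2)]e^{-c}$ (which generate $L_{-3/2}(\mathfrak g_0)$) and the four odd vectors $G^+=a^+(-1)e^{c/2}$, $\overline G^+=2a^-(-1)e^{c/2}$, $G^-=f(0)G^+$, $\overline G^-=-f(0)\overline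 G^+$, with fields $G^\pm(z),\overline G^\pm(z)$; equivalently it is the kernel of the screening operator $\int e^{\alpha/2+\nu}(z)\,dz$. *)

(* Defs.v *)
From HB Require Import structures.
From mathcomp Require Export all_boot all_order all_algebra.
From mathcomp Require Export all_classical reals.
From mathcomp Require Export complex.

Set Implicit Arguments.
Unset Strict Implicit.
Unset Printing Implicit Defensive.
Import Order.TTheory GRing.Theory Num.Theory.
Local Open Scope classical_set_scope.
Local Open Scope ring_scope.

Definition is_subspace (K : numFieldType) (M : lmodType K) (N : set M) : Prop :=
  N 0 /\ forall (a : K) (u v : M), N u -> N v -> N (a *: u + v).

(* [par false] is the even part and [par true] the odd part. *)
Record superspace (K : numFieldType) := Superspace {
  superspace_sort :> lmodType K;
  par : bool -> set superspace_sort;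
  par_subspace : forall p, is_subspace (par p);
  par_sum : forall v, exists v0 v1, [/\ par false v0, par true v1 & v = v0 + v1];
  par_direct : forall v, par false v -> par true v -> v = 0
}.

(* A family of fields Y(a,z) = \sum_n a_(n) z^(-n-1) is given by its modes:
   [Y a n u] is a_(n) u. *)

Definition binz (K : numFieldType) (m : int) (j : nat) : K :=
  (\prod_(i < j) (m - i%:Z)%:~R) / j`!%:R.

(* The Jacobi identity in modes.  The sums are finite-support sums
   ([fsbigop] returns 0 on infinite supports); their supports are finite by the
   truncation axioms below. *)
Definition borcherds (K : numFieldType) (V : superspace K)
    (prod : V -> int -> V -> V) (M : lmodType K) (Y : V -> int -> M -> M) : Prop :=
  forall (p q : bool) (a b : V), par p a -> par q b ->
  forall (m n k : int) (u : M),
    \sum_(j \in [set: nat])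
       binz K m j *: Y (prod a (n + j%:Z) b) (m + k - j%:Z) u =
    \sum_(j \in [set: nat]) ((-1) ^+ j * binz K n j) *:
       (Y a (m + n - j%:Z) (Y b (k + j%:Z) u)
        - ((-1) ^+ (p && q) * (-1) ^ n) *:
          Y b (n + k - j%:Z) (Y a (m + j%:Z) u)).

Definition bilinear_modes (K : numFieldType) (V M : lmodType K)
    (Y : V -> int -> M -> M) : Prop :=
  (forall n u, linear (fun a => Y a n u)) /\ (forall a n, linear (Y a n)).

Definition truncated (K : numFieldType) (V M : lmodType K)
    (Y : V -> int -> M -> M) : Prop :=
  forall (a : V) (u : M), exists N : int, forall n : int, N <= n -> Y a n u = 0.

Definition parity_preserving (K : numFieldType) (V M : superspace K)
    (Y : V -> int -> M -> M) : Prop :=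
  forall p q a u n, par p a -> par q u -> par (p (+) q) (Y a n u).

Record vsa (K : numFieldType) := Vsa {
  vsa_sort :> superspace K;
  vac : vsa_sort;
  mode : vsa_sort -> int -> vsa_sort -> vsa_sort;
  vac_even : par false vac;
  mode_bilinear : bilinear_modes mode;
  mode_parity : parity_preserving mode;
  mode_truncated : truncated mode;
  mode_vac : forall n u, mode vac n u = if n == -1 then u else 0;
  mode_create : forall a, mode a (-1) vac = a;
  mode_annihil : forall a (n : int), 0 <= n -> mode a n vac = 0;
  mode_borcherds : borcherds mode mode
}.

Arguments vac {K v}.
Arguments mode {K v}.

Definition translation (K : numFieldType) (V : vsa K) (a : V) : V :=
  mode a (-2) vac.

(* No L(-1) or grading operator is part of a module:
   the Jacobi identity and the vacuum axiom already
   imply Y(Da,z) = d/dz Y(a,z). *)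
Definition is_module (K : numFieldType) (V : vsa K) (M : superspace K)
    (Y : V -> int -> M -> M) : Prop :=
  [/\ bilinear_modes Y, parity_preserving Y, truncated Y,
      (forall n u, Y vac n u = if n == -1 then u else 0)
    & borcherds (@mode K V) Y].

(* Submodules are not required to be Z/2-graded. *)
Definition is_irreducible (K : numFieldType) (V M : lmodType K)
    (Y : V -> int -> M -> M) : Prop :=
  (exists u : M, u != 0) /\
  forall N : set M, is_subspace N -> (forall a n u, N u -> N (Y a n u)) ->
    (forall u, N u -> u = 0) \/ (forall u, N u).

Definition is_vsa_hom (K : numFieldType) (V W : vsa K) (phi : V -> W) : Prop :=
  [/\ linear phi, (forall p a, par p a -> par p (phi a)), phi vac = vac
    & forall a n b, phi (mode a n b) = mode (phi a) n (phi b)].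

(* [i] identifies [V] with the vertex subalgebra of [W] carried by [S]. *)
Definition is_subalgebra (K : numFieldType) (V W : vsa K) (i : V -> W)
    (S : set W) : Prop :=
  [/\ is_vsa_hom i, injective i & forall w, S w <-> exists v, i v = w].

Inductive generated (K : numFieldType) (V : vsa K) (S : set V) : V -> Prop :=
| generated_in v : S v -> generated S v
| generated_vac : generated S vac
| generated_lin (a : K) u v :
    generated S u -> generated S v -> generated S (a *: u + v)
| generated_mode u n v :
    generated S u -> generated S v -> generated S (mode u n v).

Definition is_ideal (K : numFieldType) (V : vsa K) (I : set V) : Prop :=
  [/\ is_subspace I,
      (forall v, I v -> exists v0 v1,
         [/\ par false v0 /\ I v0, par true v1 /\ I v1 & v = v0 + v1])
    & forall a n v, I v -> I (mode a n v) /\ I (mode v n a)].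

Definition is_simple (K : numFieldType) (V : vsa K) : Prop :=
  (exists v : V, v != 0) /\
  forall I : set V, is_ideal I -> (forall v, I v -> v = 0) \/ (forall v, I v).

Definition dz (K : numFieldType) (M : lmodType K) (A : int -> M -> M) :
    int -> M -> M :=
  fun n u => - (n%:~R *: A (n - 1) u).

Definition mulz (M : Type) (A : int -> M -> M) : int -> M -> M :=
  fun n u => A (n + 1) u.

(* A Lie superalgebra with an invariant form, given on a homogeneous basis;
   a list [(a1, c1); ...] stands for a1 c1 + ... *)
Record lie_superdata (K : numFieldType) := LieSuperdata {
  lbasis : Type;
  lpar : lbasis -> bool;
  lbracket : lbasis -> lbasis -> seq (K * lbasis);
  lform : lbasis -> lbasis -> K
}.

Definition lcomb (K : numFieldType) (B : Type) (M : lmodType K) (iota : B -> M)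
    (s : seq (K * B)) : M :=
  \sum_(t <- s) t.1 *: iota t.2.

Definition are_affine_currents (K : numFieldType) (g : lie_superdata K) (k : K)
    (V : vsa K) (iota : lbasis g -> V) : Prop :=
  (forall a, par (lpar a) (iota a)) /\
  forall a b,
    [/\ mode (iota a) 0 (iota b) = lcomb iota (lbracket a b),
        mode (iota a) 1 (iota b) = (k * lform a b) *: vac
      & forall n : int, 2 <= n -> mode (iota a) n (iota b) = 0].

(* A module over the affinization of g on which the central element acts as
   [k]; [rho a n] is the action of a (x) t^n. *)
Definition is_affine_module (K : numFieldType) (g : lie_superdata K) (k : K)
    (M : lmodType K) (rho : lbasis g -> int -> M -> M) : Prop :=
  (forall a n, linear (rho a n)) /\
  forall a b (m n : int) u,
    rho a m (rho b n u) - (-1) ^+ (lpar a && lpar b) *: rho b n (rho a m u) =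
    lcomb (fun c => rho c (m + n) u) (lbracket a b)
    + (if m + n == 0 then m%:~R * lform a b * k else 0) *: u.

(* V^k(g) = Ind C_k: as a module over the affinization it is freely generated
   by the vacuum, subject to g[t] vac = 0. *)
Definition is_universal_affine (K : numFieldType) (g : lie_superdata K) (k : K)
    (V : vsa K) (iota : lbasis g -> V) : Prop :=
  are_affine_currents k iota /\
  forall (M : lmodType K) (rho : lbasis g -> int -> M -> M) (v : M),
    is_affine_module k rho ->
    (forall a (n : int), 0 <= n -> rho a n v = 0) ->
    exists! phi : V -> M, [/\ linear phi, phi vac = v
      & forall a n u, phi (mode (iota a) n u) = rho a n (phi u)].

(* The conformal weight grading of V^k(g): a (x) t^n has degree -n.  It is not
   the grading by a Sugawara L(0), which does not exist at the critical level. *)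
Inductive affine_weight (K : numFieldType) (B : Type) (V : vsa K)
    (iota : B -> V) : int -> V -> Prop :=
| affine_weight_vac : affine_weight iota 0 vac
| affine_weight_zero n : affine_weight iota n 0
| affine_weight_lin (a : K) n u v : affine_weight iota n u ->
    affine_weight iota n v -> affine_weight iota n (a *: u + v)
| affine_weight_mode b m n v : affine_weight iota n v ->
    affine_weight iota (n - m) (mode (iota b) m v).

(* L_k(g) is the simple quotient of V^k(g) by a graded ideal.  At the critical
   level gradedness cannot be dropped: V^k(g) then also has non-graded maximal
   ideals. *)
Definition is_simple_affine (K : numFieldType) (g : lie_superdata K) (k : K)
    (L : vsa K) (iota : lbasis g -> L) : Prop :=
  exists (V : vsa K) (iotaV : lbasis g -> V) (pi : V -> L),
    [/\ is_universal_affine k iotaV,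
        is_vsa_hom pi /\ (forall w, exists v, pi v = w),
        (forall v, pi v = 0 -> exists s : seq V, v = \sum_(u <- s) u /\
           forall u, u \in s -> pi u = 0 /\ exists n, affine_weight iotaV n u),
        is_simple L
      & forall a, iota a = pi (iotaV a)].

(* The Sugawara vector of sl(2) at level -3/2, where 1/(2(k+2)) = 1. *)
Definition omega_sug (K : numFieldType) (V : vsa K) (e f h : V) : V :=
  mode e (-1) f + mode f (-1) e + 2^-1 *: mode h (-1) h.

Inductive sl2_basis := sl2_e | sl2_f | sl2_h.
Inductive osp12_basis := osp12_even of sl2_basis | osp12_x | osp12_y.

Definition sl2_bracket (K : numFieldType) (a b : sl2_basis) :
    seq (K * sl2_basis) :=
  match a, b with
  | sl2_e, sl2_f => [:: (1, sl2_h)]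
  | sl2_f, sl2_e => [:: (-1, sl2_h)]
  | sl2_h, sl2_e => [:: (2, sl2_e)]
  | sl2_e, sl2_h => [:: (-2, sl2_e)]
  | sl2_h, sl2_f => [:: (-2, sl2_f)]
  | sl2_f, sl2_h => [:: (2, sl2_f)]
  | _, _ => [::]
  end.

Definition sl2_form (K : numFieldType) (a b : sl2_basis) : K :=
  match a, b with
  | sl2_e, sl2_f | sl2_f, sl2_e => 1
  | sl2_h, sl2_h => 2
  | _, _ => 0
  end.

Definition sl2 (K : numFieldType) : lie_superdata K :=
  LieSuperdata (fun=> false) (@sl2_bracket K) (@sl2_form K).

Definition osp12_bracket (K : numFieldType) (a b : osp12_basis) :
    seq (K * osp12_basis) :=
  match a, b with
  | osp12_even a, osp12_even b =>
      [seq (t.1, osp12_even t.2) | t <- sl2_bracket K a b]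
  | osp12_even sl2_e, osp12_x => [::]
  | osp12_even sl2_f, osp12_x => [:: (-1, osp12_y)]
  | osp12_even sl2_h, osp12_x => [:: (1, osp12_x)]
  | osp12_even sl2_e, osp12_y => [:: (-1, osp12_x)]
  | osp12_even sl2_f, osp12_y => [::]
  | osp12_even sl2_h, osp12_y => [:: (-1, osp12_y)]
  | osp12_x, osp12_even sl2_e => [::]
  | osp12_x, osp12_even sl2_f => [:: (1, osp12_y)]
  | osp12_x, osp12_even sl2_h => [:: (-1, osp12_x)]
  | osp12_y, osp12_even sl2_e => [:: (1, osp12_x)]
  | osp12_y, osp12_even sl2_f => [::]
  | osp12_y, osp12_even sl2_h => [:: (1, osp12_y)]
  | osp12_x, osp12_x => [:: (2, osp12_even sl2_e)]
  | osp12_x, osp12_y | osp12_y, osp12_x => [:: (1, osp12_even sl2_h)]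
  | osp12_y, osp12_y => [:: (-2, osp12_even sl2_f)]
  end.

Definition osp12_form (K : numFieldType) (a b : osp12_basis) : K :=
  match a, b with
  | osp12_even a, osp12_even b => sl2_form K a b
  | osp12_x, osp12_y => 2
  | osp12_y, osp12_x => -2
  | _, _ => 0
  end.

Definition osp12 (K : numFieldType) : lie_superdata K :=
  LieSuperdata (fun a => if a is osp12_even _ then false else true)
    (@osp12_bracket K) (@osp12_form K).

(* Psi(r) = Psi_(r - 1/2), so Psi^+(r), Psi^-(s) with r + s = 0 are the modes
   numbered m, n with m + n = -1. *)
Definition is_clifford (K : numFieldType) (F : vsa K) (psip psim : F) : Prop :=
  [/\ (vac : F) != 0, par true psip /\ par true psim,
      (forall (m n : int) u,
         [/\ mode psip m (mode psim n u) + mode psim n (mode psip m u)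
               = (if m + n == -1 then u else 0),
             mode psip m (mode psip n u) + mode psip n (mode psip m u) = 0
           & mode psim m (mode psim n u) + mode psim n (mode psim m u) = 0])
    & forall v, generated [set psip; psim] v].

(* <c,c> = <d,d> = 0, <c,d> = 2 *)
Definition is_heisenberg (K : numFieldType) (M : vsa K) (c d : M) : Prop :=
  [/\ (vac : M) != 0, par false c /\ par false d,
      (forall (m n : int) u,
         [/\ mode c m (mode d n u) - mode d n (mode c m u)
               = (if m + n == 0 then 2 * m%:~R else 0) *: u,
             mode c m (mode c n u) - mode c n (mode c m u) = 0
           & mode d m (mode d n u) - mode d n (mode d m u) = 0])
    & forall v, generated [set c; d] v].

(* Coefficient of z^n in A(z)^r and in exp A(z), for a series
   A(z) = \sum_(i >= 1) A_i z^i of operators. *)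
Fixpoint op_pow (K : numFieldType) (M : lmodType K) (A : nat -> M -> M)
    (r n : nat) (u : M) : M :=
  if r is r'.+1 then \sum_(1 <= i < n.+1) A i (op_pow A r' (n - i) u)
  else if n == 0%N then u else 0.

Definition op_exp (K : numFieldType) (M : lmodType K) (A : nat -> M -> M)
    (n : nat) (u : M) : M :=
  \sum_(0 <= r < n.+1) (r`!%:R)^-1 *: op_pow A r n u.

(* With beta = m c/2: \sum_i beta(-i)/i z^i and - \sum_i beta(i)/i z^(-i). *)
Definition creation (K : numFieldType) (M : vsa K) (c : M) (m : int)
    (i : nat) (u : M) : M :=
  (m%:~R / 2 / i%:R) *: mode c (- i%:Z) u.
Definition annihilation (K : numFieldType) (M : vsa K) (c : M) (m : int)
    (i : nat) (u : M) : M :=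
  - (m%:~R / 2 / i%:R) *: mode c i%:Z u.

(* Pi(0)^{1/2} = M(1) (x) C[Z c/2], where [t m u] is u (x) e^(m c/2).
   The first clause says that [t] exhibits the direct sum of the spaces
   M(1) (x) e^(m c/2).  The last one is
     Y(e^beta, z) = exp(\sum_i beta(-i)/i z^i) exp(- \sum_i beta(i)/i z^(-i))
                    e_beta z^beta(0),
   in which beta(0) = 0 and e_beta is the shift; there is no cocycle because
   Z c/2 is isotropic. *)
Definition is_Pi_half (K : numFieldType) (M1 P : vsa K) (c d : M1)
    (t : int -> M1 -> P) : Prop :=
  [/\ (forall m, linear (t m)) /\
      (forall (X : lmodType K) (phi : int -> M1 -> X),
         (forall m, linear (phi m)) ->
         exists! psi : P -> X,
           linear psi /\ forall m u, psi (t m u) = phi m u),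
      (forall m u, par false (t m u)),
      vac = t 0 vac,
      (forall (m n : int) u,
         mode (t 0 c) n (t m u) = t m (mode c n u) /\
         mode (t 0 d) n (t m u) =
           t m (mode d n u + (if n == 0 then m%:~R else 0) *: u))
    & forall (m l n : int) u,
        mode (t m vac) n (t l u) =
        t (m + l)
          (\sum_(ij \in [set ij : nat * nat | ij.1%:Z - ij.2%:Z = - n - 1])
             op_exp (creation c m) ij.1 (op_exp (annihilation c m) ij.2 u))].

(* [t] exhibits [W] as the tensor product of superspaces, with
   Y(a (x) b, z) (u (x) v) = (-1)^(|b||u|) Y(a, z) u (x) Y(b, z) v. *)
Definition is_tensor (K : numFieldType) (A B W : vsa K) (t : A -> B -> W) : Prop :=
  [/\ ((forall b, linear (t^~ b)) /\ (forall a, linear (t a))) /\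
      (forall (X : lmodType K) (phi : A -> B -> X),
         (forall b, linear (phi^~ b)) -> (forall a, linear (phi a)) ->
         exists! psi : W -> X,
           linear psi /\ forall a b, psi (t a b) = phi a b),
      (forall p q a b, par p a -> par q b -> par (p (+) q) (t a b)),
      vac = t vac vac
    & forall p q a b u v (n : int), par q b -> par p u ->
        mode (t a b) n (t u v) =
        (-1) ^+ (q && p) *:
          \sum_(i \in [set: int]) t (mode a i u) (mode b (n - 1 - i) v)].

Definition level (K : numFieldType) : K := - (3 / 2).

(* SF(1) (x) Pi(0)^{1/2}, with SF(1) = Ker Psi^-(1/2) inside F, a^+ = Psi^-,
   a^- = D Psi^+ and omega_sf = Psi^+(-3/2) Psi^-(-1/2) vac; recall
   Psi(r) = Psi_(r - 1/2). *)
Record free_field (K : numFieldType) := FreeField {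
  ff_F : vsa K;
  ff_psip : ff_F;
  ff_psim : ff_F;
  ff_FP : is_clifford ff_psip ff_psim;
  ff_SF : vsa K;
  ff_SF_incl : ff_SF -> ff_F;
  ff_SFP : is_subalgebra ff_SF_incl [set v | mode ff_psim 0 v = 0];
  ff_ap : ff_SF;
  ff_apE : ff_SF_incl ff_ap = ff_psim;
  ff_am : ff_SF;
  ff_amE : ff_SF_incl ff_am = translation ff_psip;
  ff_omega : ff_SF;
  ff_omegaE : ff_SF_incl ff_omega = mode ff_psip (-2) (mode ff_psim (-1) vac);
  ff_M1 : vsa K;
  ff_c : ff_M1;
  ff_d : ff_M1;
  ff_M1P : is_heisenberg ff_c ff_d;
  ff_Pi : vsa K;
  ff_exp : int -> ff_M1 -> ff_Pi;
  ff_PiP : is_Pi_half ff_c ff_d ff_exp;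
  ff_alg :> vsa K;
  ff_tens : ff_SF -> ff_Pi -> ff_alg;
  ff_algP : is_tensor ff_tens
}.

Definition ff_E (K : numFieldType) (A : free_field K) (m : int) : ff_Pi A :=
  ff_exp m vac.

Definition ff_mu (K : numFieldType) (A : free_field K) : ff_Pi A :=
  ff_exp 0 (2^-1 *: ff_d A + (level K / 4) *: ff_c A).
Definition ff_nu (K : numFieldType) (A : free_field K) : ff_Pi A :=
  ff_exp 0 (2^-1 *: ff_d A - (level K / 4) *: ff_c A).

Definition ff_e (K : numFieldType) (A : free_field K) : A :=
  ff_tens vac (ff_E A 2).
Definition ff_h (K : numFieldType) (A : free_field K) : A :=
  ff_tens vac (2 *: ff_mu A).
Definition ff_f (K : numFieldType) (A : free_field K) : A :=
  (level K + 2) *: ff_tens (ff_omega A) (ff_E A (-2))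
  - ff_tens vac (mode (ff_nu A) (-1) (mode (ff_nu A) (-1) (ff_E A (-2))))
  - (level K + 1) *: ff_tens vac (mode (ff_nu A) (-2) (ff_E A (-2))).

Definition ff_Gp (K : numFieldType) (A : free_field K) : A :=
  ff_tens (ff_ap A) (ff_E A 1).
Definition ff_Gbp (K : numFieldType) (A : free_field K) : A :=
  2 *: ff_tens (ff_am A) (ff_E A 1).
Definition ff_Gm (K : numFieldType) (A : free_field K) : A :=
  mode (ff_f A) 0 (ff_Gp A).
Definition ff_Gbm (K : numFieldType) (A : free_field K) : A :=
  - mode (ff_f A) 0 (ff_Gbp A).

Record small_N4 (K : numFieldType) := SmallN4 {
  n4_ff : free_field K;
  n4_alg :> vsa K;
  n4_incl : n4_alg -> n4_ff;
  n4_inclP : is_subalgebra n4_incl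
    (generated [set w | [\/ w = ff_e n4_ff, w = ff_h n4_ff | w = ff_f n4_ff] \/
       [\/ w = ff_Gp n4_ff, w = ff_Gbp n4_ff, w = ff_Gm n4_ff
         | w = ff_Gbm n4_ff]]);
  n4_sl2 : sl2_basis -> n4_alg;
  n4_eE : n4_incl (n4_sl2 sl2_e) = ff_e n4_ff;
  n4_fE : n4_incl (n4_sl2 sl2_f) = ff_f n4_ff;
  n4_hE : n4_incl (n4_sl2 sl2_h) = ff_h n4_ff;
  n4_Gp : n4_alg;
  n4_GpE : n4_incl n4_Gp = ff_Gp n4_ff;
  n4_Gbp : n4_alg;
  n4_GbpE : n4_incl n4_Gbp = ff_Gbp n4_ff;
  n4_Gm : n4_alg;
  n4_GmE : n4_incl n4_Gm = ff_Gm n4_ff;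
  n4_Gbm : n4_alg;
  n4_GbmE : n4_incl n4_Gbm = ff_Gbm n4_ff
}.

(* [j0] and [j] are the embeddings of L_{-3/2}(sl(2)) into the acting algebra
   and into the underlying space; [Y] is Y^{N=4} and [mode v] is v(z). *)
Definition N4_fields (K : numFieldType) (L0 L : vsa K) (i : lbasis (osp12 K) -> L)
    (V2 : small_N4 K) (j : L0 -> L) (j0 : L0 -> V2)
    (Y : V2 -> int -> L -> L) : Prop :=
  let x := i osp12_x in let y := i osp12_y in
  let Lsug v := mode (omega_sug (i (osp12_even sl2_e)) (i (osp12_even sl2_f))
                        (i (osp12_even sl2_h))) 0 v in
  (forall v, Y (j0 v) = mode (j v)) /\
  [/\ Y (n4_Gp V2) = mode x - mulz (dz (mode x) - mode (Lsug x)),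
      Y (n4_Gbp V2) = - dz (mode x) + mode (Lsug x),
      Y (n4_Gm V2) = - mode y + mulz (dz (mode y) - mode (Lsug y))
    & Y (n4_Gbm V2) = - dz (mode y) + mode (Lsug y)].

Definition osp_fields (K : numFieldType) (L0 L : vsa K) (i : lbasis (osp12 K) -> L)
    (V2 : small_N4 K) (j0 : L0 -> L) (j : L0 -> V2)
    (Y : L -> int -> V2 -> V2) : Prop :=
  (forall v, Y (j0 v) = mode (j v)) /\
  (Y (i osp12_x) = mode (n4_Gp V2) - mulz (mode (n4_Gbp V2)) /\
   Y (i osp12_y) = - mode (n4_Gm V2) - mulz (mode (n4_Gbm V2))).

(* Main.v *)
(** Put x(z) = G^+(z) - z Gb^+(z) and y(z) = - G^-(z) - z Gb^-(z) on V^(2).  Free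
    field computations give {x_m, x_n} = 2 e_(m+n), whence, applying ad f, all the
    relations of affine osp(1|2) at level -3/2; since L_sug(-1) is the translation
    operator of V^(2), [L_sug(-1), x(z)] - x'(z) = Gb^+(z), so that the fields of
    V^(2) are recovered from those of osp(1|2).

    V^(2) is irreducible over affine osp(1|2): a vector of least principal degree
    in a submodule is killed by the e_n (n >= 0), h_n, f_n (n >= 1) and by the
    positive modes of G^+ and Gb^+.  In the free field realization this forces it
    to be killed by all annihilation operators, and then f_1 v = 0 reads
    h_0 (h_0 + 1) v = 0.  Hence L_sug(0) v = h_0 v / 2 has eigenvalue 0 or -1/2, and
    v is a multiple of the vacuum because the other weights are positive.

    The universal property of V^k(osp(1|2)) now provides a map onto V^(2) as
    modules over the affine algebra.  Its kernel is the maximal graded ideal: it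
    contains that ideal by irreducibility, and its closure under translation is a
    two-sided ideal which avoids the vacuum.  So L_{-3/2}(osp(1|2)) and V^(2) are
    isomorphic as modules over the affine algebra, and both module structures are
    transports of adjoint ones through this isomorphism. *)

(* The map from V^k(osp(1|2)) to V^(2) is only a morphism of modules over the affine algebra: x(z)
   contains an explicit z, so it is not the field of a vector of V^(2), and L_sug(0) of V^(2) does
   not match the conformal weight of V^k(osp(1|2)). Hence its kernel is visibly neither graded nor
   two-sided. What replaces a common grading is positivity: x_n = G^+_n - Gb^+_(n+1) raises the
   L_sug(0)-eigenvalue by 1/2 - n in its first term and by -1/2 - n in its second, and both are
   positive for n < 0. So no sum of images of negative modes of osp(1|2) can be sent to the vacuum,
   whose eigenvalue is 0; this separates both kernels from the vacuum. Because the module structures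
   are transported, no locality of the new fields has to be checked. Only the formulas involving
   L_sug(-1) need an argument: the isomorphism respects the action of all of L_{-3/2}(sl(2)), in
   particular that of the Sugawara vector. *)
Require Import Defs.
From mathcomp Require Import all_boot all_order all_algebra.
From mathcomp Require Import all_classical reals complex.
From mathcomp Require Import ring zify.

Set Implicit Arguments.
Unset Strict Implicit.
Unset Printing Implicit Defensive.
Import Order.TTheory GRing.Theory Num.Theory.
Local Open Scope ring_scope.

(** * Linear combinations *)

Section LinearCombinations.
Variables (K : fieldType) (V : lmodType K).

(** Reflected linear combinations: an identity between vectors becomes one identity of scalars per
    atom, which [field] or [ring] can settle. *)
Inductive lexp :=
  LVar of nat | LZero | LAdd of lexp & lexp | LOpp of lexp | LScale of K & lexp.

Fixpoint leval (s : seq V) e : V :=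
  match e with
  | LVar i => nth 0 s i
  | LZero => 0
  | LAdd a b => leval s a + leval s b
  | LOpp a => - leval s a
  | LScale c a => c *: leval s a
  end.

Fixpoint lcoef e (i : nat) : K :=
  match e with
  | LVar j => if eqn i j then 1 else 0
  | LZero => 0
  | LAdd a b => lcoef a i + lcoef b i
  | LOpp a => - lcoef a i
  | LScale c a => c * lcoef a i
  end.

Fixpoint lcoef_eq a b n : Prop :=
  if n is n'.+1 then lcoef a n' = lcoef b n' /\ lcoef_eq a b n' else True.

Fixpoint lsmall e n : bool :=
  match e with
  | LVar j => j < n
  | LZero => true
  | LAdd a b => lsmall a n && lsmall b n
  | LOpp a | LScale _ a => lsmall a n
  end%N.

Lemma leval_lcoef s e : lsmall e (size s) ->
  leval s e = \sum_(i < size s) lcoef e i *: nth 0 s i.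
Proof.
elim: e => [j|_|a IHa b IHb|a IHa|c a IHa] /=.
- move=> hj; rewrite (bigD1 (Ordinal hj)) //= eqnE eqxx scale1r big1 ?addr0 //.
  by move=> i /negP hi; case: eqP => [e|_]; rewrite ?scale0r //; case: hi; apply/eqP/val_inj.
- by rewrite big1 // => i _; rewrite scale0r.
- by case/andP=> /IHa -> /IHb ->; rewrite -big_split /=; apply: eq_bigr => i _;
  rewrite scalerDl.
- by move/IHa=> ->; rewrite -sumrN; apply: eq_bigr => i _; rewrite scaleNr.
- by move/IHa=> ->; rewrite scaler_sumr; apply: eq_bigr => i _; rewrite scalerA.
Qed.

Lemma leval_eq s a b : lsmall a (size s) && lsmall b (size s) ->
  lcoef_eq a b (size s) -> leval s a = leval s b.
Proof.
case/andP=> ha hb h; rewrite !leval_lcoef //; apply: eq_bigr => i _; congr (_ *: _).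
case: i => i /= hi; elim: (size s) h hi => //= n IH [e h]; rewrite ltnS leq_eqVlt.
by case/orP=> [/eqP -> //|]; apply: IH.
Qed.

End LinearCombinations.

(** Atoms are compared by [unify], so that vectors which differ only by the unfolding of local
    definitions count as one. *)
Ltac lmod_find x s :=
  match s with
  | ?y :: _ => let _ := match goal with _ => unify x y end in constr:(0%N)
  | _ :: ?r => let n := lmod_find x r in constr:(n.+1)
  end.
Ltac lmod_add x s :=
  match goal with
  | _ => let _ := lmod_find x s in s
  | _ => constr:(x :: s)
  end.
Ltac lmod_atoms t s :=
  lazymatch t with
  | (?a + ?b)%R => let s := lmod_atoms a s in lmod_atoms b s
  | (- ?a)%R => lmod_atoms a s
  | (?c *: ?a)%R => lmod_atoms a s
  | 0%R => s
  | _ => lmod_add t s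
  end.
Ltac lmod_reify K t s :=
  lazymatch t with
  | (?a + ?b)%R => let a := lmod_reify K a s in let b := lmod_reify K b s in constr:(LAdd a b)
  | (- ?a)%R => let a := lmod_reify K a s in constr:(LOpp a)
  | (?c *: ?a)%R => let a := lmod_reify K a s in constr:(LScale c a)
  | 0%R => constr:(LZero K)
  | _ => let n := lmod_find t s in constr:(LVar K n)
  end.
Ltac lmod_coefs K :=
  lazymatch goal with
  | |- @eq ?T ?a ?b =>
    let s := lmod_atoms a (@nil T) in let s := lmod_atoms b s in
    let ea := lmod_reify K a s in let eb := lmod_reify K b s in
    apply: (@leval_eq K _ s ea eb); [by [] | rewrite /=; repeat split]
  end.
Ltac lmod K := lmod_coefs K; by field.

(** * Consequences of the Jacobi identity *)

Section Calculus.
Variable K : numFieldType.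

Lemma fsbig_nat (M : zmodType) (F : nat -> M) (N : nat) :
  (forall j, (N <= j)%N -> F j = 0) ->
  \sum_(j \in [set: nat]) F j = \sum_(j < N) F j.
Proof.
move=> h; rewrite fsbig_ord; symmetry; apply: fsbig_widen => // j [_ /= hj].
by apply: h; rewrite leqNgt; apply/negP.
Qed.

Lemma subspaceZ (M : lmodType K) (S : set M) a u : is_subspace S -> S u -> S (a *: u).
Proof. by move=> [h0 h] hu; rewrite -[_ *: _]addr0; apply: h. Qed.

Lemma subspaceD (M : lmodType K) (S : set M) u v :
  is_subspace S -> S u -> S v -> S (u + v).
Proof. by move=> [h0 h] hu hv; rewrite -[u]scale1r; apply: h. Qed.

Lemma subspaceN (M : lmodType K) (S : set M) u : is_subspace S -> S u -> S (- u).
Proof. by move=> hS hu; rewrite -scaleN1r; apply: subspaceZ. Qed.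

Lemma subspaceB (M : lmodType K) (S : set M) u v :
  is_subspace S -> S u -> S v -> S (u - v).
Proof. by move=> hS hu hv; apply: subspaceD => //; apply: subspaceN. Qed.

Lemma subspace_sum (M : lmodType K) (S : set M) (I : Type) (r : seq I)
    (P : pred I) (F : I -> M) : is_subspace S ->
  (forall i, P i -> S (F i)) -> S (\sum_(i <- r | P i) F i).
Proof.
by move=> hS h; elim/big_ind: _ => //; [case: hS | move=> ? ?; apply: subspaceD].
Qed.

Lemma binz0 (m : int) : binz K m 0 = 1.
Proof. by rewrite /binz big_ord0 fact0 divr1. Qed.

Lemma binz1 (m : int) : binz K m 1 = m%:~R.
Proof. by rewrite /binz big_ord_recr big_ord0 /= divr1 mul1r subr0. Qed.

Lemma binz0S j : binz K 0 j.+1 = 0.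
Proof. by rewrite /binz big_ord_recl /= subr0 !mul0r. Qed.

Lemma binzN1 j : binz K (-1) j = (-1) ^+ j.
Proof.
rewrite /binz; apply: (canLR (mulfK _)); first by rewrite pnatr_eq0 -lt0n fact_gt0.
elim: j => [|j IH]; first by rewrite big_ord0 fact0 mulr1.
rewrite big_ord_recr /= IH factS exprS natrM -[j.+1]addn1 !natrD !intrD !intrN.
by rewrite -[j%:Z%:~R]/(j%:R); ring.
Qed.

Lemma binzN2 j : binz K (-2) j = (-1) ^+ j * j.+1%:R.
Proof.
rewrite /binz; apply: (canLR (mulfK _)); first by rewrite pnatr_eq0 -lt0n fact_gt0.
elim: j => [|j IH]; first by rewrite big_ord0 fact0 !mulr1.
rewrite big_ord_recr /= IH factS exprS natrM -[j.+2]addn1 -[j.+1]addn1 !natrD !intrD !intrN.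
by rewrite -[j%:Z%:~R]/(j%:R); ring.
Qed.

Section Module.
Variables (V : vsa K) (M : superspace K) (Y : V -> int -> M -> M).
Hypothesis hY : is_module Y.

Lemma YrP a n : linear (Y a n). Proof. by case: hY => -[]. Qed.
Lemma YlP n u : linear (fun a => Y a n u). Proof. by case: hY => -[]. Qed.

Lemma Yr0 a n : Y a n 0 = 0.
Proof. by have := YrP a n (-1) 0 0; rewrite scaler0 addr0 scaleN1r addNr. Qed.
Lemma YrD a n u v : Y a n (u + v) = Y a n u + Y a n v.
Proof. by have := YrP a n 1 u v; rewrite !scale1r. Qed.
Lemma YrZ a n c u : Y a n (c *: u) = c *: Y a n u.
Proof. by have := YrP a n c u 0; rewrite !addr0 Yr0 addr0. Qed.
Lemma YrN a n u : Y a n (- u) = - Y a n u.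
Proof. by rewrite -scaleN1r YrZ scaleN1r. Qed.
Lemma Yl0 n u : Y 0 n u = 0.
Proof. by have := YlP n u (-1) 0 0; rewrite scaler0 addr0 scaleN1r addNr. Qed.
Lemma YlD a b n u : Y (a + b) n u = Y a n u + Y b n u.
Proof. by have := YlP n u 1 a b; rewrite !scale1r. Qed.
Lemma YlZ c a n u : Y (c *: a) n u = c *: Y a n u.
Proof. by have := YlP n u c a 0; rewrite !addr0 Yl0 addr0. Qed.
Lemma YlN a n u : Y (- a) n u = - Y a n u.
Proof. by rewrite -scaleN1r YlZ scaleN1r. Qed.
Lemma Yl_sum (I : Type) (r : seq I) (P : pred I) (F : I -> V) n u :
  Y (\sum_(i <- r | P i) F i) n u = \sum_(i <- r | P i) Y (F i) n u.
Proof.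
by apply: (big_morph (fun a => Y a n u) (fun a b => YlD a b n u) (Yl0 n u)).
Qed.

Lemma Y_vac n u : Y vac n u = if n == -1 then u else 0.
Proof. by case: hY. Qed.

Lemma Y_trunc a u : exists N : nat, forall n : int, N%:Z <= n -> Y a n u = 0.
Proof.
case: hY => _ _ /(_ a u) [N hN] _ _; exists `|N|%N => n hn; apply: hN.
by apply: le_trans hn; rewrite abszE ler_norm.
Qed.

(** The Jacobi identity at [n = 0]: the factor [binz K 0 j] leaves a single term on the right, the
    supercommutator. *)
Lemma Y_comm p q a b (m k : int) u (N : nat) : par p a -> par q b ->
  (forall j : int, N%:Z <= j -> mode a j b = 0) ->
  Y a m (Y b k u) - (-1) ^+ (p && q) *: Y b k (Y a m u) =
  \sum_(j < N) binz K m j *: Y (mode a j%:Z b) (m + k - j%:Z) u.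
Proof.
case: hY => _ _ _ _ hB ha hb hN; have := hB p q a b ha hb m 0 k u.
rewrite (@fsbig_nat _ _ N); last first.
  by move=> j hj; rewrite add0r hN ?lez_nat // Yl0 scaler0.
rewrite (@fsbig_nat _ _ 1); last by move=> [//|j] _; rewrite binz0S mulr0 scale0r.
rewrite big_ord_recl big_ord0 /= binz0 ?addr0 ?subr0 ?add0r !mulr1 scale1r => <-.
by apply: eq_bigr => j _; rewrite add0r.
Qed.

(** The Jacobi identity at [m = 0]. The cut-offs are parameters, because sharp ones make the sums
    short enough to be written out in the free field computations. *)
Lemma Y_iter p q a b (n k : int) u (N1 N2 : nat) : par p a -> par q b ->
  (forall j : int, N1%:Z <= j -> Y b (k + j) u = 0) ->
  (forall j : int, N2%:Z <= j -> Y a j u = 0) ->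
  Y (mode a n b) k u =
    \sum_(j < N1) ((-1) ^+ j * binz K n j) *: Y a (n - j%:Z) (Y b (k + j%:Z) u)
    - ((-1) ^+ (p && q) * (-1) ^ n) *:
      \sum_(j < N2) ((-1) ^+ j * binz K n j) *: Y b (n + k - j%:Z) (Y a j%:Z u).
Proof.
case: hY => _ _ _ _ hB ha hb h1 h2; have := hB p q a b ha hb 0 n k u.
rewrite (@fsbig_nat _ _ 1); last by move=> [//|j] _; rewrite binz0S scale0r.
rewrite big_ord_recl big_ord0 /= binz0 scale1r ?addr0 ?subr0 ?add0r => ->.
rewrite (@fsbig_nat _ _ (maxn N1 N2)); last first.
  move=> j; rewrite geq_max => /andP[hj1 hj2]; rewrite add0r h1 ?lez_nat //.
  by rewrite h2 ?lez_nat // !Yr0 scaler0 subr0 scaler0.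
rewrite (big_ord_widen (maxn N1 N2) (fun j : nat =>
  ((-1) ^+ j * binz K n j) *: Y a (n - j%:Z) (Y b (k + j%:Z) u))) ?leq_maxl //.
rewrite (big_ord_widen (maxn N1 N2) (fun j : nat =>
  ((-1) ^+ j * binz K n j) *: Y b (n + k - j%:Z) (Y a j%:Z u))) ?leq_maxr //.
rewrite scaler_sumr -sumrN !(big_mkcond (fun i : 'I_ _ => _ < _)%N) -big_split /=.
apply: eq_bigr => j _; rewrite !add0r scalerBr; congr (_ + _).
  by case: ltnP => // hj; rewrite h1 ?lez_nat // Yr0 scaler0.
case: ltnP => hj; last by rewrite h2 ?lez_nat // Yr0 !scaler0 oppr0.
by rewrite !scalerA mulrC.
Qed.

(** The qualitative form of [Y_iter], for closure arguments: no cut-off has to be provided. *)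
Lemma Y_iter_mem (S : set M) p q a b (n k : int) u : is_subspace S ->
  par p a -> par q b ->
  (forall j : nat, S (Y a (n - j%:Z) (Y b (k + j%:Z) u))) ->
  (forall j : nat, S (Y b (n + k - j%:Z) (Y a j%:Z u))) ->
  S (Y (mode a n b) k u).
Proof.
move=> hS ha hb h1 h2; have [N1 hN1] := Y_trunc b u; have [N2 hN2] := Y_trunc a u.
(* [N1] bounds the index [k + j]; adding the absolute value of [k] turns this into a bound on
   [j]. *)
rewrite (@Y_iter p q a b n k u (N1 + `|k|)%N N2) //; last first.
  by move=> j hj; apply: hN1; move: hj; rewrite PoszD; lia.
apply: subspaceB => //; last apply: subspaceZ => //.
  by apply: subspace_sum => // i _; apply: subspaceZ.
by apply: subspace_sum => // i _; apply: subspaceZ.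
Qed.

Lemma Y_iterN1 p q a b (k : int) u (N1 N2 : nat) : par p a -> par q b ->
  (forall j : int, N1%:Z <= j -> Y b (k + j) u = 0) ->
  (forall j : int, N2%:Z <= j -> Y a j u = 0) ->
  Y (mode a (-1) b) k u =
    \sum_(j < N1) Y a (-1 - j%:Z) (Y b (k + j%:Z) u)
    + (-1) ^+ (p && q) *: \sum_(j < N2) Y b (-1 + k - j%:Z) (Y a j%:Z u).
Proof.
move=> ha hb h1 h2; rewrite (Y_iter _ ha hb h1 h2) exprN1 invrN1 mulrN1 scaleNr opprK.
by congr (_ + _ *: _); apply: eq_bigr => j _; rewrite binzN1 -exprMn mulrNN mulr1 expr1n
  scale1r.
Qed.

Lemma Y_iterN2 p q a b (k : int) u (N1 N2 : nat) : par p a -> par q b ->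
  (forall j : int, N1%:Z <= j -> Y b (k + j) u = 0) ->
  (forall j : int, N2%:Z <= j -> Y a j u = 0) ->
  Y (mode a (-2) b) k u =
    \sum_(j < N1) j.+1%:R *: Y a (-2 - j%:Z) (Y b (k + j%:Z) u)
    - (-1) ^+ (p && q) *: \sum_(j < N2) j.+1%:R *: Y b (-2 + k - j%:Z) (Y a j%:Z u).
Proof.
move=> ha hb h1 h2; rewrite (Y_iter _ ha hb h1 h2).
have -> : (-1) ^ (-2) = 1 :> K by rewrite -[-2]/(- (2%:Z)) -exprz_inv invrN1 -exprnP sqrrN
  expr1n.
rewrite mulr1; congr (_ - _ *: _); apply: eq_bigr => j _;
  by rewrite binzN2 mulrA -exprMn mulrNN mulr1 expr1n mul1r.
Qed.

End Module.

Lemma mode_module (V : vsa K) : is_module (@mode K V).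
Proof.
split; [exact: mode_bilinear | exact: mode_parity | exact: mode_truncated
  | exact: mode_vac | exact: mode_borcherds].
Qed.

End Calculus.

(** * Parity, generation and transport of structure *)

Section Structure.
Variable K : numFieldType.

Lemma par0 (V : superspace K) p : par p (0 : V).
Proof. by case: (par_subspace V p). Qed.

Lemma mode_par (V : vsa K) p q r (a b : V) n :
  par p a -> par q b -> r = p (+) q -> par r (mode a n b).
Proof. by move=> ha hb ->; apply: (@mode_parity K V). Qed.

Lemma par_decomp (V : superspace K) (P : set V) (v : V) :
  is_subspace P -> (forall p u, par p u -> P u) -> P v.
Proof.
move=> hP h; have [v0 [v1 [h0 h1 ->]]] := @par_sum _ V v.
by apply: subspaceD => //; [apply: (h false) | apply: (h true)].
Qed.

(** The commutator and iterate formulas apply to homogeneous vectors only, while [generated] is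
    closed under sums of mixed parity. The induction therefore carries a decomposition into
    homogeneous parts that both satisfy [P]. *)
Lemma generated_par_ind (V : vsa K) (S P : set V) : is_subspace P -> P vac ->
  (forall v, S v -> P v /\ exists p, par p v) ->
  (forall p q a b n, par p a -> par q b -> P a -> P b -> P (mode a n b)) ->
  forall v, generated S v -> P v.
Proof.
move=> hP h1 hS hm v hv.
suff [v0 [v1 [[_ q0] [_ q1] -> ]]] : exists v0 v1, [/\ par false v0 /\ P v0,
  par true v1 /\ P v1 & v = v0 + v1].
  exact: subspaceD.
have P0 : P 0 by case: hP.
elim: hv => {v} [v /hS[Pv [[] hv]]||c u v _ [u0 [u1 [[a1 a2] [a3 a4] ->]]] _ [v0 [v1 [[b1
  b2] [b3 b4] ->]]]
  |u n v _ [u0 [u1 [[a1 a2] [a3 a4] ->]]] _ [v0 [v1 [[b1 b2] [b3 b4] ->]]]].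
- by exists 0, v; rewrite add0r; split=> //; split=> //; apply: par0.
- by exists v, 0; rewrite addr0; split=> //; split=> //; apply: par0.
- by exists vac, 0; rewrite addr0; split=> //; split=> //; [apply: vac_even | apply: par0].
- exists (c *: u0 + v0), (c *: u1 + v1); rewrite scalerDr addrACA; split=> //.
  + by split; [have [_] := par_subspace V false; apply | case: hP => _; apply].
  + by split; [have [_] := par_subspace V true; apply | case: hP => _; apply].
have hV := mode_module V.
exists (mode u0 n v0 + mode u1 n v1), (mode u0 n v1 + mode u1 n v0); split.
- split; last by apply: subspaceD => //; [apply: (hm false false) | apply: (hm true true)].
  apply: subspaceD; [exact: par_subspace | exact: (mode_par (p := false) (q := false))|].
  exact: (mode_par (p := true) (q := true)).
- split; last by apply: subspaceD => //; [apply: (hm false true) | apply: (hm true false)].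
  apply: subspaceD; [exact: par_subspace | exact: (mode_par (p := false) (q := true))|].
  exact: (mode_par (p := true) (q := false)).
by rewrite (YlD hV) !(YrD hV); lmod K.
Qed.

Lemma is_subspace_eq (M N : lmodType K) (f g : M -> N) :
  linear f -> linear g -> is_subspace [set v | f v = g v].
Proof.
move=> hf hg; split => [|a u v /= hu hv]; last by rewrite hf hg hu hv.
have h0 h : linear h -> h 0 = 0 :> N.
  by move=> /(_ (-1) 0 0); rewrite scaler0 addr0 scaleN1r addNr.
by rewrite /= !h0.
Qed.

Section Linear.
Variables (M N : lmodType K) (f : M -> N).
Hypothesis hf : linear f.
Lemma lin0 : f 0 = 0.
Proof. by have := hf (-1) 0 0; rewrite scaler0 addr0 scaleN1r addNr. Qed.
Lemma linD u v : f (u + v) = f u + f v.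
Proof. by have := hf 1 u v; rewrite !scale1r. Qed.
Lemma linZ c u : f (c *: u) = c *: f u.
Proof. by have := hf c u 0; rewrite !addr0 lin0 addr0. Qed.
Lemma linN u : f (- u) = - f u.
Proof. by rewrite -scaleN1r linZ scaleN1r. Qed.
Lemma linB u v : f (u - v) = f u - f v.
Proof. by rewrite linD linN. Qed.
Lemma lin_sum (I : Type) (r : seq I) (P : pred I) (F : I -> M) :
  f (\sum_(i <- r | P i) F i) = \sum_(i <- r | P i) f (F i).
Proof. exact: (big_morph f linD lin0). Qed.
End Linear.

Section ModuleStructure.
Variables (V : vsa K) (M : superspace K) (Y : V -> int -> M -> M).
Hypothesis hY : is_module Y.

Lemma Y_commT p q a b (m k : int) u : par p a -> par q b ->
  exists N0 : nat, forall N : nat, (N0 <= N)%N ->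
  Y a m (Y b k u) - (-1) ^+ (p && q) *: Y b k (Y a m u) =
  \sum_(j < N) binz K m j *: Y (mode a j%:Z b) (m + k - j%:Z) u.
Proof.
move=> ha hb; have [N0 h0] := Y_trunc (mode_module V) a b.
exists N0 => N hN; apply: (Y_comm hY) => // j hj; apply: h0.
by apply: le_trans hj; rewrite lez_nat.
Qed.

Lemma Y_comm0 p q a b (k : int) u : par p a -> par q b ->
  Y a 0 (Y b k u) = (-1) ^+ (p && q) *: Y b k (Y a 0 u) + Y (mode a 0 b) k u.
Proof.
move=> ha hb; have [N h] := Y_commT 0 k u ha hb.
have /(canRL (subrK _)) -> := h N.+1 (leqnSn _); rewrite [RHS]addrC; congr (_ + _).
rewrite big_ord_recl big1 ?addr0 => [|i _]; last by rewrite binz0S scale0r.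
by rewrite binz0 scale1r /= add0r ?subr0.
Qed.

Lemma Y_comm1 p q a b (k : int) u : par p a -> par q b ->
  Y a 1 (Y b k u) = (-1) ^+ (p && q) *: Y b k (Y a 1 u)
    + (Y (mode a 0 b) (k + 1) u + Y (mode a 1 b) k u).
Proof.
move=> ha hb; have [N h] := Y_commT 1 k u ha hb.
have hN : (N <= N.+2)%N by rewrite ltnW.
have /(canRL (subrK _)) -> := h N.+2 hN; rewrite [RHS]addrC; congr (_ + _).
rewrite !big_ord_recl big1 ?addr0 => [|i _]; last first.
  rewrite /binz !big_ord_recl /= subrr mul0r mulr0 ?mul0r ?scale0r //.
rewrite binz0 !scale1r /= binz1 scale1r; congr (Y _ _ _ + Y _ _ _).
  by rewrite addrC.
by rewrite [1 + k]addrC -addrA subrr addr0.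
Qed.

(** In the iterate formula for [a_(-2) vac] only the mode -1 of the vacuum survives. Its term lies
    in the second sum for [k > 0], in the first for [k < 0], and does not occur for [k = 0]. *)
Lemma Y_translation a (k : int) u :
  Y (translation a) k u = - (k%:~R *: Y a (k - 1) u).
Proof.
apply: (@par_decomp V [set a | Y (translation a) k u = - (k%:~R *: Y a (k - 1) u)]).
  rewrite /translation; split => [|c v w /= hv hw].
    by rewrite /= (Yl0 (mode_module V)) !(Yl0 hY) scaler0 oppr0.
  rewrite (YlD (mode_module V)) (YlZ (mode_module V)) !(YlD hY) !(YlZ hY) hv hw.
  by rewrite scalerDr opprD scalerN !scalerA mulrC.
move=> p {}a ha /=; have [N hN] := Y_trunc hY a u.
have hv n u' : n != -1 -> Y vac n u' = 0 by move=> h; rewrite (Y_vac hY) (negbTE h).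
have h1 u' : Y vac (-1) u' = u' by rewrite (Y_vac hY).
rewrite /translation (@Y_iterN2 _ _ _ _ hY p false a vac k u (`|k| + 1)%N (N + `|k|)%N ha
  (@vac_even _ V)); first last.
- by move=> j hj; apply: hN; lia.
- by move=> j hj; apply: hv; lia.
rewrite andbF expr0 scale1r.
case: (leP 0 k) => hk.
  rewrite big1 => [|j _]; last by rewrite hv ?(Yr0 hY) ?scaler0 //; lia.
  case: k hk => // -[_|k _] in hv *.
    rewrite big1 ?subr0 ?scale0r ?oppr0 ?add0r ?oppr0 // => j _.
    by rewrite hv ?scaler0 //; lia.
  have kN : (k < N + k.+1)%N by lia.
  rewrite (bigD1 (Ordinal kN)) //= big1 ?addr0; last first.
    by move=> j /eqP hj; rewrite hv ?scaler0 //; apply/eqP => h; apply: hj;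
      apply: val_inj => /=; lia.
  rewrite add0r; congr (- _); rewrite -[k.+1%:~R]/(k.+1%:R).
  have -> : -2 + k.+1%:Z - k%:Z = -1 by lia.
  by rewrite h1; congr (_ *: Y _ _ _); lia.
rewrite [X in _ - X]big1 ?subr0 => [|j _]; last by rewrite hv ?scaler0 //; lia.
have [k' ek] : exists k', k = - k'.+1%:Z by exists (`|k|.-1)%N; lia.
have kN : (k' < `|k| + 1)%N by lia.
rewrite (bigD1 (Ordinal kN)) //= big1 ?addr0; last first.
  by move=> j /eqP hj; rewrite hv ?(Yr0 hY) ?scaler0 //; apply/eqP => h; apply: hj;
    apply: val_inj => /=; lia.
have -> : k + k'%:Z = -1 by lia.
rewrite h1 -scaleNr ek -mulrNz opprK; congr (_ *: Y _ _ _); lia.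
Qed.

End ModuleStructure.

Section VertexAlgebra.
Variable V : vsa K.
Let hV := mode_module V.

(** The iterate formula for [(a_n b)_(-2) vac] has only two terms, those with [b_(-2) vac] and
    [b_(-1) vac], as nonnegative modes kill the vacuum. *)
Lemma translation_mode (a b : V) n :
  translation (mode a n b) = mode a n (translation b) - n%:~R *: mode a (n - 1) b.
Proof.
have lt (f : V -> V) : linear f -> linear (fun x => translation (f x)).
  by move=> hf c u v /=; rewrite /translation hf (YlD hV) (YlZ hV).
have lB (f g : V -> V) c : linear f -> linear g -> linear (fun x => f x - c *: g x).
  move=> hf hg d u v; rewrite hf hg scalerDr scalerBr opprD addrACA.
  by rewrite !scalerA mulrC.
have l1 : linear (fun x : V => translation (mode x n b)) by apply: lt; exact: YlP.
have l2 : linear (fun x : V => mode x n (translation b) - n%:~R *: mode x (n - 1) b).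
  by apply: lB; exact: YlP.
apply: (par_decomp a (is_subspace_eq l1 l2)) => p {l1 l2}a ha /=.
have l3 : linear (fun x : V => translation (mode a n x)) by apply: lt; exact: YrP.
have l4 : linear (fun x : V => mode a n (translation x) - n%:~R *: mode a (n - 1) x).
  apply: lB; last exact: YrP.
  by move=> c u v; rewrite /translation (YlD hV) (YlZ hV) (YrD hV) (YrZ hV).
apply: (par_decomp b (is_subspace_eq l3 l4)) => q {l3 l4}b hb /=.
rewrite /translation (@Y_iter _ _ _ _ hV p q a b n (-2) vac 2 0) //; first last.
- by move=> j hj; apply: mode_annihil.
- by move=> j hj; apply: mode_annihil; lia.
rewrite big_ord0 scaler0 subr0 !big_ord_recl big_ord0 addr0 binz0 binz1 /=.
rewrite mulr1 scale1r expr1 mulN1r scaleNr /= ?subr0 ?addr0 /bump /=.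
have -> : -2 + 1%:Z = -1 by [].
by rewrite mode_create.
Qed.

(** Iterated, this gives [a_(-k-1) vac = D^k a / k!], the part of skew symmetry that [tker_right]
    relies on. *)
Lemma translation_modeN (a : V) k :
  mode a (- k.+2%:Z) vac = k.+1%:R^-1 *: mode (translation a) (- k.+1%:Z) vac.
Proof.
rewrite (Y_translation hV) -scaleNr -mulrNz opprK scalerA -[k.+1%:~R]/(k.+1%:R).
rewrite mulVf ?pnatr_eq0 // scale1r; congr mode; lia.
Qed.

End VertexAlgebra.

Section Agreement.
Variables (V : vsa K) (M : superspace K) (Y1 Y2 : V -> int -> M -> M).
Hypotheses (h1 : is_module Y1) (h2 : is_module Y2).

(** Source of both uniqueness claims: by the iterate formula, the modes of a product are determined
    by those of its factors. *)
Lemma module_agree S : (forall v, S v -> exists p, par p v) ->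
  (forall v, S v -> Y1 v = Y2 v) -> forall v, generated S v -> Y1 v = Y2 v.
Proof.
move=> hp hS v hv; apply/funext => n; apply/funext => u; move: n u.
apply: (@generated_par_ind V S [set v | forall n u, Y1 v n u = Y2 v n u]) hv.
- split => [n u|c a b ha hb n u] /=; first by rewrite (Yl0 h1) (Yl0 h2).
  by rewrite (YlD h1) (YlD h2) (YlZ h1) (YlZ h2) ha hb.
- by move=> n u; rewrite (Y_vac h1) (Y_vac h2).
- by move=> w Sw; split; [move=> n u; rewrite hS | apply: hp].
move=> p q a b n ha hb ea eb k u /=.
have [N1 hN1] := Y_trunc h1 b u; have [N2 hN2] := Y_trunc h1 a u.
have t1 j : (N1 + `|k|)%N%:Z <= j -> Y1 b (k + j) u = 0 by move=> hj; apply: hN1; lia.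
rewrite (Y_iter h1 (a := a) (b := b) n ha hb t1 hN2).
rewrite (@Y_iter _ _ _ _ h2 p q a b n k u (N1 + `|k|)%N N2) //; first last.
- by move=> j /hN2; rewrite ea.
- by move=> j /t1; rewrite eb.
by congr (_ - _ *: _); apply: eq_bigr => j _; rewrite ?ea ?eb ?ea.
Qed.

End Agreement.

Lemma pullback_module (V W : vsa K) (phi : V -> W) (M : superspace K)
    (Y : W -> int -> M -> M) :
  is_vsa_hom phi -> is_module Y -> is_module (fun v => Y (phi v)).
Proof.
move=> [hl hp h1 hm] [[b1 b2] hY2 hY3 hY4 hY5]; split.
- by split=> // n u c a b; rewrite hl b1.
- by move=> p q a u n ha hu; apply: hY2 => //; apply: hp.
- by move=> a u; apply: hY3.
- by move=> n u; rewrite h1.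
move=> p q a b ha hb m n k u; rewrite -(hY5 p q _ _ (hp _ _ ha) (hp _ _ hb)).
by apply: eq_fsbigr => j _; rewrite hm.
Qed.

Lemma transport_module (V : vsa K) (M N : superspace K) (Y : V -> int -> M -> M)
    (f : M -> N) (g : N -> M) : is_module Y -> cancel f g -> cancel g f ->
  linear f -> (forall p u, par p u -> par p (f u)) ->
  (forall p u, par p u -> par p (g u)) ->
  is_module (fun v n u => f (Y v n (g u))).
Proof.
move=> hY fK gK hf pf pg; have hg : linear g.
  by move=> c u v; apply: (can_inj fK); rewrite hf !gK.
split.
- split => [n u c a b|a n c u v]; first by rewrite (YlD hY) (YlZ hY) hf.
  by rewrite hg (YrD hY) (YrZ hY) hf.
- by move=> p q a u n ha hu; apply: pf; case: hY => _ h _ _ _; apply: h => //; apply: pg.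
- move=> a u; have [m hm] := Y_trunc hY a (g u); exists m%:Z => n hn.
  by rewrite hm // (lin0 hf).
- by move=> n u; rewrite (Y_vac hY); case: ifP => _; rewrite ?gK ?(lin0 hf).
move=> p q a b ha hb m n k u; apply: (can_inj gK).
(* Truncation supplies the bound [B], which turns the finite-support sums into ordinary ones; with
   those the linear [g] commutes. *)
have mg (F : nat -> N) (B : nat) : (forall j, (B <= j)%N -> F j = 0) ->
    g (\sum_(j \in [set: nat]) F j) = \sum_(j \in [set: nat]) g (F j).
  move=> hF; rewrite (fsbig_nat hF) (@fsbig_nat _ _ B); first exact: lin_sum.
  by move=> j hj; rewrite hF // (lin0 hg).
have [N1 hN1] := Y_trunc (mode_module V) a b.
have [N2 hN2] := Y_trunc hY b (g u); have [N3 hN3] := Y_trunc hY a (g u).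
rewrite (mg _ (N1 + `|n|)%N) => [|j hj]; last first.
  by rewrite hN1 ?(Yl0 hY) ?(lin0 hf) ?scaler0 //; lia.
rewrite (mg _ (N2 + N3 + `|k| + `|m|)%N) => [|j hj]; last first.
  by rewrite !fK hN2 ?hN3 ?(Yr0 hY) ?(lin0 hf) ?scaler0 ?subr0 ?scaler0 //; lia.
have hB : borcherds mode Y by case: hY.
under eq_fsbigr do rewrite (linZ hg) fK.
under [RHS]eq_fsbigr do rewrite (linZ hg) (linB hg) (linZ hg) !fK.
exact: hB ha hb m n k (g u).
Qed.

End Structure.

(** * Complements of subspaces *)

Section Complement.
Variables (K : numFieldType) (M : lmodType K).

(** A maximal subspace among those meeting [S] only in 0 is a complement, and [pi] is the projection
    onto it along [S]. *)
Lemma subspace_complement (S : set M) : is_subspace S ->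
  exists pi : M -> M, [/\ linear pi, (forall u, pi u = 0 <-> S u)
    & forall u, pi (pi u) = pi u].
Proof.
move=> hS; have S0 : S 0 by case: hS.
(* [P] does not ask for [0]: the empty chain has empty union, which must satisfy [P] too. *)
pose P := [set C : set M | (forall (k : K) u v, C u -> C v -> C (k *: u + v))
                           /\ forall u, C u -> S u -> u = 0]%classic.
have [|C [[Clin Cdis] Cmax]] := @Zorn_bigcup M P.
  move=> F FP Ftot; split=> [k u v [X FX Xu] [X' FX' X'v]|u [X FX Xu]]; last first.
    by have [_] := FP _ FX; apply.
  have [h|h] := Ftot _ _ FX FX'.
    by exists X' => //; have [hl _] := FP _ FX'; apply: hl => //; apply: h.
  by exists X => //; have [hl _] := FP _ FX; apply: hl => //; apply: h.
have C0 : C 0.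
  have [[u Cu]|hn] := pselect (exists u, C u).
    by have := Clin (-1) u u Cu Cu; rewrite scaleN1r addNr.
  case: (Cmax [set 0]%classic).
    split; first by move=> u Cu; case: hn; exists u.
    by move=> /(_ 0 erefl) C0; case: hn; exists 0.
  by split=> [k u v -> ->|u -> //]; rewrite /= scaler0 addr0.
have hC : is_subspace C by split.
have dec u : exists a, C a /\ S (u - a).
  (* If [u] had no decomposition, [C] could be enlarged by the line through [u]. *)
  apply: contrapT => hn; apply: (Cmax [set v | exists a k, C a /\ v = a + k *: u]%classic).
    split=> [a Ca|/(_ u) h]; first by exists a, 0; rewrite scale0r addr0.
    apply: hn; exists u; rewrite subrr; split=> //; apply: h.
    by exists 0, 1; rewrite scale1r add0r.
  split=> [k _ _ [a [l [Ca ->]]] [a' [l' [Ca' ->]]]|_ [a [k [Ca ->]]] hs].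
    exists (k *: a + a'), (k * l + l'); split; first exact: Clin.
    lmod K.
  have [k0|k0] := eqVneq k 0.
    by move: hs; rewrite k0 scale0r addr0; apply: Cdis.
  case: hn; exists (- k^-1 *: a); split; first exact: subspaceZ.
  have -> : u - - k^-1 *: a = k^-1 *: (a + k *: u).
    by rewrite scalerDr scalerA mulVf // scale1r scaleNr opprK addrC.
  exact: subspaceZ.
have [pi hpi] : exists pi : M -> M, forall u, C (pi u) /\ S (u - pi u).
  exists (fun u => sval (cid (dec u))) => u; exact: (svalP (cid (dec u))).
have uniq u a : C a -> S (u - a) -> pi u = a.
  move=> Ca Sa; apply/eqP; rewrite -subr_eq0; apply/eqP; apply: Cdis.
    by apply: subspaceB => //; case: (hpi u).
  have -> : pi u - a = (u - a) - (u - pi u) by lmod K.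
  by apply: subspaceB => //; case: (hpi u).
exists pi; split.
- move=> k u v; apply: uniq; first by apply: Clin; [case: (hpi u) | case: (hpi v)].
  have -> : k *: u + v - (k *: pi u + pi v) = k *: (u - pi u) + (v - pi v) by lmod K.
  by case: hS => _; apply; [case: (hpi u) | case: (hpi v)].
- move=> u; split=> [e|Su]; first by case: (hpi u); rewrite e subr0.
  by apply: uniq => //; rewrite subr0.
by move=> u; apply: uniq; [case: (hpi u) | rewrite subrr].
Qed.

(** This serves to show that the vacuum of a tensor product is nonzero, by means of the bilinear map
    [l a *: b]. *)
Lemma dual_vector (v : M) : v != 0 ->
  exists l : M -> K, (forall k u w, l (k *: u + w) = k * l u + l w) /\ l v = 1.
Proof.
move=> v0; pose S := [set u : M | exists k : K, u = k *: v]%classic.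
have hS : is_subspace S.
  split=> [|k u w [a ->] [b ->]]; first by exists 0; rewrite scale0r.
  by exists (k * a + b); rewrite scalerDl scalerA.
have [pi [lpi kpi pipi]] := subspace_complement hS.
have dec u : exists k : K, u - pi u = k *: v.
  by apply/(kpi (u - pi u)).1; rewrite (linB lpi) pipi subrr.
have [l hl] : exists l : M -> K, forall u, u - pi u = l u *: v.
  exists (fun u => sval (cid (dec u))) => u; exact: (svalP (cid (dec u))).
have inj a b : a *: v = b *: v -> a = b.
  move=> /eqP; rewrite -subr_eq0 -scalerBl scaler_eq0 (negbTE v0) orbF subr_eq0.
  by move/eqP.
exists l; split=> [k u w|]; apply: inj.
  by rewrite -hl scalerDl -scalerA -!hl lpi; lmod K.
rewrite -hl scale1r; have -> : pi v = 0 by apply/kpi; exists 1; rewrite scale1r.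
by rewrite subr0.
Qed.

End Complement.

(** * Free fields *)

Section ModeRules.
Variables (K : numFieldType) (V : vsa K).
Let hV := mode_module V.

Lemma modeDr (a : V) n u v : mode a n (u + v) = mode a n u + mode a n v.
Proof. exact: YrD hV _ _ _ _. Qed.
Lemma modeNr (a : V) n u : mode a n (- u) = - mode a n u.
Proof. exact: YrN hV _ _ _. Qed.
Lemma modeZr (a : V) n c u : mode a n (c *: u) = c *: mode a n u.
Proof. exact: YrZ hV _ _ _ _. Qed.
Lemma mode0r (a : V) n : mode a n 0 = 0.
Proof. exact: Yr0 hV _ _. Qed.
Lemma modeDl (a b : V) n u : mode (a + b) n u = mode a n u + mode b n u.
Proof. exact: YlD hV _ _ _ _. Qed.
Lemma modeNl (a : V) n u : mode (- a) n u = - mode a n u.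
Proof. exact: YlN hV _ _ _. Qed.
Lemma modeZl (a : V) n c u : mode (c *: a) n u = c *: mode a n u.
Proof. exact: YlZ hV _ _ _ _. Qed.
Lemma mode0l n (u : V) : mode 0 n u = 0.
Proof. exact: Yl0 hV _ _. Qed.
Definition modeE := (modeDr, modeNr, modeZr, mode0r, modeDl, modeNl, modeZl, mode0l).

(** Sums over [iota 0 N] unfold by computation once [N] is a numeral; [unroll] then writes out all
    the terms. *)
Lemma iterN1 p q (a b : V) (k : int) u (N1 N2 : nat) : par p a -> par q b ->
  (forall j : int, N1%:Z <= j -> mode b (k + j) u = 0) ->
  (forall j : int, N2%:Z <= j -> mode a j u = 0) ->
  mode (mode a (-1) b) k u =
    \sum_(j <- iota 0 N1) mode a (-1 - j%:Z) (mode b (k + j%:Z) u)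
    + (-1) ^+ (p && q) *: \sum_(j <- iota 0 N2) mode b (k - 1 - j%:Z) (mode a j%:Z u).
Proof.
move=> ha hb h1 h2; rewrite (Y_iterN1 hV ha hb h1 h2) -(big_mkord xpredT (fun j => mode a
  (-1 - j%:Z) (mode b (k + j%:Z) u))).
rewrite -(big_mkord xpredT (fun j => mode b (-1 + k - j%:Z) (mode a j%:Z u))) /index_iota
  !subn0.
by congr (_ + _ *: _); apply: eq_bigr => j _; congr mode; lia.
Qed.

Lemma iterN2 p q (a b : V) (k : int) u (N1 N2 : nat) : par p a -> par q b ->
  (forall j : int, N1%:Z <= j -> mode b (k + j) u = 0) ->
  (forall j : int, N2%:Z <= j -> mode a j u = 0) ->
  mode (mode a (-2) b) k u =
    \sum_(j <- iota 0 N1) j.+1%:R *: mode a (-2 - j%:Z) (mode b (k + j%:Z) u)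
    - (-1) ^+ (p && q) *: \sum_(j <- iota 0 N2) j.+1%:R *: mode b (k - 2 - j%:Z) (mode a
      j%:Z u).
Proof.
move=> ha hb h1 h2; rewrite (Y_iterN2 hV ha hb h1 h2) -(big_mkord xpredT (fun j => j.+1%:R
  *: mode a (-2 - j%:Z) (mode b (k + j%:Z) u))).
rewrite -(big_mkord xpredT (fun j => j.+1%:R *: mode b (-2 + k - j%:Z) (mode a j%:Z u)))
  /index_iota !subn0.
by congr (_ - _ *: _); apply: eq_bigr => j _; congr (_ *: mode _ _ _); lia.
Qed.

(** The case of a pure double pole, which covers the Heisenberg fields and the symplectic
    fermions. *)
Lemma comm_scalar p q (a b : V) kappa : par p a -> par q b ->
  (forall n, 0 <= n -> mode a n b = if n == 1 then kappa *: vac else 0) ->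
  forall m n u, mode a m (mode b n u) =
    (-1) ^+ (p && q) *: mode b n (mode a m u)
    + (if m + n == 0 then m%:~R * kappa else 0) *: u.
Proof.
move=> ha hb h m n u.
have hN j : 2%:Z <= j -> mode a j b = 0.
  by move=> hj; rewrite h; [case: eqP => // e; move: hj; rewrite e | lia].
rewrite -[LHS](subrK ((-1) ^+ (p && q) *: mode b n (mode a m u))).
rewrite (Y_comm hV m n u ha hb hN) !big_ord_recl big_ord0 /= !h //= !modeE scaler0 add0r addr0.
rewrite addrC binz1 mode_vac; congr (_ + _).
have -> : (m + n - (bump 0 0)%:Z == -1) = (m + n == 0) by rewrite /bump; lia.
by case: ifP => _; rewrite ?scalerA // !scaler0 scale0r.
Qed.

Lemma comm_zero p q (a b : V) : par p a -> par q b ->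
  (forall n, 0 <= n -> mode a n b = 0) ->
  forall m n u, mode a m (mode b n u) = (-1) ^+ (p && q) *: mode b n (mode a m u).
Proof.
move=> ha hb h m n u; rewrite (@comm_scalar p q a b 0) //.
  by rewrite mulr0 if_same scale0r addr0.
by move=> j hj; rewrite h // scale0r if_same.
Qed.

Lemma comm_prim p q (a b c : V) : par p a -> par q b -> mode a 0 b = c ->
  (forall n, 1 <= n -> mode a n b = 0) ->
  forall m n u, mode a m (mode b n u) =
    (-1) ^+ (p && q) *: mode b n (mode a m u) + mode c (m + n) u.
Proof.
move=> ha hb h0 h m n u.
rewrite -[LHS](subrK ((-1) ^+ (p && q) *: mode b n (mode a m u))).
rewrite (@Y_comm _ _ _ _ hV p q a b m n u 1 ha hb h) big_ord_recl big_ord0 /= h0 binz0.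
by rewrite scale1r ?addr0 ?subr0 addrC.
Qed.

End ModeRules.

Local Ltac unroll := rewrite /= ?big_cons ?big_nil /= ?(modeE, expr0, expr1,
  scaleN1r, scaler0, scale0r, scale1r, addr0, add0r, oppr0).

(* [ap], [am] stand for a^+, a^- and [E m] for e^(m c/2).  The Heisenberg algebra
   is presented in the basis nu, c, with d = 2 nu - 3/4 c at level -3/2. *)
Record free_field_rel (K : numFieldType) (A : vsa K) (ap am c nu : A)
    (E : int -> A) : Prop := FreeFieldRel {
  ffr_ap : par true ap;
  ffr_am : par true am;
  ffr_c : par false c;
  ffr_nu : par false nu;
  ffr_E : forall m, par false (E m);
  ffr_apap : forall n, 0 <= n -> mode ap n ap = 0;
  ffr_amam : forall n, 0 <= n -> mode am n am = 0;
  ffr_apam : forall n, 0 <= n -> mode ap n am = if n == 1 then 1 *: vac else 0;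
  ffr_cc : forall n, 0 <= n -> mode c n c = 0;
  ffr_nunu : forall n, 0 <= n -> mode nu n nu = if n == 1 then (3 / 4) *: vac else 0;
  ffr_cnu : forall n, 0 <= n -> mode c n nu = if n == 1 then 1 *: vac else 0;
  ffr_apc : forall n, 0 <= n -> mode ap n c = 0;
  ffr_apnu : forall n, 0 <= n -> mode ap n nu = 0;
  ffr_apE : forall n m, 0 <= n -> mode ap n (E m) = 0;
  ffr_amc : forall n, 0 <= n -> mode am n c = 0;
  ffr_amnu : forall n, 0 <= n -> mode am n nu = 0;
  ffr_amE : forall n m, 0 <= n -> mode am n (E m) = 0;
  ffr_cE : forall n m, 0 <= n -> mode c n (E m) = 0;
  ffr_nuE0 : forall m, mode nu 0 (E m) = (m%:~R / 2) *: E m;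
  ffr_nuE : forall n m, 1 <= n -> mode nu n (E m) = 0;
  ffr_EE : forall n m l, 0 <= n -> mode (E m) n (E l) = 0;
  ffr_EEN1 : forall m l, mode (E m) (-1) (E l) = E (m + l);
  ffr_DE : forall m, translation (E m) = (m%:~R / 2) *: mode c (-1) (E m);
  ffr_E0 : E 0 = vac
}.

(** * Commutators of the free fields *)

Section FreeFieldCalculus.
Variables (K : numFieldType) (A : vsa K) (ap am c nu : A) (E : int -> A).
Hypothesis H : free_field_rel ap am c nu E.
Let pap := ffr_ap H.
Let pam := ffr_am H.
Let pc := ffr_c H.
Let pnu := ffr_nu H.
Let pE := ffr_E H.

Lemma cc_comm m n u : mode c m (mode c n u) = mode c n (mode c m u).
Proof. by rewrite (comm_zero pc pc (ffr_cc H)) expr0 scale1r. Qed.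
Lemma cnu_comm m n u : mode c m (mode nu n u) =
  mode nu n (mode c m u) + (if m + n == 0 then m%:~R else 0) *: u.
Proof. by rewrite (comm_scalar pc pnu (ffr_cnu H)) expr0 scale1r mulr1. Qed.
Lemma nunu_comm m n u : mode nu m (mode nu n u) =
  mode nu n (mode nu m u) + (if m + n == 0 then m%:~R * (3 / 4) else 0) *: u.
Proof. by rewrite (comm_scalar pnu pnu (ffr_nunu H)) expr0 scale1r. Qed.
Lemma cE_comm m n l u : mode c m (mode (E l) n u) = mode (E l) n (mode c m u).
Proof. by rewrite (comm_zero pc (pE l)) ?expr0 ?scale1r // => ? ?; apply: (ffr_cE H). Qed.
Lemma nuE_comm m n l u : mode nu m (mode (E l) n u) =
  mode (E l) n (mode nu m u) + (l%:~R / 2) *: mode (E l) (m + n) u.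
Proof.
rewrite (@comm_prim _ _ _ _ _ _ _ pnu (pE l) (ffr_nuE0 H l)) ?expr0 ?scale1r ?modeE //.
by move=> ? ?; apply: (ffr_nuE H).
Qed.
Lemma EE_comm m n k l u : mode (E k) m (mode (E l) n u) = mode (E l) n (mode (E k) m u).
Proof. by rewrite (comm_zero (pE k) (pE l)) ?expr0 ?scale1r // => ? ?; apply: (ffr_EE H). Qed.

Lemma apap_comm m n u : mode ap m (mode ap n u) = - mode ap n (mode ap m u).
Proof. by rewrite (comm_zero pap pap (ffr_apap H)) expr1 scaleN1r. Qed.
Lemma amam_comm m n u : mode am m (mode am n u) = - mode am n (mode am m u).
Proof. by rewrite (comm_zero pam pam (ffr_amam H)) expr1 scaleN1r. Qed.
Lemma apam_comm m n u : mode ap m (mode am n u) =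
  - mode am n (mode ap m u) + (if m + n == 0 then m%:~R else 0) *: u.
Proof. by rewrite (comm_scalar pap pam (ffr_apam H)) expr1 scaleN1r mulr1. Qed.

Lemma a_comm a : (a = ap \/ a = am) ->
  [/\ par true a,
      (forall m n l u, mode a m (mode (E l) n u) = mode (E l) n (mode a m u)),
      (forall m n u, mode a m (mode c n u) = mode c n (mode a m u))
    & (forall m n u, mode a m (mode nu n u) = mode nu n (mode a m u))].
Proof.
case=> ->; split=> // m n.
- by move=> l u; rewrite (comm_zero pap (pE l)) ?expr0 ?scale1r // => ? ?; apply: (ffr_apE H).
- by move=> u; rewrite (comm_zero pap pc (ffr_apc H)) expr0 scale1r.
- by move=> u; rewrite (comm_zero pap pnu (ffr_apnu H)) expr0 scale1r.
- by move=> l u; rewrite (comm_zero pam (pE l)) ?expr0 ?scale1r // => ? ?; apply: (ffr_amE H).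
- by move=> u; rewrite (comm_zero pam pc (ffr_amc H)) expr0 scale1r.
- by move=> u; rewrite (comm_zero pam pnu (ffr_amnu H)) expr0 scale1r.
Qed.

Definition sf_om : A := mode am (-1) ap.

Lemma par_om : par false sf_om. Proof. exact: (mode_par (-1) pam pap). Qed.

Lemma om_iter k u (N1 N2 : nat) :
  (forall j : int, N1%:Z <= j -> mode ap (k + j) u = 0) ->
  (forall j : int, N2%:Z <= j -> mode am j u = 0) ->
  mode sf_om k u = \sum_(j <- iota 0 N1) mode am (-1 - j%:Z) (mode ap (k + j%:Z) u)
     - \sum_(j <- iota 0 N2) mode ap (k - 1 - j%:Z) (mode am j%:Z u).
Proof. by move=> h1 h2; rewrite /sf_om (iterN1 pam pap h1 h2) /= expr1 scaleN1r. Qed.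

Lemma amap n : 0 <= n -> mode am n ap = if n == 1 then - vac else 0.
Proof.
move=> hn; have := apam_comm (-1) n vac.
rewrite !mode_create (mode_annihil am hn) mode0r => /eqP.
rewrite eq_sym addrC subr_eq0 => /eqP <-.
have -> : (-1 + n == 0) = (n == 1) by lia.
by case: ifP => _; rewrite ?scale0r // scaleN1r.
Qed.
End FreeFieldCalculus.

(** * Operator products of the constituents of f *)

Section FreeFieldOPE.
Variables (K : numFieldType) (A : vsa K) (ap am c nu : A) (E : int -> A).
Hypothesis H : free_field_rel ap am c nu E.
Let hA := mode_module A.
Let pc := ffr_c H.
Let pnu := ffr_nu H.
Let pE := ffr_E H.
Let om := sf_om ap am.
Let pom : par false om := par_om H.

(** For [k = 0] and [k = 1] the right side is [D a] and [a], and it vanishes afterwards: both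
    fermions are primary of weight 1 for [om]. *)
Lemma om_a a k : (a = ap \/ a = am) -> 0 <= k -> mode om k a = mode a (k - 2) vac.
Proof.
move=> ha hk.
have v2 j (b : A) : 2%:Z <= j -> 0 <= k -> mode b (k + j - 2) vac = 0 by move=> *;
  apply: mode_annihil; lia.
case: ha => ->.
  rewrite (om_iter H (N1 := 0) (N2 := 2)).
  - unroll; rewrite !(amap H) //= modeNr mode0r add0r opprK; congr mode; lia.
  - by move=> j hj; apply: (ffr_apap H); lia.
  - by move=> j hj; rewrite (amap H); [case: eqP => // -> in hj *; lia | lia].
rewrite (om_iter H (N1 := 2) (N2 := 0)).
- unroll; rewrite !(ffr_apam H) ?addr_ge0 //.
  have [k0|k0] := eqVneq k 0; first by rewrite k0 /= scale1r mode0r add0r.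
  have [k1|k1] := eqVneq k 1; first by rewrite k1 /= scale1r mode0r addr0.
  rewrite (mode_annihil _ (n := k - 2)); last by lia.

  have -> : (k + 1%:Z == 1) = false by lia.
  by rewrite !mode0r addr0.
- move=> j hj; rewrite (ffr_apam H); last by lia.
  by have -> : (k + j == 1) = false by lia.
by move=> j hj; apply: (ffr_amam H); lia.
Qed.

Lemma om_a_comm a m n u : (a = ap \/ a = am) ->
  mode om m (mode a n u) = mode a n (mode om m u) - n%:~R *: mode a (m + n - 1) u.
Proof.
move=> ha; have [pa _ _ _] := a_comm H ha.
have h j : 2%:Z <= j -> mode om j a = 0.
  by move=> hj; rewrite om_a //; [apply: mode_annihil | ]; lia.
rewrite -[LHS](subrK (mode a n (mode om m u))) addrC; congr (_ + _).
have := Y_comm hA m n u pom pa h; rewrite /= expr0 scale1r => ->.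
rewrite !big_ord_recl big_ord0 /= !om_a // binz0 binz1 -/(translation a) mode_create.
rewrite (Y_translation hA) scale1r ?addr0 ?subr0.
have -> : m + n - (bump 0 0)%:Z = m + n - 1 by [].
lmod_coefs K; rewrite intrD; by ring.
Qed.

(** These are the modes of D e^(kc/2) = k/2 c_(-1) e^(kc/2). When the [c_j] with [j >= 0] kill [u],
    they give a recursion for the mode [n - 1] in terms of those of index at least [n], except at
    [n = 0]. *)
Lemma E_rel k n u (N1 N2 : nat) :
  (forall j : int, N1%:Z <= j -> mode (E k) (n + j) u = 0) ->
  (forall j : int, N2%:Z <= j -> mode c j u = 0) ->
  - (n%:~R *: mode (E k) (n - 1) u) = (k%:~R / 2) *:
    (\sum_(j <- iota 0 N1) mode c (-1 - j%:Z) (mode (E k) (n + j%:Z) u)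
     + \sum_(j <- iota 0 N2) mode (E k) (n - 1 - j%:Z) (mode c j%:Z u)).
Proof.
move=> h1 h2; have := Y_translation hA (E k) n u; rewrite (ffr_DE H) modeZl => <-.
by rewrite (iterN1 pc (pE k) h1 h2) /= expr0 scale1r.
Qed.

Lemma EN2 k m : mode (E k) (-2) (E m) = (k%:~R / 2) *: mode c (-1) (E (k + m)).
Proof.
have := @E_rel k (-1) (E m) 1 0; unroll.
rewrite (ffr_EEN1 H) opprK => -> //.
  by move=> j hj; apply: (ffr_EE H); lia.
by move=> j hj; apply: (ffr_cE H); lia.
Qed.

(** The right side is the second Schur polynomial in the creation operators of [- c]. *)
Lemma E2N3 m : mode (E (-2)) (-3) (E m) =
  (1 / 2) *: (mode c (-1) (mode c (-1) (E (-2 + m))) - mode c (-2) (E (-2 + m))).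
Proof.
have := @E_rel (-2) (-2) (E m) 2 0; unroll.
rewrite (ffr_EEN1 H) EN2 modeZr => e.
have -> : mode (E (-2)) (-3) (E m) = (1 / 2) *: - ((-2)%:~R *: mode (E (-2)) (-2 - 1) (E m)).
  by lmod K.
rewrite e; first by lmod K.
  by move=> j hj; apply: (ffr_EE H); lia.
by move=> j hj; apply: (ffr_cE H); lia.
Qed.

Let e2 := E (-2).
Let pe2 : par false e2 := pE (-2).
Definition nuE_vec : A := mode nu (-1) e2.
Definition nunuE_vec : A := mode nu (-1) nuE_vec.
Definition nu2E_vec : A := mode nu (-2) e2.

Lemma par_nuE : par false nuE_vec. Proof. exact: (mode_par (-1) pnu pe2). Qed.
Lemma par_nunuE : par false nunuE_vec. Proof. exact: (mode_par (-1) pnu par_nuE). Qed.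
Lemma par_nu2E : par false nu2E_vec. Proof. exact: (mode_par (-2) pnu pe2). Qed.

Local Ltac nuEm := let j := fresh "j" in let hj := fresh "hj" in
  move=> j hj; first [ by apply: (ffr_nuE H); lia | by apply: (ffr_EE H); lia ].

Lemma nuE_Em_ge k m : 1 <= k -> mode nuE_vec k (E m) = 0.
Proof.
move=> hk; rewrite /nuE_vec (iterN1 (N1 := 0) (N2 := 1) pnu pe2); try nuEm.
unroll; rewrite (ffr_nuE0 H) modeZr (ffr_EE H) ?scaler0 //; lia.
Qed.

Lemma nuE_Em0 m : mode nuE_vec 0 (E m) = (m%:~R / 2) *: E (-2 + m).
Proof.
rewrite /nuE_vec (iterN1 (N1 := 0) (N2 := 1) pnu pe2); try nuEm.
by unroll; rewrite (ffr_nuE0 H) modeZr (ffr_EEN1 H).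
Qed.

Lemma nuE_EmN1 m : mode nuE_vec (-1) (E m) =
  mode nu (-1) (E (-2 + m)) - (m%:~R / 2) *: mode c (-1) (E (-2 + m)).
Proof.
rewrite /nuE_vec (iterN1 (N1 := 1) (N2 := 1) pnu pe2); try nuEm.
unroll; rewrite (ffr_nuE0 H) modeZr (ffr_EEN1 H) EN2; lmod K.
Qed.

Lemma nuE_EmN2 m : mode nuE_vec (-2) (E m) =
  - mode nu (-1) (mode c (-1) (E (-2 + m))) + mode nu (-2) (E (-2 + m))
  + (m%:~R / 4) *: (mode c (-1) (mode c (-1) (E (-2 + m))) - mode c (-2) (E (-2 + m))).
Proof.
rewrite /nuE_vec (iterN1 (N1 := 2) (N2 := 1) pnu pe2); try nuEm.
unroll; rewrite (ffr_nuE0 H) modeZr (ffr_EEN1 H) EN2 E2N3 modeZr; lmod K.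
Qed.

Lemma nunuE_Em_ge k m : 2 <= k -> mode nunuE_vec k (E m) = 0.
Proof.
move=> hk; rewrite /nunuE_vec (iterN1 (N1 := 0) (N2 := 1) pnu par_nuE); try nuEm.
  unroll; rewrite (ffr_nuE0 H) modeZr nuE_Em_ge ?scaler0 //; lia.
by move=> j hj; apply: nuE_Em_ge; lia.
Qed.

Lemma nunuE_Em1 m : mode nunuE_vec 1 (E m) = (m%:~R ^+ 2 / 4) *: E (-2 + m).
Proof.
rewrite /nunuE_vec (iterN1 (N1 := 0) (N2 := 1) pnu par_nuE); try nuEm.
  unroll; rewrite (ffr_nuE0 H) modeZr nuE_Em0; lmod K.
by move=> j hj; apply: nuE_Em_ge; lia.
Qed.

Lemma nunuE_Em0 m : mode nunuE_vec 0 (E m) =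
  m%:~R *: mode nu (-1) (E (-2 + m)) - (m%:~R ^+ 2 / 4) *: mode c (-1) (E (-2 + m)).
Proof.
rewrite /nunuE_vec (iterN1 (N1 := 1) (N2 := 1) pnu par_nuE); try nuEm.
  unroll; rewrite (ffr_nuE0 H) modeZr nuE_Em0 modeZr nuE_EmN1; lmod K.
by move=> j hj; apply: nuE_Em_ge; lia.
Qed.

Lemma nu2E_Em_ge k m : 2 <= k -> mode nu2E_vec k (E m) = 0.
Proof.
move=> hk; rewrite /nu2E_vec (iterN2 (N1 := 0) (N2 := 1) pnu pe2); try nuEm.
unroll; rewrite (ffr_nuE0 H) modeZr (ffr_EE H) ?scaler0 ?oppr0 //; lia.
Qed.

Lemma nu2E_Em1 m : mode nu2E_vec 1 (E m) = - (m%:~R / 2) *: E (-2 + m).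
Proof.
rewrite /nu2E_vec (iterN2 (N1 := 0) (N2 := 1) pnu pe2); try nuEm.
by unroll; rewrite (ffr_nuE0 H) modeZr (ffr_EEN1 H); lmod K.
Qed.

Lemma nu2E_Em0 m : mode nu2E_vec 0 (E m) = (m%:~R / 2) *: mode c (-1) (E (-2 + m)).
Proof.
rewrite /nu2E_vec (iterN2 (N1 := 0) (N2 := 1) pnu pe2); try nuEm.
unroll; rewrite (ffr_nuE0 H) modeZr EN2; lmod K.
Qed.

(** By [current_f0] the vector [w] occurs in [f_0 G]. Its products with the constituents of [f]
    serve to compute [f_0 f_0 G], all of whose terms are monomials applied to [Z]. *)
Let w : A := mode nu (-1) (E (-1)).
Let Z : A := E (-3).
Let ncZ := mode nu (-1) (mode c (-1) Z).
Let sZ := mode c (-1) (mode c (-1) Z) - mode c (-2) Z.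

Lemma e2_w k : mode e2 k w = mode nu (-1) (mode e2 k (E (-1))) + mode e2 (k - 1) (E (-1)).
Proof.
have := nuE_comm H (-1) k (-2) (E (-1)); rewrite /w -/e2 => ->.
rewrite [-1 + k]addrC -/e2; lmod K.
Qed.

Lemma nu_w0 : mode nu 0 w = (- (1 / 2)) *: w.
Proof. by rewrite /w (nunu_comm H) (ffr_nuE0 H) modeZr /= scale0r addr0; lmod K. Qed.
Lemma nu_w1 : mode nu 1 w = (3 / 4) *: E (-1).
Proof. by rewrite /w (nunu_comm H) (ffr_nuE H) // mode0r /= add0r mul1r. Qed.
Lemma nu_w2 j : 2 <= j -> mode nu j w = 0.
Proof.
move=> hj; rewrite /w (nunu_comm H) (ffr_nuE H) ?mode0r ?add0r; last by lia.
have -> : (j - 1 == 0) = false by lia.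
by rewrite scale0r.
Qed.

Lemma e2_w_ge k : 1 <= k -> mode e2 k w = 0.
Proof. by move=> hk; rewrite e2_w !(ffr_EE H) ?mode0r ?addr0 //; lia. Qed.
Lemma e2_w0 : mode e2 0 w = Z.
Proof. by rewrite e2_w (ffr_EE H) // mode0r add0r (ffr_EEN1 H). Qed.
Lemma e2_wN1 : mode e2 (-1) w = mode nu (-1) Z - mode c (-1) Z.
Proof. by rewrite e2_w (ffr_EEN1 H) EN2; congr (_ + _); lmod K. Qed.
Lemma e2_wN2 : mode e2 (-2) w = - ncZ + (1 / 2) *: sZ.
Proof. by rewrite e2_w EN2 E2N3 modeZr; congr (_ + _); rewrite /ncZ; lmod K. Qed.

Lemma nuE_w_ge k : 2 <= k -> mode nuE_vec k w = 0.
Proof.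
move=> hk; rewrite /nuE_vec (iterN1 (N1 := 0) (N2 := 2) pnu pe2).
- unroll; rewrite nu_w0 nu_w1 !modeZr e2_w_ge; last by lia.
  rewrite (ffr_EE H); last by lia.
  by rewrite !scaler0 addr0.
- by move=> j hj; apply: e2_w_ge; lia.
- by move=> j hj; apply: nu_w2.
Qed.

Lemma nuE_w1 : mode nuE_vec 1 w = (1 / 4) *: Z.
Proof.
rewrite /nuE_vec (iterN1 (N1 := 0) (N2 := 2) pnu pe2).
- unroll; rewrite nu_w0 nu_w1 !modeZr e2_w0 (ffr_EEN1 H) -/Z; lmod K.
- by move=> j hj; apply: e2_w_ge; lia.
- by move=> j hj; apply: nu_w2.
Qed.

Lemma nuE_w0 : mode nuE_vec 0 w = (1 / 2) *: mode nu (-1) Z - (1 / 4) *: mode c (-1) Z.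
Proof.
rewrite /nuE_vec (iterN1 (N1 := 1) (N2 := 2) pnu pe2).
- unroll; rewrite nu_w0 nu_w1 !modeZr e2_w0 e2_wN1 EN2 -/Z; lmod K.
- by move=> j hj; apply: e2_w_ge; lia.
- by move=> j hj; apply: nu_w2.
Qed.

Lemma nuE_wN1 : mode nuE_vec (-1) w = mode nu (-1) (mode nu (-1) Z)
  - (1 / 2) *: ncZ + mode nu (-2) Z + (1 / 8) *: sZ.
Proof.
rewrite /nuE_vec (iterN1 (N1 := 2) (N2 := 2) pnu pe2).
- unroll; rewrite nu_w0 nu_w1 !modeZr e2_w0 e2_wN1 e2_wN2 E2N3 modeDr modeNr -/ncZ -/sZ;
  lmod K.
- by move=> j hj; apply: e2_w_ge; lia.
- by move=> j hj; apply: nu_w2.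
Qed.

Lemma nunuE_w0 : mode nunuE_vec 0 w = - (3 / 4) *: ncZ + (1 / 2) *: mode nu (-2) Z - (1 /
  4) *: sZ.
Proof.
rewrite /nunuE_vec (iterN1 (N1 := 2) (N2 := 2) pnu par_nuE).
- unroll; rewrite nu_w0 nu_w1 !modeZr nuE_w1 nuE_w0 nuE_wN1 nuE_EmN2 -/ncZ -/sZ !(modeDr,
  modeNr, modeZr) -/ncZ.
  lmod K.
- by move=> j hj; apply: nuE_w_ge; lia.
- by move=> j hj; apply: nu_w2.
Qed.

Lemma nu2E_w0 : mode nu2E_vec 0 w = mode nu (-2) Z - (1 / 2) *: ncZ - (1 / 2) *: sZ.
Proof.
rewrite /nu2E_vec (iterN2 (N1 := 1) (N2 := 2) pnu pe2).
- unroll; rewrite nu_w0 nu_w1 !modeZr e2_w0 e2_wN2 E2N3 -/ncZ -/sZ; lmod K.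
- by move=> j hj; apply: e2_w_ge; lia.
- by move=> j hj; apply: nu_w2.
Qed.

End FreeFieldOPE.

(** * The odd currents a^+ e^(c/2) and a^- e^(c/2) *)

Section SuperCurrents.
Variables (K : numFieldType) (A : vsa K) (ap am c nu : A) (E : int -> A).
Hypothesis H : free_field_rel ap am c nu E.
Let hA := mode_module A.
Let pap := ffr_ap H.
Let pE := ffr_E H.
Let om := sf_om ap am.
Let pom : par false om := par_om H.
Let e2 := E (-2).
Let pe2 : par false e2 := pE (-2).
Let nunuE := nunuE_vec nu E.
Let nu2E := nu2E_vec nu E.

Definition omE : A := mode om (-1) e2.
Definition ff_fvec : A := (1 / 2) *: omE - nunuE + (1 / 2) *: nu2E.
Definition ff_hvec : A := 2 *: nu - (3 / 2) *: c.
Definition current (a : A) : A := mode a (-1) (E 1).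

Lemma om_E k m : 0 <= k -> mode om k (E m) = 0.
Proof.
move=> hk; rewrite (om_iter H (N1 := 0) (N2 := 0)); first by unroll.
  by move=> j hj; apply: (ffr_apE H); lia.
by move=> j hj; apply: (ffr_amE H).
Qed.

(** A fermionic mode squares to zero, and here one of the modes occurs twice. This removes the cubic
    term in [om_aZ]. *)
Lemma amap_sq_zero a u : (a = ap \/ a = am) -> mode a (-1) (mode am (-1) (mode ap (-1) u)) = 0.
Proof.
have sq (b : A) m v : (b = ap \/ b = am) -> mode b m (mode b m v) = 0.
  have z (x : A) : x = - x -> x = 0.
    move=> /eqP; rewrite -addr_eq0 -mulr2n -scaler_nat scaler_eq0 pnatr_eq0 /=.
    by move=> /eqP.
  by case=> ->; apply: z; [rewrite {1}(apap_comm H) | rewrite {1}(amam_comm H)].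
case=> ->; last by rewrite sq //; right.
by rewrite (apam_comm H) sq ?mode0r /= ?scale0r ?oppr0 ?addr0 //; left.
Qed.

Section OneCurrent.
Variable a : A.
Hypothesis ha : a = ap \/ a = am.

Let pa : par true a. Proof. by case: (a_comm H ha). Qed.
Let aE m n l u : mode a m (mode (E l) n u) = mode (E l) n (mode a m u).
Proof. by case: (a_comm H ha). Qed.
Let ac m n u : mode a m (mode c n u) = mode c n (mode a m u).
Proof. by case: (a_comm H ha). Qed.
Let anu m n u : mode a m (mode nu n u) = mode nu n (mode a m u).
Proof. by case: (a_comm H ha). Qed.

Lemma a_E m k : 0 <= k -> mode a k (E m) = 0.
Proof. by case: ha => -> hk; [apply: (ffr_apE H) | apply: (ffr_amE H)]. Qed.

Lemma a_even_comm (b : A) : par false b -> (forall n, 0 <= n -> mode a n b = 0) ->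
  forall m n u, mode a m (mode b n u) = mode b n (mode a m u).
Proof. by move=> pb h m n u; rewrite (comm_zero pa pb h) expr0 scale1r. Qed.

Lemma a_nunuE m n u : mode a m (mode nunuE n u) = mode nunuE n (mode a m u).
Proof.
apply: a_even_comm; first exact: par_nunuE H.
by move=> k hk; rewrite /nunuE /nunuE_vec /nuE_vec !anu a_E // !mode0r.
Qed.
Lemma a_nu2E m n u : mode a m (mode nu2E n u) = mode nu2E n (mode a m u).
Proof.
apply: a_even_comm; first exact: par_nu2E H.
by move=> k hk; rewrite /nu2E /nu2E_vec !anu a_E // !mode0r.
Qed.

Lemma omE_a_ge k m : 2 <= k -> mode omE k (mode a (-1) (E m)) = 0.
Proof.
move=> hk; rewrite /omE (iterN1 (N1 := 0) (N2 := 2) pom pe2).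
- unroll; rewrite !(om_a_comm H _ _ _ ha) !om_E // !mode0r -/om !add0r !modeNr !modeZr.
  rewrite -!aE !(ffr_EE H) ?mode0r ?scaler0 ?oppr0 ?addr0 //; lia.
- by move=> j hj; rewrite -aE (ffr_EE H) ?mode0r //; lia.
- by move=> j hj; rewrite (om_a_comm H _ _ _ ha) om_E ?mode0r ?a_E ?scaler0 ?subr0 //; lia.
Qed.

Lemma omE_a1 m : mode omE 1 (mode a (-1) (E m)) = mode a (-1) (E (-2 + m)).
Proof.
rewrite /omE (iterN1 (N1 := 0) (N2 := 2) pom pe2).
- unroll; rewrite !(om_a_comm H _ _ _ ha) !om_E // !mode0r !add0r !modeNr !modeZr -!aE.
  rewrite (ffr_EEN1 H) (ffr_EE H) // mode0r; lmod K.
- by move=> j hj; rewrite -aE (ffr_EE H) ?mode0r //; lia.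
- by move=> j hj; rewrite (om_a_comm H _ _ _ ha) om_E ?mode0r ?a_E ?scaler0 ?subr0 //; lia.
Qed.

Lemma omE_a0 m : mode omE 0 (mode a (-1) (E m)) =
  mode a (-2) (E (-2 + m)) - mode a (-1) (mode c (-1) (E (-2 + m))).
Proof.
rewrite /omE (iterN1 (N1 := 0) (N2 := 2) pom pe2).
- unroll; rewrite !(om_a_comm H _ _ _ ha) !om_E // !mode0r !add0r !modeNr !modeZr -!aE.
  rewrite (ffr_EEN1 H) (EN2 H) modeZr; lmod K.
- by move=> j hj; rewrite -aE (ffr_EE H) ?mode0r //; lia.
- by move=> j hj; rewrite (om_a_comm H _ _ _ ha) om_E ?mode0r ?a_E ?scaler0 ?subr0 //; lia.
Qed.

Lemma f_a_ge k m : 2 <= k -> mode ff_fvec k (mode a (-1) (E m)) = 0.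
Proof.
move=> hk; rewrite /ff_fvec !modeE omE_a_ge // -a_nunuE -a_nu2E.
by rewrite (nunuE_Em_ge H) // (nu2E_Em_ge H) // mode0r scaler0 oppr0 !addr0.
Qed.

(** The coefficient vanishes at [m = 1], which is why the currents are built on e^(c/2). *)
Lemma f_a1 m : mode ff_fvec 1 (mode a (-1) (E m)) =
  (1 / 2 - m%:~R * (m%:~R + 1) / 4) *: mode a (-1) (E (-2 + m)).
Proof.
rewrite /ff_fvec !modeE omE_a1 // -a_nunuE -a_nu2E (nunuE_Em1 H) (nu2E_Em1 H) !modeZr; lmod K.
Qed.

Lemma f_a0 m : mode ff_fvec 0 (mode a (-1) (E m)) =
  (1 / 2) *: mode a (-2) (E (-2 + m))
  + (m%:~R * (m%:~R + 1) / 4 - 1 / 2) *: mode a (-1) (mode c (-1) (E (-2 + m)))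
  - m%:~R *: mode a (-1) (mode nu (-1) (E (-2 + m))).
Proof.
rewrite /ff_fvec !modeE omE_a0 // -a_nunuE -a_nu2E (nunuE_Em0 H) (nu2E_Em0 H).
rewrite !(modeDr, modeZr, modeNr); lmod K.
Qed.

Lemma current_f0 : mode ff_fvec 0 (current a) =
  (1 / 2) *: mode a (-2) (E (-1)) - mode a (-1) (mode nu (-1) (E (-1))).
Proof. by rewrite /current f_a0; lmod K. Qed.

Lemma current_f k : 1 <= k -> mode ff_fvec k (current a) = 0.
Proof.
move=> hk; have [->|k1] := eqVneq k 1; last by apply: f_a_ge; lia.
by rewrite /current f_a1; lmod K.
Qed.

Lemma current_e k : 0 <= k -> mode (E 2) k (current a) = 0.
Proof. by move=> hk; rewrite /current -aE (ffr_EE H) // mode0r. Qed.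

Lemma current_h0 : mode ff_hvec 0 (current a) = current a.
Proof.
rewrite /ff_hvec !modeE /current -anu -ac (ffr_nuE0 H) (ffr_cE H) // mode0r modeZr; lmod K.
Qed.

Lemma current_h k : 1 <= k -> mode ff_hvec k (current a) = 0.
Proof.
move=> hk; rewrite /ff_hvec !modeE /current -anu -ac (ffr_nuE H) // (ffr_cE H); last by lia.
by rewrite !mode0r !scaler0 subr0.
Qed.

(* The singular vector which makes the Sugawara vector a conformal vector. *)
Lemma current_translation : translation (current a) =
  2 *: mode ff_fvec 0 (mode (E 2) (-1) (current a)) + 3 *: mode ff_hvec (-1) (current a).
Proof.
rewrite /current translation_mode (ffr_DE H) -aE (ffr_EEN1 H) f_a0 /ff_hvec !modeE -anu
  -ac; lmod K.
Qed.

Let w : A := mode nu (-1) (E (-1)).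
Let Z : A := E (-3).

Lemma a_w k : 0 <= k -> mode a k w = 0.
Proof. by move=> hk; rewrite /w anu a_E // mode0r. Qed.

Lemma om_w k : 0 <= k -> mode om k w = 0.
Proof.
have q b : (b = ap \/ b = am) -> forall k, 0 <= k -> mode b k w = 0.
  by case=> -> {}k hk; [have [_ _ _ ->] := a_comm H (or_introl _ (erefl ap)) | have [_ _ _
    ->] := a_comm H (or_intror _ (erefl am))];
  rewrite ?(ffr_apE H) ?(ffr_amE H) ?mode0r.
move=> hk; rewrite (om_iter H (N1 := 0) (N2 := 0)); first by unroll.
  by move=> j hj; apply: q; [left | lia].
by move=> j hj; apply: q; [right | lia].
Qed.

Lemma omE_a0_EN1 : mode omE 0 (mode a (-2) (E (-1))) =
  2 *: mode a (-3) Z - 2 *: mode a (-2) (mode c (-1) Z)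
  + mode a (-1) (mode c (-1) (mode c (-1) Z)) - mode a (-1) (mode c (-2) Z).
Proof.
rewrite /omE (iterN1 (N1 := 0) (N2 := 3) pom pe2).
- unroll; rewrite !(om_a_comm H _ _ _ ha) !om_E // !mode0r !add0r !modeNr !modeZr -!aE.
  rewrite (ffr_EEN1 H) (EN2 H) (E2N3 H) !(modeDr, modeNr, modeZr); lmod K.
- by move=> j hj; rewrite -aE (ffr_EE H) ?mode0r //; lia.
- by move=> j hj; rewrite (om_a_comm H _ _ _ ha) om_E ?mode0r ?a_E ?scaler0 ?subr0 //; lia.
Qed.

Lemma om_aZ : mode om (-1) (mode a (-1) Z) = mode a (-3) Z.
Proof.
rewrite (om_a_comm H _ _ _ ha) (om_iter H (N1 := 1) (N2 := 0)).
- unroll; rewrite amap_sq_zero //; lmod K.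
- by move=> j hj; apply: (ffr_apE H); lia.
- by move=> j hj; apply: (ffr_amE H).
Qed.

Lemma omE_a0_w : mode omE 0 (mode a (-1) w) =
  mode a (-3) Z + mode a (-2) (mode nu (-1) Z) - mode a (-2) (mode c (-1) Z)
  - mode a (-1) (mode nu (-1) (mode c (-1) Z))
  + (1 / 2) *: mode a (-1) (mode c (-1) (mode c (-1) Z)) - (1 / 2) *: mode a (-1) (mode c
    (-2) Z).
Proof.
rewrite /omE (iterN1 (N1 := 1) (N2 := 2) pom pe2).
- unroll; rewrite !(om_a_comm H _ _ _ ha) !om_w // !mode0r !add0r !modeNr !modeZr -!aE.
  rewrite (e2_w0 H) (e2_wN1 H) (e2_wN2 H) om_aZ !(modeDr, modeNr, modeZr); lmod K.
- by move=> j hj; rewrite -aE (e2_w_ge H) ?mode0r //; lia.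
- by move=> j hj; rewrite (om_a_comm H _ _ _ ha) om_w ?mode0r ?a_w ?scaler0 ?subr0 //; lia.
Qed.

(** Under the zero modes of sl(2) a current generates a doublet. The contributions of the three
    summands of [f] cancel monomial by monomial. *)
Lemma current_f0f0 : mode ff_fvec 0 (mode ff_fvec 0 (current a)) = 0.
Proof.
rewrite current_f0 !(modeDr, modeNr, modeZr) /ff_fvec !(modeDl, modeNl, modeZl).
rewrite omE_a0_EN1 omE_a0_w -!a_nunuE -!a_nu2E (nunuE_Em0 H) (nu2E_Em0 H).
rewrite (nunuE_w0 H) (nu2E_w0 H) !(modeDr, modeNr, modeZr); lmod K.
Qed.

Lemma current_sq k : 0 <= k -> mode (current a) k (current a) = 0.
Proof.
move=> hk; rewrite {1}/current (iterN1 (N1 := 0) (N2 := 0) pa (pE 1)); first by unroll.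
  by move=> j hj; rewrite /current -aE (ffr_EE H) ?mode0r //; lia.
move=> j hj; rewrite /current; case: ha => ->.
  by rewrite (apap_comm H) (ffr_apE H) ?mode0r ?oppr0.
by rewrite (amam_comm H) (ffr_amE H) ?mode0r ?oppr0.
Qed.

Lemma par_current : par true (current a). Proof. exact: (mode_par (-1) pa (pE 1)). Qed.

End OneCurrent.

Lemma current_pm k : 0 <= k -> mode (current ap) k (current am) = mode (E 1) (k - 2) (E 1).
Proof.
have aE := fun m n l u => let: And4 _ h _ _ := a_comm H (or_intror _ (erefl am)) in h m n l u.
move=> hk; rewrite {1}/current (iterN1 (N1 := 0) (N2 := 2) pap (pE 1)).
- unroll; rewrite /current !(apam_comm H) !(ffr_apE H) // !mode0r !oppr0 !add0r /=.
  by rewrite !scale0r !scale1r mode0r add0r; congr mode; lia.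
- by move=> j hj; rewrite /current -aE (ffr_EE H) ?mode0r //; lia.
move=> j hj; rewrite /current (apam_comm H) (ffr_apE H); last by lia.
have -> : (j - 1 == 0) = false by lia.
by rewrite mode0r scale0r oppr0 addr0.
Qed.

(** [(E 1)_(-2) (E 1)] is half of the translate of [E 2], so the coefficient is [- (m + n) / 2 + m].
    Its antisymmetry in [m] and [n] is what makes [xx_rel] close. *)
Lemma current_pm_comm m n u :
  mode (current ap) m (mode (current am) n u) + mode (current am) n (mode (current ap) m u)
  = ((m - n)%:~R / 2) *: mode (E 2) (m + n - 1) u.
Proof.
have p1 := par_current (or_introl _ (erefl ap)).
have p2 := par_current (or_intror _ (erefl am)).
have h j : 2%:Z <= j -> mode (current ap) j (current am) = 0.
  by move=> hj; rewrite current_pm ?(ffr_EE H) //; lia.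
have := Y_comm hA m n u p1 p2 h; rewrite /= expr1 scaleN1r opprK => ->.
rewrite !big_ord_recl big_ord0 /= !current_pm // binz0 binz1 (EN2 H) (ffr_EEN1 H).
have -> : (1%:~R / 2) *: mode c (-1) (E (1 + 1)) = (1 / 2) *: translation (E 2).
  rewrite (ffr_DE H); lmod K.
rewrite modeZl (Y_translation hA).
have -> : m + n - (bump 0 0)%:Z = m + n - 1 by [].
have -> : m + n - 0%:Z = m + n by lia.
lmod_coefs K; rewrite !(intrD, intrN); by field.
Qed.

Lemma current_sq_comm a m n u : (a = ap \/ a = am) ->
  mode (current a) m (mode (current a) n u) + mode (current a) n (mode (current a) m u) = 0.
Proof.
move=> ha; have pa := par_current ha.
by rewrite (comm_zero pa pa (current_sq ha)) expr1 scaleN1r addNr.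
Qed.

End SuperCurrents.

(** * Singular vectors in the free field algebra *)

(** Truncation starts this descending induction, by which annihilation operators are shown to vanish
    one after the other from the top index down to [L]. *)
Lemma int_down_ind (P : int -> Prop) (L : int) :
  (exists N : nat, forall j : int, N%:Z <= j -> P j) ->
  (forall M, L <= M -> (forall j, M < j -> P j) -> P M) ->
  forall j, L <= j -> P j.
Proof.
move=> [N hN] h.
have hk (k : nat) : forall j, L <= j -> N%:Z - k%:Z <= j -> P j.
  elim: k => [|k IH] j hL hj; first by apply: hN; move: hj; rewrite subr0.
  by apply: h => // i hi; apply: IH; lia.
by move=> j hj; apply: (hk (N + `|j|)%N); lia.
Qed.

Section Kernel.
Variables (K : numFieldType) (A : vsa K) (ap am c nu : A) (E : int -> A).
Hypothesis H : free_field_rel ap am c nu E.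
Let hA := mode_module A.
Let pap := ffr_ap H.
Let pam := ffr_am H.
Let pc := ffr_c H.
Let pnu := ffr_nu H.
Let pE := ffr_E H.

Definition ff_gens : set A :=
  [set v | [\/ v = ap, v = am, v = c | v = nu] \/ exists m, v = E m].

Lemma ff_gens_par v : ff_gens v -> exists p, par p v.
Proof. by move=> [[->|->|->|->]|[m ->]]; [exists true|exists true|exists false|exists
  false|exists false]. Qed.

(** Zero modes are superderivations of all products, so the generators suffice. *)
Lemma zero_mode p x : par p x -> (forall v, ff_gens v -> mode x 0 v = 0) ->
  forall u, generated ff_gens u -> mode x 0 u = 0.
Proof.
move=> px h; apply: (generated_par_ind (P := [set u | mode x 0 u = 0])).
- split=> [|d u v /= hu hv]; first exact: mode0r.
  by rewrite modeDr modeZr hu hv scaler0 addr0.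
- exact: mode_annihil.
- by move=> v hv; split; [apply: h | apply: ff_gens_par].
move=> q r a b n pa pb /= ha hb.
by rewrite (Y_comm0 hA _ _ px pa) hb ha mode0r mode0l scaler0 addr0.
Qed.

Lemma c0_gen u : generated ff_gens u -> mode c 0 u = 0.
Proof.
apply: (zero_mode pc) => v [[->|->|->|->]|[m ->]].
- have := a_even_comm H (or_introl _ (erefl ap)) pc (ffr_apc H) (-1) 0 vac.
  by rewrite mode_create mode_annihil // mode0r.
- have := a_even_comm H (or_intror _ (erefl am)) pc (ffr_amc H) (-1) 0 vac.
  by rewrite mode_create mode_annihil // mode0r.
- exact: (ffr_cc H).
- by rewrite (ffr_cnu H).
- exact: (ffr_cE H).
Qed.

Lemma ap0_gen u : generated ff_gens u -> mode ap 0 u = 0.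
Proof.
apply: (zero_mode pap) => v [[->|->|->|->]|[m ->]];
  by [apply: (ffr_apap H) | rewrite (ffr_apam H) | apply: (ffr_apc H) | apply: (ffr_apnu H)
    | apply: (ffr_apE H)].
Qed.

Lemma am0_gen u : generated ff_gens u -> mode am 0 u = 0.
Proof.
apply: (zero_mode pam) => v [[->|->|->|->]|[m ->]];
  by [apply: (ffr_amam H) | rewrite (amap H) | apply: (ffr_amc H) | apply: (ffr_amnu H) |
    apply: (ffr_amE H)].
Qed.

(* [cnil B u]: every monomial of length [B] in the [c_j], [j >= 1], kills [u].
   This local nilpotence yields a vector killed by all the [c_j], on which
   D e^(kc/2) = k/2 c_(-1) e^(kc/2) becomes a recursion for the modes of e^(kc/2). *)
Fixpoint cnil (B : nat) (u : A) : Prop :=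
  if B is B'.+1 then forall j : int, 1 <= j -> cnil B' (mode c j u) else u = 0.

Lemma cnil_subspace B : is_subspace (cnil B).
Proof.
elim: B => [|B [IH0 IH]]; split=> //=.
- by move=> d u v -> ->; rewrite scaler0 addr0.
- by move=> j _; rewrite mode0r.
by move=> d u v hu hv j hj; rewrite modeDr modeZr; apply: IH; [apply: hu | apply: hv].
Qed.

Lemma cnilS B u : cnil B u -> cnil B.+1 u.
Proof.
elim: B u => [|B IH] u; first by move=> -> j _; rewrite /= mode0r.
by move=> h j hj; apply: IH; apply: h.
Qed.

Lemma cnil_le B B' u : (B <= B')%N -> cnil B u -> cnil B' u.
Proof. by move=> /subnK <-; elim: (B' - B)%N => //= k IH /IH /cnilS. Qed.

Lemma cnil_ex_subspace : is_subspace [set u | exists B, cnil B u].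
Proof.
split=> [|d u v [B hu] [B' hv]]; first by exists 0%N.
exists (maxn B B'); have [_ h] := cnil_subspace (maxn B B'); apply: h.
  by apply: cnil_le hu; apply: leq_maxl.
by apply: cnil_le hv; apply: leq_maxr.
Qed.

Lemma cnil_mode b (kappa : int -> int -> K) B n u :
  (forall j n u, mode c j (mode b n u) = mode b n (mode c j u) + kappa j n *: u) ->
  cnil B u -> cnil B.+1 (mode b n u).
Proof.
move=> h; elim: B u => [|B IH] u hu; first by rewrite hu mode0r; case: (cnil_subspace 1).
move=> j hj; rewrite h; have hS := cnil_subspace B.+1.
by apply: (subspaceD hS); [apply: IH; apply: hu | apply: (subspaceZ _ hS)].
Qed.

Lemma cnil_gen u : generated ff_gens u -> exists B, cnil B u.
Proof.
move=> hu; rewrite -[u]mode_create.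
suff h : forall n v, (exists B, cnil B v) -> exists B, cnil B (mode u n v).
  by apply: h; exists 1%N => j hj; rewrite /= mode_annihil //; lia.
move: u hu; apply: (@generated_par_ind K A ff_gens
  [set u | forall n v, (exists B, cnil B v) -> exists B, cnil B (mode u n v)]).
- split=> [n v _|d u u' hu hu' n v hv].
    by exists 0%N; rewrite mode0l.
  rewrite modeDl modeZl; have [_ h] := cnil_ex_subspace; apply: h.
    exact: hu.
  exact: hu'.
- by move=> n v hv; rewrite mode_vac; case: ifP => _ //; exists 0%N.
- move=> b hb; split; last exact: ff_gens_par.
  suff [kappa hk] : exists kappa : int -> int -> K, forall j n u,
      mode c j (mode b n u) = mode b n (mode c j u) + kappa j n *: u.
    by move=> n v [B hv]; exists B.+1; apply: cnil_mode hk hv.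
  case: hb => [[->|->|->|->]|[m ->]].
  + exists (fun _ _ => 0) => j n u.
    by rewrite (a_even_comm H (or_introl _ (erefl ap)) pc (ffr_apc H)) scale0r addr0.
  + exists (fun _ _ => 0) => j n u.
    by rewrite (a_even_comm H (or_intror _ (erefl am)) pc (ffr_amc H)) scale0r addr0.
  + by exists (fun _ _ => 0) => j n u; rewrite (cc_comm H) scale0r addr0.
  + exists (fun j n => if j + n == 0 then j%:~R else 0) => j n u; exact: (cnu_comm H).
  + by exists (fun _ _ => 0) => j n u; rewrite (cE_comm H) scale0r addr0.
move=> p q a b n pa pb ha hb k v hv.
refine (Y_iter_mem hA cnil_ex_subspace pa pb _ _) => j.
  by apply: ha; apply: hb.
by apply: hb; apply: ha.
Qed.

Definition c_free (u : A) := forall j : int, 0 <= j -> mode c j u = 0.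

(** Here [E_rel] has no right side left and reads [M (E k)_(M-1) u = 0]. The descent is blocked only
    at [M = 0], between the modes 0 and -1; [E_inj] supplies the mode -1 as a hypothesis. *)
Lemma E_down k u M : c_free u -> M != 0 -> (forall j, M <= j -> mode (E k) j u = 0) ->
  mode (E k) (M - 1) u = 0.
Proof.
move=> hu hM h; have := @E_rel _ _ _ _ _ _ _ H k M u 0 0; unroll => e.
have {}e : - (M%:~R *: mode (E k) (M - 1) u) = 0.
  by apply: e => j hj; [apply: h; lia | apply: hu].
move/eqP: e; rewrite oppr_eq0 scaler_eq0 intr_eq0 (negbTE hM) /= => /eqP //.
Qed.

Lemma E_c_free k u n : c_free u -> 0 <= n -> mode (E k) n u = 0.
Proof.
move=> hu; apply: (int_down_ind (P := fun n => mode (E k) n u = 0)).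
  exact: (Y_trunc hA).
move=> M hM h; have := @E_down k u (M + 1) hu; rewrite addrK; apply; first by lia.
by move=> j hj; apply: h; lia.
Qed.

(* By [E_down] all modes vanish, whereas e^(-kc/2)_(-1) e^(kc/2) = vac. *)
Lemma E_inj k u : c_free u -> mode (E k) (-1) u = 0 -> u = 0.
Proof.
move=> hu h1.
have hE n : mode (E k) n u = 0.
  have hn : forall i : nat, forall n, - (1 + i%:Z) <= n -> mode (E k) n u = 0.
    elim=> [|i IH] j hj.
      have [j0|j0] := leP 0 j; first exact: E_c_free.
      by have -> : j = -1 by lia.
    have [->|nj] := eqVneq j (- (1 + i%:Z) - 1); last by apply: IH; lia.
    by apply: E_down => //; lia.
  by apply: (hn `|n|%N); lia.
have e : mode (mode (E (- k)) (-1) (E k)) (-1) u = u.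
  by rewrite (ffr_EEN1 H) addNr (ffr_E0 H) mode_vac.
rewrite -e; have z : is_subspace [set u : A | u = 0].
  by split=> // d x y -> ->; rewrite scaler0 addr0.
refine (Y_iter_mem hA z (pE _) (pE _) _ _) => j /=.
  by rewrite hE mode0r.
by rewrite (EE_comm H) hE mode0r.
Qed.

(** The vectors [c_j u] satisfy the same hypotheses with a smaller [B], hence vanish; then [u] is
    [c_free] and [E_inj] applies. *)
Lemma cnil_zero B u : cnil B u -> mode c 0 u = 0 ->
  (forall n, -1 <= n -> mode (E 2) n u = 0) -> u = 0.
Proof.
elim: B u => [//|B IH] u hB h0 he.
apply: (@E_inj 2) => [j hj|]; last exact: he.
have [->//|j0] := eqVneq j 0; apply: IH.
- by apply: hB; lia.
- by rewrite (cc_comm H) h0 mode0r.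
- by move=> n hn; rewrite -(cE_comm H) he // mode0r.
Qed.

(* If [c_j u = 0] for [j > M], then [D e^c = c_(-1) e^c] gives [e_(-1) c_M u = 0],
   so that [c_M u] is killed by the [e_n] with [n >= -1]. *)
Lemma c_free_of_e u : generated ff_gens u ->
  (forall n, 0 <= n -> mode (E 2) n u = 0) -> c_free u.
Proof.
move=> gu he j hj; have c0 := c0_gen gu; have [B hB] := cnil_gen gu.
have [->//|j0] := eqVneq j 0.
have {hj j0} : 1 <= j by lia.
move: j; apply: (int_down_ind (P := fun j => mode c j u = 0)).
  exact: (Y_trunc hA).
move=> M hM h; case: B hB => [->|B hB]; first by rewrite mode0r.
apply: (cnil_zero (hB M hM)); first by rewrite (cc_comm H) c0 mode0r.
move=> n hn; rewrite -(cE_comm H).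
have [n0|n0] := leP 0 n; first by rewrite he // mode0r.
have -> : n = -1 by lia.
case: M hM h => // M hM h.
have := @E_rel _ _ _ _ _ _ _ H 2 M%:Z u 0 M.+1; rewrite he; last by lia.
rewrite scaler0 oppr0 big_nil add0r.
rewrite -[iota 0 M.+1]/(index_iota 0 M.+1) big_nat_recr //= big_nat big1 ?add0r.
  move=> e; have {}e : 0 = (2%:~R / 2) *: mode (E 2) (M%:Z - 1 - M%:Z) (mode c M%:Z u).
    by apply: e => i hi; [apply: he; lia | apply: h; lia].
  have e1 : M%:Z - 1 - M%:Z = -1 by lia.
  by rewrite (cE_comm H) -[RHS]scale1r {}e e1; lmod K.
by move=> i /andP[_ hi]; rewrite -(cE_comm H) he ?mode0r //; lia.
Qed.

(** If the [a_j] with [j > M] kill [u], all terms of the [M]-th mode of the current vanish except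
    [(E 1)_(-1) a_M u], and [E_inj] cancels [(E 1)_(-1)]. *)
Lemma a_zero a u : (a = ap \/ a = am) -> c_free u ->
  (forall m, 1 <= m -> mode (current E a) m u = 0) ->
  forall m, 1 <= m -> mode a m u = 0.
Proof.
move=> ha hu hG; have [pa aE ac _] := a_comm H ha.
apply: (int_down_ind (P := fun m => mode a m u = 0)); first exact: (Y_trunc hA).
move=> M hM h; apply: (@E_inj 1) => [j hj|]; first by rewrite -ac hu // mode0r.
case: M hM h => // M hM h; have := hG M hM.
rewrite /current (iterN1 (N1 := 0) (N2 := M.+1) pa (pE 1)).
- rewrite -[iota 0 M.+1]/(index_iota 0 M.+1) big_nil add0r andbF expr0 scale1r big_nat_recr
  //= big_nat big1 ?add0r.
    by have -> : M%:Z - 1 - M%:Z = -1 by lia.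
  by move=> i /andP[_ hi]; rewrite -aE E_c_free ?mode0r //; lia.
- by move=> j hj; apply: E_c_free => //; lia.
- by move=> j hj; apply: h; lia.
Qed.

(** The fermionic part of [f_1] drops out and [nu] contributes only its zero mode. By [E_inj], a
    vanishing [f_1 u] then forces the quadratic polynomial in [nu_0] to kill [u]. *)
Lemma f1_c_free u : c_free u -> (forall j, 1 <= j -> mode nu j u = 0) ->
  (forall j, 0 <= j -> mode ap j u = 0) -> (forall j, 0 <= j -> mode am j u = 0) ->
  mode (ff_fvec ap am nu E) 1 u =
    - mode (E (-2)) (-1) (mode nu 0 (mode nu 0 u) + (1 / 2) *: mode nu 0 u).
Proof.
move=> hu hn hp hm; have pe2 := pE (-2).
have hom j : 0 <= j -> mode (sf_om ap am) j u = 0.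
  move=> hj; rewrite (om_iter H (N1 := 0) (N2 := 0)); first by unroll.
    by move=> i hi; apply: hp; lia.
  by move=> i hi; apply: hm.
have -> : ff_fvec ap am nu E = (1 / 2) *: omE ap am E - nunuE_vec nu E + (1 / 2) *:
  nu2E_vec nu E by [].
have cfn : c_free (mode nu 0 u).
  move=> j hj; rewrite (cnu_comm H) hu // mode0r add0r addr0.
  by case: eqP => [->|_]; rewrite scale0r.
have hn' j : 1 <= j -> mode nu j (mode nu 0 u) = 0.
  move=> hj; rewrite (nunu_comm H) hn // mode0r add0r addr0.
  have -> : (j == 0) = false by lia.
  by rewrite scale0r.
have nuEE v k : c_free v -> (forall j, 1 <= j -> mode nu j v = 0) -> 0 <= k ->
    mode (nuE_vec nu E) k v = mode (E (-2)) (k - 1) (mode nu 0 v).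
  move=> hv hnv hk; rewrite /nuE_vec (iterN1 (N1 := 0) (N2 := 1) pnu pe2) //.
    by unroll; congr mode; lia.
  by move=> j hj; apply: E_c_free => //; lia.
rewrite !modeE.
have -> : mode (omE ap am E) 1 u = 0.
  rewrite /omE (iterN1 (N1 := 0) (N2 := 0) (par_om H) pe2) //; first by unroll.
  by move=> j hj; apply: E_c_free => //; lia.
have -> : mode (nunuE_vec nu E) 1 u = mode (E (-2)) (-1) (mode nu 0 (mode nu 0 u)).
  rewrite /nunuE_vec (iterN1 (N1 := 0) (N2 := 1) pnu (par_nuE H)) //.
    by unroll; rewrite nuEE.
  by move=> j hj; rewrite nuEE ?E_c_free //; lia.
have -> : mode (nu2E_vec nu E) 1 u = - mode (E (-2)) (-1) (mode nu 0 u).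
  rewrite /nu2E_vec (iterN2 (N1 := 0) (N2 := 1) pnu pe2) //; first by unroll.
  by move=> j hj; apply: E_c_free => //; lia.
lmod K.
Qed.

Lemma singular_h0 u : generated ff_gens u ->
  (forall n, 0 <= n -> mode (E 2) n u = 0) ->
  (forall n, 1 <= n -> mode (ff_hvec c nu) n u = 0) ->
  mode (ff_fvec ap am nu E) 1 u = 0 ->
  (forall m, 1 <= m -> mode (current E ap) m u = 0) ->
  (forall m, 1 <= m -> mode (current E am) m u = 0) ->
  mode (ff_hvec c nu) 0 (mode (ff_hvec c nu) 0 u) + mode (ff_hvec c nu) 0 u = 0.
Proof.
move=> gu he hh hf hp hm; have cu := c_free_of_e gu he.
have hn j : 1 <= j -> mode nu j u = 0.
  move=> hj; have := hh j hj; rewrite /ff_hvec !modeE cu; last by lia.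
  by rewrite scaler0 subr0 => /eqP; rewrite scaler_eq0 pnatr_eq0 /= => /eqP.
have hap j : 0 <= j -> mode ap j u = 0.
  move=> hj; have [->|j0] := eqVneq j 0; first exact: ap0_gen.
  by apply: (a_zero (or_introl _ (erefl ap)) cu hp); lia.
have ham j : 0 <= j -> mode am j u = 0.
  move=> hj; have [->|j0] := eqVneq j 0; first exact: am0_gen.
  by apply: (a_zero (or_intror _ (erefl am)) cu hm); lia.
have h0 : mode nu 0 (mode nu 0 u) + (1 / 2) *: mode nu 0 u = 0.
  apply: (@E_inj (-2)); last by apply: oppr_inj; rewrite oppr0 -f1_c_free.
  have cn : forall v, c_free v -> c_free (mode nu 0 v).
    move=> v hv j hj; rewrite (cnu_comm H) hv // mode0r add0r addr0.
    by case: eqP => [->|_]; rewrite scale0r.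
  by move=> j hj; rewrite modeDr modeZr !cn // ?scaler0 ?addr0 //; apply: cn.
rewrite /ff_hvec !modeE (cnu_comm H) cu // !mode0r /= !scale0r.
(* [h_0] acts as [2 nu_0] on [u] and on [nu_0 u], whence the factor 4. *)
transitivity (4%:R *: (mode nu 0 (mode nu 0 u) + (1 / 2) *: mode nu 0 u));
  last by rewrite h0 scaler0.
lmod K.
Qed.

End Kernel.

(** * The algebra SF(1) (x) Pi(0)^{1/2} *)

Section FreeFieldRealization.
Variable K : numFieldType.

Lemma fsbig_one (I : choiceType) (M : zmodType) (F : I -> M) (P : set I) i0 :
  P i0 -> (forall i, P i -> i <> i0 -> F i = 0) -> \sum_(i \in P) F i = F i0.
Proof.
move=> P0 h; rewrite -[RHS](@fsbig_set1 _ _ +%R _ i0 F); symmetry.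
apply: fsbig_widen => [j -> //|j [Pj /= hj]]; exact: h.
Qed.

(** The generators of a subalgebra are known only through their images, so their parity has to be
    read off in the larger algebra. *)
Lemma vsa_hom_reflect_par (V W : vsa K) (phi : V -> W) p a :
  is_vsa_hom phi -> injective phi -> par p (phi a) -> par p a.
Proof.
move=> [hl hp _ _] inj ha; have [a0 [a1 [h0 h1 ea]]] := @par_sum _ V a.
have e : phi a = phi a0 + phi a1 by rewrite ea (linD hl).
have hW := fun p => par_subspace W p.
have z b : phi b = 0 -> b = 0 by move=> hb; apply: inj; rewrite hb (lin0 hl).
case: p ha => ha.
  have a00 : a0 = 0.
    apply: z; apply: par_direct; first exact: hp.
    have -> : phi a0 = phi a - phi a1 by rewrite e addrK.
    by apply: subspaceB => //; apply: hp.
  by rewrite ea a00 add0r.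
have a10 : a1 = 0.
  apply: z; apply: par_direct; last exact: hp.
  have -> : phi a1 = phi a - phi a0 by rewrite e addrC addKr.
  by apply: subspaceB => //; apply: hp.
by rewrite ea a10 addr0.
Qed.

(** * Symplectic fermions inside the Clifford algebra *)

Section SymplecticFermions.
Variable A : free_field K.
Let F := ff_F A.
Let psip : F := ff_psip A.
Let psim : F := ff_psim A.
Let X : ff_SF A := ff_ap A.
Let Y : ff_SF A := ff_am A.
Let inc : ff_SF A -> F := @ff_SF_incl _ A.

Let hom : is_vsa_hom inc. Proof. by case: (ff_SFP A). Qed.
Let inj : injective inc. Proof. by case: (ff_SFP A). Qed.
Let incm a n b : inc (mode a n b) = mode (inc a) n (inc b). Proof. by case: hom. Qed.
Let inc_vac : inc vac = vac. Proof. by case: hom. Qed.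
Let inc_lin : linear inc. Proof. by case: hom. Qed.
Let incX : inc X = psim := ff_apE A.
Let incY : inc Y = translation psip := ff_amE A.

Let cl_pp m n (u : F) : mode psip m (mode psip n u) = - mode psip n (mode psip m u).
Proof. by case: (ff_FP A) => _ _ /(_ m n u)[_ /eqP + _] _; rewrite addr_eq0 => /eqP. Qed.
Let cl_mm m n (u : F) : mode psim m (mode psim n u) = - mode psim n (mode psim m u).
Proof. by case: (ff_FP A) => _ _ /(_ m n u)[_ _ /eqP +] _; rewrite addr_eq0 => /eqP. Qed.

Let cl_mp m n (u : F) : mode psim n (mode psip m u) =
  (if m + n == -1 then u else 0) - mode psip m (mode psim n u).
Proof. by case: (ff_FP A) => _ _ /(_ m n u)[<- _ _] _; rewrite addrC addKr. Qed.

Lemma par_ff_ap : par true X.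
Proof.
by apply: (vsa_hom_reflect_par hom inj); rewrite incX; case: (ff_FP A) => _ [].
Qed.
Lemma par_ff_am : par true Y.
Proof.
apply: (vsa_hom_reflect_par hom inj); rewrite incY /translation.
by apply: (mode_par (p := true) (q := false)); [case: (ff_FP A) => _ [] | apply: vac_even |].
Qed.

Lemma sf_apap n : 0 <= n -> mode X n X = 0.
Proof.
move=> hn; apply: inj; rewrite incm incX (lin0 inc_lin) -{2}[psim]mode_create.
by rewrite cl_mm mode_annihil // mode0r oppr0.
Qed.

Lemma sf_amam n : 0 <= n -> mode Y n Y = 0.
Proof.
move=> hn; apply: inj; rewrite incm incY (lin0 inc_lin) (Y_translation (mode_module F)).
have [->|n0] := eqVneq n 0; first by rewrite scale0r oppr0.
rewrite /translation cl_pp mode_annihil; last by lia.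
by rewrite mode0r oppr0 scaler0 oppr0.
Qed.

Lemma sf_apam n : 0 <= n -> mode X n Y = if n == 1 then 1 *: vac else 0.
Proof.
move=> hn; apply: inj; rewrite incm incX incY /translation.
rewrite cl_mp (mode_annihil psim hn) mode0r subr0.
have -> : (-2 + n == -1) = (n == 1) by lia.
by case: ifP => _; rewrite ?(lin0 inc_lin) // scale1r inc_vac.
Qed.

Lemma sf_omega : ff_omega A = mode Y (-1) X.
Proof.
have e : inc (ff_omega A) = _ := ff_omegaE A.
apply: inj; rewrite incm incX incY e (Y_translation (mode_module F)) mode_create.
by rewrite scaleN1r opprK.
Qed.

Lemma sf_vac_neq0 : (vac : ff_SF A) != 0.
Proof.
have [v0 _ _ _] := ff_FP A; apply/eqP => /(congr1 inc).
by rewrite inc_vac (lin0 inc_lin); apply/eqP.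
Qed.

End SymplecticFermions.

(** * The algebra Pi(0)^{1/2} *)

Section Lattice.
Variable A : free_field K.
Let M1 := ff_M1 A.
Let c : M1 := ff_c A.
Let d : M1 := ff_d A.
Let P := ff_Pi A.
Let t : int -> M1 -> P := @ff_exp _ A.

Let h_cd m n (u : M1) : mode c m (mode d n u) =
  mode d n (mode c m u) + (if m + n == 0 then 2 * m%:~R else 0) *: u.
Proof. by case: (ff_M1P A) => _ _ /(_ m n u)[<- _ _] _; rewrite addrC subrK. Qed.
Let h_cc m n (u : M1) : mode c m (mode c n u) = mode c n (mode c m u).
Proof. by case: (ff_M1P A) => _ _ /(_ m n u)[_ /eqP + _] _; rewrite subr_eq0 => /eqP. Qed.
Let h_dd m n (u : M1) : mode d m (mode d n u) = mode d n (mode d m u).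
Proof. by case: (ff_M1P A) => _ _ /(_ m n u)[_ _ /eqP +] _; rewrite subr_eq0 => /eqP. Qed.

Let t_lin m : linear (t m). Proof. by case: (ff_PiP A) => -[]. Qed.
Let t_par m u : par false (t m u). Proof. by case: (ff_PiP A). Qed.
Let t_vac : vac = t 0 vac. Proof. by case: (ff_PiP A). Qed.
Let t_c m n u : mode (t 0 c) n (t m u) = t m (mode c n u).
Proof. by case: (ff_PiP A) => _ _ _ /(_ m n u)[]. Qed.
Let t_d m n u : mode (t 0 d) n (t m u) =
  t m (mode d n u + (if n == 0 then m%:~R else 0) *: u).
Proof. by case: (ff_PiP A) => _ _ _ /(_ m n u)[]. Qed.

(** The universal property of the direct sum provides the projection onto the summand [m = 0], which
    detects the vacuum. *)
Lemma pi_vac_neq0 : (vac : P) != 0.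
Proof.
have [v0 _ _ _] := ff_M1P A.
have [[_ univ] _ _ _ _] := ff_PiP A.
have [|psi [[lpsi hpsi] _]] := univ M1 (fun m u => if m == 0 then u else 0).
  by move=> m k u v; case: ifP => _ //; rewrite scaler0 addr0.
apply/eqP => /(congr1 psi); rewrite (lin0 lpsi) {1}t_vac hpsi eqxx.
by apply/eqP.
Qed.

Lemma op_pow_annihilated (f : nat -> M1 -> M1) r n u :
  (forall i, f i 0 = 0) -> (forall i, (0 < i)%N -> f i u = 0) ->
  op_pow f r n u = if (r == 0%N) && (n == 0%N) then u else 0.
Proof.
move=> f0 h; elim: r n => [|r IH] n //=; rewrite big_nat big1 // => i /andP[hi _].
by rewrite IH; case: ifP => _; [apply: h | apply: f0].
Qed.

Lemma op_exp_annihilated (f : nat -> M1 -> M1) n u :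
  (forall i, f i 0 = 0) -> (forall i, (0 < i)%N -> f i u = 0) ->
  op_exp f n u = if n == 0%N then u else 0.
Proof.
move=> f0 h; rewrite /op_exp big_nat_recl // big_nat big1 ?addr0 => [|i _]; last first.
  by rewrite op_pow_annihilated // scaler0.
by rewrite op_pow_annihilated // fact0 invr1 scale1r.
Qed.

(** The annihilation half of the vertex operator is trivial on the vacuum, so of all pairs only
    [(- n - 1, 0)] contributes; [absz (n + 1)] is this [- n - 1]. *)
Lemma t_exp m l n : mode (t m vac) n (t l vac) =
  if n <= -1 then t (m + l) (op_exp (creation c m) (absz (n + 1)) vac) else 0.
Proof.
case: (ff_PiP A) => _ _ _ _ /(_ m l n vac) ->.
have ann j : op_exp (annihilation c m) j vac = if j == 0%N then vac else 0.
  apply: op_exp_annihilated => i; first by rewrite /annihilation mode0r scaler0.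
  by move=> hi; rewrite /annihilation mode_annihil ?scaler0.
have exp0 k : op_exp (creation c m) k 0 = 0.
  rewrite op_exp_annihilated ?if_same // => i; rewrite /creation mode0r scaler0 //.
case: ifP => hn.
  rewrite (@fsbig_one _ _ _ _ ((absz (n + 1)), 0%N)) /=; first by rewrite ann.
    by lia.
  move=> [i j] /= hij ne; rewrite ann; case: eqP => [j0|_]; last exact: exp0.
  by case: ne; rewrite j0; congr pair; move: hij; rewrite j0; lia.
rewrite fsbig1; first exact: (lin0 (t_lin _)).
move=> [i j] /= hij; rewrite ann.
by case: eqP => [j0|_]; [move: hij; rewrite j0; lia | exact: exp0].
Qed.

Lemma pi_EE m l n : 0 <= n -> mode (ff_E A m) n (ff_E A l) = 0.
Proof. by move=> hn; rewrite /ff_E t_exp; case: ifP => //; lia. Qed.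

Lemma pi_EEN1 m l : mode (ff_E A m) (-1) (ff_E A l) = ff_E A (m + l).
Proof. by rewrite /ff_E t_exp /= /op_exp big_nat1 fact0 invr1 scale1r. Qed.

Lemma pi_E0 : ff_E A 0 = vac. Proof. by rewrite t_vac. Qed.

Lemma pi_DE m : translation (ff_E A m) = (m%:~R / 2) *: mode (t 0 c) (-1) (ff_E A m).
Proof.
rewrite /translation [X in mode _ _ X]t_vac /ff_E t_exp t_c /= addr0 -(linZ (t_lin m));
  congr (t _ _).
rewrite /op_exp !big_nat_recr //= big_geq // add0r fact0 invr1 scale1r /= add0r.
rewrite scale1r big_ltn // big_geq // addr0 /= /creation divr1.
by congr (_ *: mode _ _ _).
Qed.

Lemma pi_cc n : 0 <= n -> mode (t 0 c) n (t 0 c) = 0.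
Proof. by move=> hn; rewrite t_c -[X in mode c n X]mode_create h_cc mode_annihil // mode0r
  (lin0 (t_lin _)). Qed.

Lemma pi_nuE_ n m u : mode (ff_nu A) n (t m u) =
  t m (2^-1 *: mode d n u - (level K / 4) *: mode c n u)
   + (if n == 0 then m%:~R / 2 else 0) *: t m u.
Proof.
have -> : ff_nu A = 2^-1 *: t 0 d - (level K / 4) *: t 0 c.
  by rewrite -!(linZ (t_lin 0)) -(linB (t_lin 0)).
rewrite !modeE t_c t_d.
rewrite (linD (t_lin m)) (linB (t_lin m)) !(linZ (t_lin m)).
by case: ifP => _; lmod K.
Qed.

Lemma pi_cE n m : 0 <= n -> mode (t 0 c) n (ff_E A m) = 0.
Proof. by move=> hn; rewrite t_c mode_annihil // (lin0 (t_lin _)). Qed.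

Lemma pi_nuE n m : 0 <= n ->
  mode (ff_nu A) n (ff_E A m) = (if n == 0 then m%:~R / 2 else 0) *: ff_E A m.
Proof.
by move=> hn; rewrite pi_nuE_ !mode_annihil // !scaler0 subr0 (lin0 (t_lin _)) add0r.
Qed.

Lemma pi_cnu n : 0 <= n -> mode (t 0 c) n (ff_nu A) = if n == 1 then 1 *: vac else 0.
Proof.
move=> hn; rewrite /ff_nu t_c !modeE -[X in mode c n X]mode_create h_cd.
rewrite -[X in - (_ *: mode c n X)]mode_create h_cc (mode_annihil c hn) !mode0r add0r
  scaler0 subr0.
have -> : (n + -1 == 0) = (n == 1) by lia.
case: eqP => [->|_]; last by rewrite scale0r scaler0 (lin0 (t_lin _)).
by rewrite scalerA t_vac -(linZ (t_lin 0)); congr (t _ (_ *: _)); field.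
Qed.

Lemma pi_nunu n : 0 <= n -> mode (ff_nu A) n (ff_nu A) = if n == 1 then (3 / 4) *: vac else 0.
Proof.
move=> hn; rewrite {2}/ff_nu pi_nuE_ mul0r if_same scale0r addr0 !modeE.
have e1 : mode d n d = 0 by rewrite -[X in mode d n X]mode_create h_dd mode_annihil // mode0r.
have e2 : mode c n c = 0 by rewrite -[X in mode c n X]mode_create h_cc mode_annihil // mode0r.
have en : (n + -1 == 0) = (n == 1) by lia.
have e3 : mode c n d = (if n == 1 then 2 else 0) *: vac.
  rewrite -[X in mode c n X]mode_create h_cd mode_annihil // mode0r add0r en.
  by case: eqP => [->|//]; rewrite mulr1.
have e4 : mode d n c = (if n == 1 then 2 else 0) *: vac.
  rewrite -[X in mode d n X]mode_create.
  have := h_cd (-1) n vac; rewrite (mode_annihil d hn) mode0r => /esym/eqP.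
  rewrite addr_eq0 => /eqP ->; rewrite [-1 + n]addrC en -scaleNr.
  by case: ifP => _; congr (_ *: _); field.
rewrite e1 e2 e3 e4 t_vac; case: ifP => _; rewrite ?scale0r ?scaler0 ?subrr ?(lin0 (t_lin
  _)) //.
  by rewrite -(linZ (t_lin 0)); congr (t _ _); rewrite /level; lmod K.
by rewrite !scaler0 subr0 (lin0 (t_lin _)).
Qed.

Lemma pi_par_nu : par false (ff_nu A). Proof. exact: t_par. Qed.
Lemma pi_par_E m : par false (ff_E A m). Proof. exact: t_par. Qed.

End Lattice.

(** * The tensor product and the vectors e, h, f, G *)

Section Tensor.
Variable A : free_field K.
Let t : ff_SF A -> ff_Pi A -> A := @ff_tens _ A.

Let t_l b : linear (t^~ b). Proof. by case: (ff_algP A) => -[[]]. Qed.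
Let t_r a : linear (t a). Proof. by case: (ff_algP A) => -[[]]. Qed.
Let t_vac : vac = t vac vac. Proof. by case: (ff_algP A). Qed.
Let t_par p q a b : par p a -> par q b -> par (p (+) q) (t a b).
Proof. by case: (ff_algP A) => _ h _ _; apply: h. Qed.
Let t_mode p q a b u v n : par q b -> par p u -> mode (t a b) n (t u v) =
  (-1) ^+ (q && p) *: \sum_(i \in [set: int]) t (mode a i u) (mode b (n - 1 - i) v).
Proof. by case: (ff_algP A) => _ _ _; apply. Qed.

Lemma tens_L p a n u v : par p u -> mode (t a vac) n (t u v) = t (mode a n u) v.
Proof.
move=> pu; rewrite (t_mode _ _ _ (@vac_even _ _) pu) expr0 scale1r.
rewrite (@fsbig_one _ _ _ _ n) => [|//|i _ hi]; last first.
  by rewrite mode_vac (_ : (_ == _) = false) ?(lin0 (t_r _)) //; apply/eqP; lia.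
by rewrite mode_vac (_ : (_ == _) = true) //; apply/eqP; lia.
Qed.

Lemma tens_R b n v : par false b -> mode (t vac b) n (t vac v) = t vac (mode b n v).
Proof.
move=> pb; rewrite (t_mode _ _ _ pb (@vac_even _ _)) expr0 scale1r.
rewrite (@fsbig_one _ _ _ _ (-1)) => [|//|i _ hi]; last first.
  by rewrite mode_vac (_ : (_ == _) = false) ?(lin0 (t_l _)) //; apply/eqP.
by rewrite mode_vac eqxx; congr (t _ (mode _ _ _)); lia.
Qed.

Lemma tens_prod a b : t a b = mode (t a vac) (-1) (t vac b).
Proof. by rewrite (tens_L _ _ _ (@vac_even _ _)) mode_create. Qed.

Lemma ff_vac_neq0 : (vac : A) != 0.
Proof.
have [l [llin l1]] := dual_vector (sf_vac_neq0 A).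
have [[_ univ] _ _ _] := ff_algP A.
have [| |psi [[lpsi hpsi] _]] := univ (ff_Pi A) (fun a b => l a *: b).
- by move=> b k u v; rewrite llin scalerDl scalerA.
- by move=> a k u v; rewrite scalerDr !scalerA mulrC.
apply/eqP => /(congr1 psi); rewrite (lin0 lpsi) t_vac hpsi l1 scale1r.
by apply/eqP; apply: pi_vac_neq0.
Qed.

Definition ffA_ap : A := t (ff_ap A) vac.
Definition ffA_am : A := t (ff_am A) vac.
Definition ffA_c : A := t vac (ff_exp 0 (ff_c A)).
Definition ffA_nu : A := t vac (ff_nu A).
Definition ffA_E (m : int) : A := t vac (ff_E A m).

Lemma free_field_relP : free_field_rel ffA_ap ffA_am ffA_c ffA_nu ffA_E.
Proof.
have pc : par false (ff_exp 0 (ff_c A)) by case: (ff_PiP A).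
have pnu := pi_par_nu A; have pE := pi_par_E A.
have v0 : par false (vac : ff_SF A) := @vac_even _ _.
have v0' : par false (vac : ff_Pi A) := @vac_even _ _.
have pap := par_ff_ap A; have pam := par_ff_am A.
have L0 (a : ff_SF A) n x : 0 <= n -> mode (t a vac) n (t vac x) = 0.
  by move=> hn; rewrite (tens_L _ _ _ v0) mode_annihil // (lin0 (t_l _)).
have R0 : t vac 0 = 0 := lin0 (t_r _).
split.
- exact: (t_par pap v0').
- exact: (t_par pam v0').
- exact: (t_par v0 pc).
- exact: (t_par v0 pnu).
- by move=> m; apply: (t_par v0 (pE m)).
- by move=> n hn; rewrite /ffA_ap (tens_L _ _ _ pap) sf_apap // (lin0 (t_l _)).
- by move=> n hn; rewrite /ffA_am (tens_L _ _ _ pam) sf_amam // (lin0 (t_l _)).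
- move=> n hn; rewrite /ffA_ap /ffA_am (tens_L _ _ _ pam) sf_apam //.
  by case: ifP => _; rewrite ?scale1r ?t_vac // (lin0 (t_l _)).
- by move=> n hn; rewrite /ffA_c tens_R // pi_cc.
- move=> n hn; rewrite /ffA_nu tens_R // pi_nunu //.
  by case: ifP => _ //; rewrite (linZ (t_r _)) t_vac.
- move=> n hn; rewrite /ffA_c /ffA_nu tens_R // pi_cnu //.
  by case: ifP => _ //; rewrite (linZ (t_r _)) t_vac.
- by move=> n hn; apply: L0.
- by move=> n hn; apply: L0.
- by move=> n m hn; apply: L0.
- by move=> n hn; apply: L0.
- by move=> n hn; apply: L0.
- by move=> n m hn; apply: L0.
- by move=> n m hn; rewrite /ffA_c /ffA_E tens_R // pi_cE.
- by move=> m; rewrite /ffA_nu /ffA_E tens_R // pi_nuE //= (linZ (t_r _)).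
- move=> n m hn; rewrite /ffA_nu /ffA_E tens_R // pi_nuE; last by lia.
  by have -> : (n == 0) = false by [lia]; rewrite scale0r.
- by move=> n m l hn; rewrite /ffA_E tens_R // pi_EE.
- by move=> m l; rewrite /ffA_E tens_R // pi_EEN1.
- move=> m; rewrite /translation t_vac /ffA_c /ffA_E !tens_R // -/(translation _) pi_DE.
  exact: (linZ (t_r _)).
by rewrite /ffA_E pi_E0 t_vac.
Qed.

Lemma ff_hE : ff_h A = ff_hvec ffA_c ffA_nu.
Proof.
rewrite /ff_h /ff_hvec /ffA_c /ffA_nu -!(linZ (t_r _)) -(linB (t_r _)); congr (t _ _).
have lexp : linear (ff_exp 0 : ff_M1 A -> ff_Pi A) by case: (ff_PiP A) => -[].
rewrite /ff_mu /ff_nu -!(linZ lexp) -(linB lexp); congr (ff_exp _ _); rewrite /level; lmod K.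
Qed.

Lemma ff_fE : ff_f A = ff_fvec ffA_ap ffA_am ffA_nu ffA_E.
Proof.
have pnu := pi_par_nu A; have pam := par_ff_am A; have pap := par_ff_ap A.
rewrite /ff_f /ff_fvec /omE /sf_om /nunuE_vec /nuE_vec /nu2E_vec /ffA_nu /ffA_E /ffA_ap
  /ffA_am.
rewrite !tens_R // (tens_L _ _ _ pap) -sf_omega -tens_prod /level; lmod K.
Qed.

Lemma ff_GpE : ff_Gp A = current ffA_E ffA_ap.
Proof. by rewrite /ff_Gp /current -tens_prod. Qed.

Lemma ff_GbpE : ff_Gbp A = 2 *: current ffA_E ffA_am.
Proof. by rewrite /ff_Gbp /current -tens_prod. Qed.

End Tensor.
End FreeFieldRealization.

(** * Modules over affine algebras *)

Section AffineModules.
Variables (K : numFieldType) (g : lie_superdata K) (k : K).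

Lemma mem_lcomb (B : Type) (M : lmodType K) (S : set M) (iota : B -> M) (s : seq (K * B)) :
  is_subspace S -> foldr (fun t P => S (iota t.2) /\ P) True s -> S (lcomb iota s).
Proof.
move=> hS; rewrite /lcomb; elim: s => [|t s IH] /= h; first by rewrite big_nil; case: hS.
case: h => ht hs; rewrite big_cons; apply: subspaceD => //; last exact: IH.
exact: subspaceZ.
Qed.

Lemma currents_affine_module (V : vsa K) (iota : lbasis g -> V) (M : superspace K)
    (Y : V -> int -> M -> M) : are_affine_currents k iota -> is_module Y ->
  is_affine_module k (fun b n => Y (iota b) n).
Proof.
move=> [hp hc] hY; split=> [a n|a b m n u]; first exact: YrP.
have [h0 h1 h2] := hc a b.
rewrite (Y_comm hY m n u (hp a) (hp b) h2) !big_ord_recl big_ord0 /= addr0 binz0 binz1 scale1r.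
rewrite h0 h1; congr (_ + _).
  by rewrite /lcomb (Yl_sum hY); apply: eq_bigr => t _; rewrite (YlZ hY) ?subr0 ?addr0.
rewrite (YlZ hY) (Y_vac hY).
have -> : (m + n - (bump 0 0)%:Z == -1) = (m + n == 0) by rewrite /bump; lia.
rewrite addr0 scalerA; case: ifP => _; rewrite ?scaler0 ?scale0r //; congr (_ *: _); ring.
Qed.

Lemma hom_currents (V W : vsa K) (phi : V -> W) (iota : lbasis g -> V) :
  is_vsa_hom phi -> are_affine_currents k iota ->
  are_affine_currents k (fun b => phi (iota b)).
Proof.
move=> [hl hp h1 hm] [ip ic]; split=> [a|a b]; first exact/hp/ip.
have [e0 e1 e2] := ic a b; split=> [||n hn].
- rewrite -hm e0 /lcomb (lin_sum hl); apply: eq_bigr => t _; exact: linZ.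
- by rewrite -hm e1 (linZ hl) h1.
by rewrite -hm e2 // (lin0 hl).
Qed.

(* With [pi] a projection along [S], [(1 - pi) b + pi b pi] is an action on
   [S + V/S], and [pi] intertwines the given action with it; by uniqueness
   [pi] is zero. *)
Lemma universal_affine_ind (V : vsa K) (iota : lbasis g -> V) (S : set V) :
  is_universal_affine k iota -> is_subspace S -> S vac ->
  (forall b n u, S u -> S (mode (iota b) n u)) -> forall u, S u.
Proof.
move=> [hc univ] hS S1 Sm; have [hl hrel] := currents_affine_module hc (mode_module V).
have [pi [lpi kpi pipi]] := subspace_complement hS.
pose rho b n u := mode (iota b) n (u - pi u) + pi (mode (iota b) n (pi u)).
have Sr u : S (u - pi u) by apply/kpi; rewrite (linB lpi) pipi subrr.
have piS u : S u -> pi u = 0 by move/kpi.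
have pim b n u : pi (mode (iota b) n u) = pi (mode (iota b) n (pi u)).
  apply/eqP; rewrite -subr_eq0 -(linB lpi) -modeNr -modeDr; apply/eqP/piS.
  exact/Sm/Sr.
have rlin b n : linear (rho b n).
  move=> c u v; rewrite /rho lpi.
  have -> : c *: u + v - (c *: pi u + pi v) = c *: (u - pi u) + (v - pi v) by lmod K.
  by rewrite !(modeDr, modeZr) (linD lpi) (linZ lpi); lmod K.
have pir b n u : pi (rho b n u) = pi (mode (iota b) n (pi u)).
  by rewrite /rho (linD lpi) pipi piS ?add0r //; apply/Sm/Sr.
have rr a m b n u : rho a m (rho b n u) =
    mode (iota a) m (mode (iota b) n (u - pi u)) + pi (mode (iota a) m (mode (iota b) n (pi
      u))).
  rewrite {1}/rho pir; congr (mode _ _ _ + _); last by rewrite -pim.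
  by rewrite /rho addrK.
have hrho : is_affine_module k rho.
  split=> // a b m n u; rewrite !rr.
  set s := (-1) ^+ _; set kap := if _ then _ else _.
  transitivity (mode (iota a) m (mode (iota b) n (u - pi u))
     - s *: mode (iota b) n (mode (iota a) m (u - pi u))
     + pi (mode (iota a) m (mode (iota b) n (pi u))
     - s *: mode (iota b) n (mode (iota a) m (pi u)))).
    by rewrite (linB lpi) (linZ lpi); lmod K.
  rewrite !hrel -/kap (linD lpi) (linZ lpi) pipi.
  have -> : lcomb (fun c => rho c (m + n) u) (lbracket a b) =
    lcomb (fun c => mode (iota c) (m + n) (u - pi u)) (lbracket a b)
    + pi (lcomb (fun c => mode (iota c) (m + n) (pi u)) (lbracket a b)).
    rewrite /lcomb (lin_sum lpi) -big_split /=; apply: eq_bigr => t _.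
    by rewrite (linZ lpi) /rho scalerDr.
  lmod K.
have l0 : linear (fun _ : V => 0 : V) by move=> c u v; rewrite scaler0 addr0.
have [|phi [_ uniq]] := univ V rho 0 hrho.
  by move=> a n _; exact: (lin0 (rlin a n)).
have e1 : phi = pi.
  apply: uniq; split=> //; first exact: piS.
  by move=> a n u; rewrite /rho pipi subrr mode0r add0r.
have e2 : phi = fun=> 0.
  by apply: uniq; split=> // a n u; rewrite (lin0 (rlin a n)).
by move=> u; apply/kpi; rewrite -e1 e2.
Qed.

Lemma simple_affine_currents (L : vsa K) (i : lbasis g -> L) :
  is_simple_affine k i -> are_affine_currents k i.
Proof.
move=> [V [iV [pi [[hc _] [hpi _] _ _ hi]]]].
have -> : i = fun b => pi (iV b) by apply/funext.
exact: hom_currents.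
Qed.

Lemma simple_affine_ind (L : vsa K) (i : lbasis g -> L) (S : set L) :
  is_simple_affine k i -> is_subspace S -> S vac ->
  (forall b n u, S u -> S (mode (i b) n u)) -> forall u, S u.
Proof.
move=> [V [iV [pi [hU [hpi surj] _ _ hi]]]] hS S1 Sm u.
have [lpi _ pi1 pim] := hpi; have [v <-] := surj u.
apply: (@universal_affine_ind V iV [set v | S (pi v)]%classic hU) => [||b n w /= Sw].
- split=> [|c w w' /= Sw Sw'] /=; first by rewrite (lin0 lpi); case: hS.
  by rewrite lpi; case: hS => _; apply.
- by rewrite /= pi1.
by rewrite pim -hi; apply: Sm.
Qed.

Lemma affine_ind_generated (V : vsa K) (iota : lbasis g -> V) :
  (forall S : set V, is_subspace S -> S vac ->
    (forall b n u, S u -> S (mode (iota b) n u)) -> forall u, S u) ->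
  forall u, generated [set w | exists b, w = iota b]%classic u.
Proof.
move=> ind; apply: ind; first split.
- have := generated_lin (-1) (generated_vac [set w | exists b, w = iota b]%classic)
    (generated_vac [set w | exists b, w = iota b]%classic).
  by rewrite scaleN1r addNr.
- by move=> c u v hu hv; apply: generated_lin.
- exact: generated_vac.
by move=> b n u hu; apply: generated_mode => //; apply: generated_in; exists b.
Qed.

Lemma universal_affine_generated (V : vsa K) (iota : lbasis g -> V) :
  is_universal_affine k iota -> forall u, generated [set w | exists b, w = iota b]%classic u.
Proof. by move=> hU; apply: affine_ind_generated => S; apply: universal_affine_ind hU. Qed.

Lemma simple_affine_generated (L : vsa K) (i : lbasis g -> L) :
  is_simple_affine k i -> forall u, generated [set w | exists b, w = i b]%classic u.
Proof. by move=> hL; apply: affine_ind_generated => S; apply: simple_affine_ind hL. Qed.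

End AffineModules.

(** * Spans of creation modes applied to a vacuum vector *)

Section Spans.
Variables (K : numFieldType) (k : K) (M : lmodType K)
  (rho : osp12_basis -> int -> M -> M) (v0 : M) (alpha beta : int).
Hypothesis hrho : @is_affine_module K (osp12 K) k M rho.
Hypothesis hv0 : forall b (n : int), 0 <= n -> rho b n v0 = 0.

Definition osp12_wt (b : osp12_basis) : int :=
  match b with
  | osp12_even sl2_e => 2 | osp12_even sl2_h => 0 | osp12_even sl2_f => -2
  | osp12_x => 1 | osp12_y => -1
  end.

Definition mode_deg b (m : int) : int := - (alpha * m) - beta * osp12_wt b.

(* A grading for [weak = false], the associated filtration for [weak = true].
   [alpha, beta = 1, 0] is the grading by conformal weight, [alpha, beta = 4, 1]
   a principal one, in which e_0 and x_0 have negative degree. *)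
Inductive neg_span (weak : bool) : int -> M -> Prop :=
| neg_span_vac : neg_span weak 0 v0
| neg_span_zero n : neg_span weak n 0
| neg_span_lin c n u v : neg_span weak n u -> neg_span weak n v ->
    neg_span weak n (c *: u + v)
| neg_span_mode b m n u : m < 0 -> neg_span weak n u ->
    neg_span weak (n + mode_deg b m) (rho b m u)
| neg_span_weak n n' u : weak -> n <= n' -> neg_span weak n u -> neg_span weak n' u.

Lemma neg_span_subspace w n : is_subspace (neg_span w n).
Proof. by split=> [|c u v]; [apply: neg_span_zero | apply: neg_span_lin]. Qed.

Lemma neg_span_eq w n n' u : neg_span w n u -> n = n' -> neg_span w n' u.
Proof. by move=> h <-. Qed.

(** A mode with [m >= 0] is moved to the right. Each bracket term acts on a shorter monomial, for
    which the induction hypothesis covers every mode, so no ordered basis is required. *)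
Lemma neg_span_rho w n u : neg_span w n u ->
  forall b m, neg_span w (n + mode_deg b m) (rho b m u).
Proof.
have [rlin rrel] := hrho.
elim=> {n u} [|n|c n u v _ IHu _ IHv|b' m' n u hm' hu IH|n n' u hw hn _ IH] b m.
- case: (ltP m 0) => hm; first by apply: neg_span_mode => //; apply: neg_span_vac.
  by rewrite hv0 //; apply: neg_span_zero.
- by rewrite (lin0 (rlin b m)); apply: neg_span_zero.
- by rewrite rlin; apply: neg_span_lin.
- case: (ltP m 0) => hm; first by do 2![apply: neg_span_mode => //].
  have hS := neg_span_subspace w (n + mode_deg b' m' + mode_deg b m).
  have := rrel b b' m m' u => /(canRL (subrK _)) ->.
  apply: (subspaceD hS); last first.
    apply: (subspaceZ _ hS); apply: neg_span_eq (neg_span_mode b' hm' (IH b m)) _.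
    exact: addrAC.
  apply: (subspaceD hS).
    apply: (mem_lcomb hS); clear rrel; case: b b' IH hS => [[]| |] [[]| |] IH hS /=;
    repeat split; (apply: neg_span_eq (IH _ _) _; rewrite /mode_deg /=; lia).
  (* The central term occurs for [m + m' = 0] and pairs opposite weights, so it does not change the
     degree. *)
  case: eqP => hmm; last by rewrite scale0r; apply: neg_span_zero.
  case: b b' IH hS {rrel} => [[]| |] [[]| |] IH hS /=;
    try (rewrite mulr0 mul0r scale0r; apply: neg_span_zero);
    (apply: (subspaceZ _ hS); apply: neg_span_eq hu _; rewrite /mode_deg /=;
     have -> : m' = - m by lia); lia.
by apply: neg_span_weak hw _ (IH b m); rewrite lerD2r.
Qed.

Lemma neg_span_le0 w n u : (forall b m, m < 0 -> 0 < mode_deg b m) ->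
  neg_span w n u -> (n < 0 -> u = 0) /\ (n = 0 -> exists c, u = c *: v0).
Proof.
have [rlin _] := hrho; move=> hdeg.
elim=> {n u} [|n|c n u v _ [IHu1 IHu2] _ [IHv1 IHv2]|b m n u hm hu [IH1 IH2]|n n' u hw hn _
  [IH1 IH2]].
- by split=> // _; exists 1; rewrite scale1r.
- by split=> // _; exists 0; rewrite scale0r.
- split=> h; first by rewrite IHu1 // IHv1 // scaler0 addr0.
  have [a ->] := IHu2 h; have [b ->] := IHv2 h.
  by exists (c * a + b); rewrite scalerDl scalerA.
- have hd := hdeg b m hm; have hn : n + mode_deg b m <= 0 -> n < 0 by lia.
  split=> h; first by rewrite IH1 ?(lin0 (rlin b m)) //; apply: hn; apply: ltW.
  by exists 0; rewrite IH1 ?(lin0 (rlin b m)) ?scale0r //; apply: hn; rewrite h.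
split=> h; first by apply: IH1; apply: le_lt_trans hn h.
move: hn; rewrite h le_eqVlt => /orP[/eqP /IH2 //|/IH1 ->].
by exists 0; rewrite scale0r.
Qed.

(** In the graded version the vacuum has degree 0, so a vector of any other degree is built from
    images of creation modes alone. *)
Lemma neg_span_pos n u (S : set M) : neg_span false n u -> n != 0 -> is_subspace S ->
  (forall b m v, m < 0 -> S (rho b m v)) -> S u.
Proof.
move=> h + hS Sm; elim: h => {n u} [//|n _|c n u v _ IHu _ IHv hn|b m n u hm _ _ _|//].
- by case: hS.
- by case: hS => _; apply; [apply: IHu | apply: IHv].
exact: Sm.
Qed.

End Spans.

Lemma affine_weight_neg_span (K : numFieldType) (k : K) (V : vsa K)
    (iota : osp12_basis -> V) n u : are_affine_currents (g := osp12 K) k iota ->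
  affine_weight iota n u ->
  neg_span (fun b m => mode (iota b) m) vac 1 0 false n u.
Proof.
move=> hc; have hr := currents_affine_module hc (mode_module V).
have h0 b m : 0 <= m -> mode (iota b) m vac = 0 by apply: mode_annihil.
elim=> {n u} [|n|c n u v _ IHu _ IHv|b m n u _ IH].
- exact: neg_span_vac.
- exact: neg_span_zero.
- exact: neg_span_lin.
by apply: neg_span_eq (neg_span_rho hr h0 IH b m) _; rewrite /mode_deg; lia.
Qed.

(** * Sums of eigenvectors *)

Section Eigenvectors.
Variables (K : numFieldType) (M : lmodType K) (T : M -> M) (Lam : set K).
Hypothesis hT : linear T.

Definition eigen_sum (u : M) := exists (n : nat) (x : nat -> M) (l : nat -> K),
  u = \sum_(i < n) x i /\ forall i, (i < n)%N -> Lam (l i) /\ T (x i) = l i *: x i.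

(** Applying [T - l n] removes one eigenvector from the sum and multiplies [u] by [mu - l n], which
    is nonzero because [mu] lies outside [Lam]. *)
Lemma eigen_sum_inj mu u : ~ Lam mu -> eigen_sum u -> T u = mu *: u -> u = 0.
Proof.
move=> hmu [n]; elim: n u => [|n IH] u [x [l [-> hx]]]; first by rewrite big_ord0.
set v := \sum_(i < n.+1) x i => hv.
have [hl hTn] := hx n (leqnn _).
have e : v = \sum_(i < n) x i + x n by rewrite /v big_ord_recr.
have e' : (mu - l n) *: v = \sum_(i < n) (l i - l n) *: x i.
  rewrite scalerBl -hv e (linD hT) (lin_sum hT) hTn scalerDr scaler_sumr opprD addrACA
    subrr addr0.
  rewrite -sumrB; apply: eq_bigr => i _; have [_ ->] := hx i (ltnW (ltn_ord i)).
  by rewrite scalerBl.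
have : (mu - l n) *: v = 0.
  apply: IH; last by rewrite (linZ hT) hv !scalerA mulrC.
  exists (fun i => (l i - l n) *: x i), l; split=> // i hi.
  have [? hi'] := hx i (ltnW hi); split=> //.
  by rewrite (linZ hT) hi' !scalerA mulrC.
move/eqP; rewrite scaler_eq0 subr_eq0 => /orP[/eqP em|/eqP //].
by case: hmu; rewrite em.
Qed.

Lemma eigen_sum_subspace : is_subspace eigen_sum.
Proof.
split=> [|c u v [n [x [l [-> hx]]]] [m [y [l' [-> hy]]]]].
  by exists 0%N, (fun=> 0), (fun=> 0); rewrite big_ord0.
exists (n + m)%N, (fun i => if (i < n)%N then c *: x i else y (i - n)%N),
  (fun i => if (i < n)%N then l i else l' (i - n)%N); split=> [|i hi].
  rewrite big_split_ord /= scaler_sumr; congr (_ + _); apply: eq_bigr => i _.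
    by rewrite ltn_ord.
  by rewrite ltnNge leq_addr /= addKn.
case: ltnP => hin; last by apply: hy; rewrite ltn_subLR.
by have [? h] := hx i hin; split=> //; rewrite (linZ hT) h !scalerA mulrC.
Qed.

Lemma eigen_sum1 u l : Lam l -> T u = l *: u -> eigen_sum u.
Proof. by move=> hl hu; exists 1%N, (fun=> u), (fun=> l); rewrite big_ord1;
  split=> // -[]. Qed.

End Eigenvectors.

Lemma eigen_sum_shift (K : numFieldType) (M : lmodType K) (T f : M -> M)
    (Lam Lam' : set K) d u : linear T -> linear f ->
  (forall v, T (f v) = f (T v) + d *: f v) ->
  (forall l, Lam l -> Lam' (l + d)) -> eigen_sum T Lam u -> eigen_sum T Lam' (f u).
Proof.
move=> hT hf hTf hL [n [x [l [-> hx]]]]; exists n, (fun i => f (x i)), (fun i => l i + d).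
split=> [|i hi]; first by rewrite (lin_sum hf).
have [hl he] := hx i hi; split; first exact: hL.
by rewrite hTf he (linZ hf) scalerDl.
Qed.

(** * The Sugawara vector *)

Section Sugawara.
Variables (K : numFieldType) (V : vsa K) (s : sl2_basis -> V).
Hypothesis hs : are_affine_currents (g := sl2 K) (level K) s.
Let hV := mode_module V.
Let e := s sl2_e.
Let f := s sl2_f.
Let h := s sl2_h.

Lemma sl2_par b : par false (s b). Proof. by case: hs => hp _; exact: hp. Qed.
Let pe : par false e := sl2_par _.
Let pf : par false f := sl2_par _.
Let ph : par false h := sl2_par _.

Lemma sl2_rel a b m n u : mode (s a) m (mode (s b) n u) =
  mode (s b) n (mode (s a) m u) + lcomb (fun c => mode (s c) (m + n) u) (sl2_bracket K a b)
  + (if m + n == 0 then m%:~R * sl2_form K a b * level K else 0) *: u.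
Proof.
have [_ hr] := currents_affine_module hs hV.
have /= := hr a b m n u; rewrite expr0 scale1r => /(canRL (subrK _)) ->.
by rewrite addrC addrA.
Qed.

Lemma ef_comm m n u : mode e m (mode f n u) = mode f n (mode e m u) + mode h (m + n) u
  + (if m + n == 0 then m%:~R * level K else 0) *: u.
Proof. by rewrite sl2_rel /lcomb !big_cons big_nil /= scale1r addr0 mulr1. Qed.
Lemma fe_comm m n u : mode f m (mode e n u) = mode e n (mode f m u) - mode h (m + n) u
  + (if m + n == 0 then m%:~R * level K else 0) *: u.
Proof. by rewrite sl2_rel /lcomb !big_cons big_nil /= scaleN1r addr0 mulr1. Qed.
Lemma he_comm m n u : mode h m (mode e n u) = mode e n (mode h m u) + 2 *: mode e (m + n) u.
Proof. by rewrite sl2_rel /lcomb !big_cons big_nil /= addr0 mulr0 mul0r if_same scale0r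
  addr0. Qed.
Lemma hf_comm m n u : mode h m (mode f n u) = mode f n (mode h m u) - 2 *: mode f (m + n) u.
Proof. by rewrite sl2_rel /lcomb !big_cons big_nil /= addr0 mulr0 mul0r if_same scale0r
  addr0 scaleNr. Qed.
Lemma ee_comm m n u : mode e m (mode e n u) = mode e n (mode e m u).
Proof. by rewrite sl2_rel /lcomb big_nil /= mulr0 mul0r if_same scale0r !addr0. Qed.
Lemma ff_comm m n u : mode f m (mode f n u) = mode f n (mode f m u).
Proof. by rewrite sl2_rel /lcomb big_nil /= mulr0 mul0r if_same scale0r !addr0. Qed.

Let om := omega_sug e f h.

Lemma par_omega_sug : par false om.
Proof.
have hp := par_subspace V false; rewrite /om /omega_sug.
by do 2?[apply: subspaceD => //]; first [ apply: subspaceZ => // | idtac ];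
  apply: (mode_par (p := false) (q := false)).
Qed.

Lemma sug_iter j u (Ne Nf Nh Ne' Nf' Nh' : nat) :
  (forall i : int, Ne'%:Z <= i -> mode e (j + i) u = 0) ->
  (forall i : int, Nf'%:Z <= i -> mode f (j + i) u = 0) ->
  (forall i : int, Nh'%:Z <= i -> mode h (j + i) u = 0) ->
  (forall i : int, Ne%:Z <= i -> mode e i u = 0) ->
  (forall i : int, Nf%:Z <= i -> mode f i u = 0) ->
  (forall i : int, Nh%:Z <= i -> mode h i u = 0) ->
  mode om j u =
    (\sum_(i <- iota 0 Nf') mode e (-1 - i%:Z) (mode f (j + i%:Z) u)
     + \sum_(i <- iota 0 Ne) mode f (j - 1 - i%:Z) (mode e i%:Z u))
    + (\sum_(i <- iota 0 Ne') mode f (-1 - i%:Z) (mode e (j + i%:Z) u)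
     + \sum_(i <- iota 0 Nf) mode e (j - 1 - i%:Z) (mode f i%:Z u))
    + (1 / 2) *: (\sum_(i <- iota 0 Nh') mode h (-1 - i%:Z) (mode h (j + i%:Z) u)
     + \sum_(i <- iota 0 Nh) mode h (j - 1 - i%:Z) (mode h i%:Z u)).
Proof.
move=> e' f' h' e1 f1 h1; rewrite /om /omega_sug !modeDl modeZl.
rewrite (iterN1 pe pf f' e1) (iterN1 pf pe e' f1) (iterN1 ph ph h' h1) /= expr0 !scale1r.
by rewrite div1r.
Qed.

(** [L_sug(-1)] need not be the translation operator of the whole algebra, so their agreement is
    recorded vector by vector, together with the weight. *)
Definition conformal (a : V) (delta : K) :=
  mode om 0 a = translation a /\ mode om 1 a = delta *: a.

Lemma conformal_mode0 p a delta n u : par p a -> conformal a delta ->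
  mode om 0 (mode a n u) = mode a n (mode om 0 u) - n%:~R *: mode a (n - 1) u.
Proof.
move=> pa [h0 _]; rewrite (Y_comm0 hV n u par_omega_sug pa) h0 (Y_translation hV).
by rewrite /= expr0 scale1r.
Qed.

Lemma conformal_mode1 p a delta n u : par p a -> conformal a delta ->
  mode om 1 (mode a n u) = mode a n (mode om 1 u) + (delta - n%:~R - 1) *: mode a n u.
Proof.
move=> pa [h0 h1]; rewrite (Y_comm1 hV n u par_omega_sug pa) h0 h1 (Y_translation hV).
rewrite modeZl addrK /= expr0 scale1r intrD; lmod K.
Qed.

Lemma conformal_prod p a b da db n : par p a -> conformal a da -> conformal b db ->
  conformal (mode a n b) (da + db - n%:~R - 1).
Proof.
move=> pa ha hb; split.
  by rewrite (conformal_mode0 n b pa ha) translation_mode; case: hb => ->.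
rewrite (conformal_mode1 n b pa ha); case: hb => _ ->; rewrite modeZr; lmod K.
Qed.

Lemma sl2_prod0 a b : mode (s a) 0 (s b) = lcomb s (sl2_bracket K a b).
Proof. by case: hs => _ /(_ a b)[]. Qed.
Lemma sl2_prod1 a b : mode (s a) 1 (s b) = (level K * sl2_form K a b) *: vac.
Proof. by case: hs => _ /(_ a b)[]. Qed.
Lemma sl2_prod2 a b n : 2 <= n -> mode (s a) n (s b) = 0.
Proof. by case: hs => _ /(_ a b)[_ _]; apply. Qed.

Lemma ee_prod n : 0 <= n -> mode e n e = 0.
Proof. by move=> hn; rewrite -{2}[e]mode_create ee_comm mode_annihil // mode0r. Qed.
Lemma ff_prod n : 0 <= n -> mode f n f = 0.
Proof. by move=> hn; rewrite -{2}[f]mode_create ff_comm mode_annihil // mode0r. Qed.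
Lemma he_prod n : 1 <= n -> mode h n e = 0.
Proof.
move=> hn; rewrite -[X in mode h n X]mode_create he_comm !mode_annihil ?mode0r ?scaler0
  ?addr0 //; lia.
Qed.
Lemma hf_prod n : 1 <= n -> mode h n f = 0.
Proof.
move=> hn; rewrite -[X in mode h n X]mode_create hf_comm !mode_annihil ?mode0r ?scaler0
  ?subr0 //; lia.
Qed.
Lemma he0 : mode h 0 e = 2 *: e.
Proof. by rewrite sl2_prod0 /lcomb !big_cons big_nil /= addr0. Qed.
Lemma hf0 : mode h 0 f = (-2) *: f.
Proof. by rewrite sl2_prod0 /lcomb !big_cons big_nil /= addr0. Qed.
Lemma ef0 : mode e 0 f = h.
Proof. by rewrite sl2_prod0 /lcomb !big_cons big_nil /= addr0 scale1r. Qed.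
Lemma fe0 : mode f 0 e = - h.
Proof. by rewrite sl2_prod0 /lcomb !big_cons big_nil /= addr0 scaleN1r. Qed.
Lemma ef1 : mode e 1 f = level K *: vac. Proof. by rewrite sl2_prod1 mulr1. Qed.
Lemma fe1 : mode f 1 e = level K *: vac. Proof. by rewrite sl2_prod1 mulr1. Qed.

Lemma heN1 : mode h (-1) e = mode e (-1) h + 2 *: translation e.
Proof. by rewrite -[X in mode h (-1) X]mode_create he_comm mode_create. Qed.
Lemma hfN1 : mode h (-1) f = mode f (-1) h - 2 *: translation f.
Proof. by rewrite -[X in mode h (-1) X]mode_create hf_comm mode_create. Qed.

Lemma conformal_e : conformal e 1.
Proof.
have eh0 : mode e 0 h = - (2 *: e).
  by rewrite sl2_prod0 /lcomb !big_cons big_nil /= addr0 scaleNr.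
split.
  rewrite (sug_iter (j := 0) (u := e) (Ne := 0) (Nf := 2) (Nh := 1) (Ne' := 0) (Nf' := 2)
    (Nh' := 1));
    try by move=> i hi; rewrite ?add0r; first [apply: ee_prod | apply: he_prod | apply:
      sl2_prod2].
  unroll; rewrite he0 fe0 fe1 !(modeNr, modeZr) heN1 /level /translation; lmod K.
rewrite (sug_iter (j := 1) (u := e) (Ne := 0) (Nf := 2) (Nh := 1) (Ne' := 0) (Nf' := 1)
  (Nh' := 0));
    try by move=> i hi; first [apply: ee_prod; lia | apply: he_prod;
      lia | apply: sl2_prod2; lia].
unroll; rewrite he0 fe0 fe1 !(modeNr, modeZr) he0 eh0 mode_create /level; lmod K.
Qed.

Lemma conformal_f : conformal f 1.
Proof.
have fh0 : mode f 0 h = 2 *: f.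
  by rewrite sl2_prod0 /lcomb !big_cons big_nil /= addr0.
split.
  rewrite (sug_iter (j := 0) (u := f) (Ne := 2) (Nf := 0) (Nh := 1) (Ne' := 2) (Nf' := 0)
    (Nh' := 1));
    try by move=> i hi; rewrite ?add0r; first [apply: ff_prod | apply: hf_prod | apply:
      sl2_prod2].
  unroll; rewrite hf0 ef0 ef1 !(modeNr, modeZr) hfN1 /level /translation; lmod K.
rewrite (sug_iter (j := 1) (u := f) (Ne := 2) (Nf := 0) (Nh := 1) (Ne' := 1) (Nf' := 0)
  (Nh' := 0));
    try by move=> i hi; first [apply: ff_prod; lia | apply: hf_prod;
      lia | apply: sl2_prod2; lia].
unroll; rewrite hf0 ef0 ef1 !(modeNr, modeZr) hf0 fh0 mode_create /level; lmod K.
Qed.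

Lemma conformal_sl2 b : conformal (s b) 1.
Proof.
case: b; [exact: conformal_e | exact: conformal_f|].
have := conformal_prod 0 pe conformal_e conformal_f; rewrite ef0.
by rewrite (_ : 1 + 1 - 0%:~R - 1 = 1 :> K) //; field.
Qed.

Lemma omega_sug1_singular u : (forall n, 0 <= n -> mode e n u = 0) ->
  (forall n, 1 <= n -> mode h n u = 0) -> (forall n, 1 <= n -> mode f n u = 0) ->
  mode om 1 u = mode h 0 u + (1 / 2) *: mode h 0 (mode h 0 u).
Proof.
move=> he hh hf.
rewrite (sug_iter (j := 1) (u := u) (Ne := 0) (Nf := 1) (Nh := 1) (Ne' := 0) (Nf' := 0)
  (Nh' := 0)) //;
  try by move=> i hi; first [apply: he; lia | apply: hh; lia | apply: hf; lia].
by unroll; rewrite ef_comm he // mode0r /= mul0r scale0r add0r addr0.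
Qed.

Section Doublet.
Variable G : V.
Hypotheses (pG : par true G) (eG : forall n, 0 <= n -> mode e n G = 0)
  (hG0 : mode h 0 G = G) (hG : forall n, 1 <= n -> mode h n G = 0)
  (fG : forall n, 1 <= n -> mode f n G = 0)
  (ffG : mode f 0 (mode f 0 G) = 0)
  (DG : translation G = 2 *: mode f 0 (mode e (-1) G) + 3 *: mode h (-1) G).
Let G' := mode f 0 G.

Lemma par_doublet : par true G'. Proof. exact: mode_par pf pG erefl. Qed.
Let pG' := par_doublet.

(** After [f_0] has been moved past [e_(-1)], the relation [DG] reads
    [D G = 2 e_(-1) f_0 G + h_(-1) G], and this is [L_sug(-1) G]. The weight is the value of
    [h_0 + h_0^2 / 2] at [h_0 = 1]. *)
Lemma conformal_G : conformal G (3 / 2).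
Proof.
split.
  rewrite (sug_iter (j := 0) (u := G) (Ne := 0) (Nf := 1) (Nh := 1) (Ne' := 0) (Nf' := 1)
    (Nh' := 1));
    try by move=> i hi; rewrite ?add0r; first [apply: eG | apply: fG | apply: hG].
  unroll; rewrite hG0 DG fe_comm /= scale0r addr0; lmod K.
rewrite (sug_iter (j := 1) (u := G) (Ne := 0) (Nf := 1) (Nh := 1) (Ne' := 0) (Nf' := 0)
  (Nh' := 0));
    try by move=> i hi; first [apply: eG; lia | apply: fG; lia | apply: hG; lia].
unroll; rewrite !hG0 ef_comm eG // mode0r /= mul0r scale0r add0r addr0 hG0; lmod K.
Qed.

Lemma conformal_G' : conformal G' (3 / 2).
Proof.
have := conformal_prod 0 pf conformal_f conformal_G.
by rewrite (_ : 1 + 3 / 2 - 0%:~R - 1 = 3 / 2 :> K) //; field.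
Qed.

Lemma eG_comm m n u : mode e m (mode G n u) = mode G n (mode e m u).
Proof. by rewrite (comm_zero pe pG eG) expr0 scale1r. Qed.
Lemma hG_comm m n u : mode h m (mode G n u) = mode G n (mode h m u) + mode G (m + n) u.
Proof. by rewrite (comm_prim ph pG hG0 hG) expr0 scale1r. Qed.
Lemma fG_comm m n u : mode f m (mode G n u) = mode G n (mode f m u) + mode G' (m + n) u.
Proof. by rewrite (comm_prim pf pG erefl fG) expr0 scale1r. Qed.

Lemma eG'_comm m n u : mode e m (mode G' n u) = mode G' n (mode e m u) + mode G (m + n) u.
Proof.
have p0 : mode e 0 G' = G by rewrite /G' ef_comm eG // mode0r hG0 /= mul0r scale0r add0r addr0.
rewrite (comm_prim pe pG' p0) ?expr0 ?scale1r // => j hj.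
rewrite /G' ef_comm eG; last by lia.
rewrite mode0r addr0 hG // !add0r; have -> : (j == 0) = false by lia.
by rewrite scale0r.
Qed.
Lemma hG'_comm m n u : mode h m (mode G' n u) = mode G' n (mode h m u) - mode G' (m + n) u.
Proof.
have p0 : mode h 0 G' = - G' by rewrite /G' hf_comm hG0 addr0; lmod K.
rewrite (comm_prim ph pG' p0) ?expr0 ?scale1r ?modeNl // => j hj.
by rewrite /G' hf_comm hG // mode0r addr0 fG // scaler0 subr0.
Qed.
Lemma fG'_comm m n u : mode f m (mode G' n u) = mode G' n (mode f m u).
Proof.
rewrite (comm_zero pf pG') ?expr0 ?scale1r // => j hj.
have [->//|j0] := eqVneq j 0; rewrite /G' ff_comm fG ?mode0r //; lia.
Qed.

End Doublet.
End Sugawara.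

(** * The action of affine osp(1|2) on V^(2) *)

(** An interface between the free field computations, which establish it, and the comparison with
    osp(1|2). G^- and Gb^- enter as [f_0 Gp] and [- f_0 Gbp]. *)
Record n4_rel (K : numFieldType) (V : vsa K) (s : sl2_basis -> V) (Gp Gbp : V) : Prop :=
  N4Rel {
  n4r_currents : are_affine_currents (g := sl2 K) (level K) s;
  n4r_par : forall G, G = Gp \/ G = Gbp -> par true G;
  n4r_e : forall G n, G = Gp \/ G = Gbp -> 0 <= n -> mode (s sl2_e) n G = 0;
  n4r_h0 : forall G, G = Gp \/ G = Gbp -> mode (s sl2_h) 0 G = G;
  n4r_h : forall G n, G = Gp \/ G = Gbp -> 1 <= n -> mode (s sl2_h) n G = 0;
  n4r_f : forall G n, G = Gp \/ G = Gbp -> 1 <= n -> mode (s sl2_f) n G = 0;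
  n4r_ff : forall G, G = Gp \/ G = Gbp -> mode (s sl2_f) 0 (mode (s sl2_f) 0 G) = 0;
  n4r_D : forall G, G = Gp \/ G = Gbp -> translation G =
    2 *: mode (s sl2_f) 0 (mode (s sl2_e) (-1) G) + 3 *: mode (s sl2_h) (-1) G;
  n4r_sq : forall G m n u, G = Gp \/ G = Gbp ->
    mode G m (mode G n u) + mode G n (mode G m u) = 0;
  n4r_pm : forall m n u, mode Gp m (mode Gbp n u) + mode Gbp n (mode Gp m u) =
    (m - n)%:~R *: mode (s sl2_e) (m + n - 1) u;
  n4r_sing : forall u, (forall n, 0 <= n -> mode (s sl2_e) n u = 0) ->
    (forall n, 1 <= n -> mode (s sl2_h) n u = 0) -> mode (s sl2_f) 1 u = 0 ->
    (forall n, 1 <= n -> mode Gp n u = 0) -> (forall n, 1 <= n -> mode Gbp n u = 0) ->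
    mode (s sl2_h) 0 (mode (s sl2_h) 0 u) + mode (s sl2_h) 0 u = 0;
  n4r_gen : forall v, generated
    ([set w | (exists b, w = s b) \/ [\/ w = Gp, w = Gbp, w = mode (s sl2_f) 0 Gp
       | w = - mode (s sl2_f) 0 Gbp]])%classic v;
  n4r_vac : (vac : V) != 0
}.

Section OspAction.
Variables (K : numFieldType) (V : vsa K) (s : sl2_basis -> V) (Gp Gbp : V).
Hypothesis H : n4_rel s Gp Gbp.
Let hV := mode_module V.
Let hs := n4r_currents H.
Let e := s sl2_e.
Let f := s sl2_f.
Let h := s sl2_h.
Let Gp' := mode f 0 Gp.
Let Gbp' := mode f 0 Gbp.
Let om := omega_sug e f h.
Let ip : Gp = Gp \/ Gp = Gbp := or_introl erefl.
Let ib : Gbp = Gp \/ Gbp = Gbp := or_intror erefl.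

Definition osp_action (b : osp12_basis) (n : int) (u : V) : V :=
  match b with
  | osp12_even a => mode (s a) n u
  | osp12_x => mode Gp n u - mode Gbp (n + 1) u
  | osp12_y => - mode (mode (s sl2_f) 0 Gp) n u - mode (- mode (s sl2_f) 0 Gbp) (n + 1) u
  end.
Let rho := osp_action.
Let x := rho osp12_x.
Let y := rho osp12_y.

Lemma y_modeE n u : y n u = - mode Gp' n u + mode Gbp' (n + 1) u.
Proof. by rewrite /y /= modeNl opprK. Qed.
Lemma x_modeE n u : x n u = mode Gp n u - mode Gbp (n + 1) u.
Proof. by []. Qed.

Lemma osp_action_linear b n : linear (rho b n).
Proof.
by move=> c u v; case: b => [b||] /=; rewrite !(modeDr, modeZr) //; lmod K.
Qed.

Let xD n u v : x n (u + v) = x n u + x n v := linD (osp_action_linear osp12_x n) u v.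
Let xN n u : x n (- u) = - x n u := linN (osp_action_linear osp12_x n) u.
Let yD n u v : y n (u + v) = y n u + y n v := linD (osp_action_linear osp12_y n) u v.
Let yN n u : y n (- u) = - y n u := linN (osp_action_linear osp12_y n) u.

Let eG G n u m (i : G = Gp \/ G = Gbp) : mode e m (mode G n u) = mode G n (mode e m u) :=
  eG_comm hs (n4r_par H i) (fun n => n4r_e H i) m n u.
Let hG G n u m (i : G = Gp \/ G = Gbp) :
    mode h m (mode G n u) = mode G n (mode h m u) + mode G (m + n) u :=
  hG_comm hs (n4r_par H i) (n4r_h0 H i) (fun n => n4r_h H i) m n u.
Let fG G n u m (i : G = Gp \/ G = Gbp) :
    mode f m (mode G n u) = mode G n (mode f m u) + mode (mode f 0 G) (m + n) u :=
  fG_comm hs (n4r_par H i) (fun n => n4r_f H i) m n u.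
Let eG' G n u m (i : G = Gp \/ G = Gbp) :
    mode e m (mode (mode f 0 G) n u) = mode (mode f 0 G) n (mode e m u) + mode G (m + n) u :=
  eG'_comm hs (n4r_par H i) (fun n => n4r_e H i) (n4r_h0 H i) (fun n => n4r_h H i) m n u.
Let hG' G n u m (i : G = Gp \/ G = Gbp) :
    mode h m (mode (mode f 0 G) n u) = mode (mode f 0 G) n (mode h m u) - mode (mode f 0 G)
      (m + n) u :=
  hG'_comm hs (n4r_par H i) (n4r_h0 H i) (fun n => n4r_h H i) (fun n => n4r_f H i) m n u.
Let fG' G n u m (i : G = Gp \/ G = Gbp) :
    mode f m (mode (mode f 0 G) n u) = mode (mode f 0 G) n (mode f m u) :=
  fG'_comm hs (n4r_par H i) (fun n => n4r_f H i) (n4r_ff H i) m n u.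

Lemma ex_rel m n u : mode e m (x n u) = x n (mode e m u).
Proof. by rewrite !x_modeE modeDr modeNr !eG. Qed.
Lemma hx_rel m n u : mode h m (x n u) = x n (mode h m u) + x (m + n) u.
Proof. by rewrite !x_modeE modeDr modeNr !hG // [m + (n + 1)]addrA; lmod K. Qed.
Lemma fx_rel m n u : mode f m (x n u) = x n (mode f m u) - y (m + n) u.
Proof. by rewrite !x_modeE y_modeE modeDr modeNr !fG // [m + (n + 1)]addrA; lmod K. Qed.
Lemma ey_rel m n u : mode e m (y n u) = y n (mode e m u) - x (m + n) u.
Proof. by rewrite !x_modeE !y_modeE modeDr modeNr !eG' // [m + (n + 1)]addrA; lmod K. Qed.
Lemma hy_rel m n u : mode h m (y n u) = y n (mode h m u) - y (m + n) u.
Proof. by rewrite !y_modeE modeDr modeNr !hG' // [m + (n + 1)]addrA; lmod K. Qed.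
Lemma fy_rel m n u : mode f m (y n u) = y n (mode f m u).
Proof. by rewrite !y_modeE modeDr modeNr !fG'. Qed.

(** The squares of G^+ and Gb^+ contribute nothing, and the cross terms have coefficients
    [- (m - (n + 1))] and [- (n - (m + 1))], with sum 2. *)
Lemma xx_rel m n u : x m (x n u) + x n (x m u) = 2 *: mode e (m + n) u.
Proof.
rewrite !x_modeE !(modeDr, modeNr).
have e1 := n4r_sq H m n u ip; have e2 := n4r_sq H (m + 1) (n + 1) u ib.
have e3 := n4r_pm H m (n + 1) u; have e4 := n4r_pm H n (m + 1) u.
have m1 : m + (n + 1) - 1 = m + n by lia.
have m2 : n + (m + 1) - 1 = m + n by lia.
rewrite m1 in e3; rewrite m2 in e4.
transitivity ((mode Gp m (mode Gp n u) + mode Gp n (mode Gp m u))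
  + (mode Gbp (m + 1) (mode Gbp (n + 1) u) + mode Gbp (n + 1) (mode Gbp (m + 1) u))
  - (mode Gp m (mode Gbp (n + 1) u) + mode Gbp (n + 1) (mode Gp m u))
  - (mode Gp n (mode Gbp (m + 1) u) + mode Gbp (m + 1) (mode Gp n u))); first by lmod K.
rewrite e1 e2 e3 e4 !(intrD, intrN); lmod K.
Qed.

Lemma xx_sq m u : x m (x m u) = mode e (m + m) u.
Proof.
have := xx_rel m m u; rewrite -mulr2n -scaler_nat => /(congr1 (fun v => 2^-1 *: v)).
by rewrite !scalerA mulVf ?pnatr_eq0 // !scale1r.
Qed.

Lemma y_of_x p m u : y (p + m) u = x m (mode f p u) - mode f p (x m u).
Proof. by rewrite fx_rel; lmod K. Qed.

(* y_n = - [f_(n-m), x_m] and x_m^2 = e_(2m), so the anticommutator is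
   [e_(2m), f_(n-m)]. *)
Lemma xy_rel m n u : x m (y n u) + y n (x m u) =
  mode h (m + n) u + (if m + n == 0 then m%:~R * 2 * level K else 0) *: u.
Proof.
have yx v : y n v = x m (mode f (n - m) v) - mode f (n - m) (x m v).
  by rewrite -y_of_x; congr (y _ _); lia.
rewrite !yx xD xN !xx_sq; set z := x m (mode f (n - m) (x m u)).
transitivity (mode e (m + m) (mode f (n - m) u) - mode f (n - m) (mode e (m + m) u)).
  by lmod K.
rewrite (ef_comm hs) -/h; have -> : m + m + (n - m) = m + n by lia.
by rewrite intrD; case: eqP => _; lmod K.
Qed.

(** Writing [y_m = [x_0, f_m]] reduces this to [xy_rel] with first index 0, where the central term
    vanishes. *)
Lemma yy_rel m n u : y m (y n u) + y n (y m u) = (-2) *: mode f (m + n) u.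
Proof.
have yx v : y m v = x 0 (mode f m v) - mode f m (x 0 v).
  by rewrite -y_of_x addr0.
rewrite !yx yD yN !fy_rel.
have e1 := xy_rel 0 n (mode f m u); have e2 := xy_rel 0 n u.
transitivity ((x 0 (y n (mode f m u)) + y n (x 0 (mode f m u)))
  - mode f m (x 0 (y n u) + y n (x 0 u))).
  by rewrite modeDr !fy_rel; lmod K.
rewrite e1 e2 modeDr modeZr !add0r (hf_comm hs) [n + m]addrC -/f -/h; lmod K.
Qed.

Lemma osp_action_affine : is_affine_module (g := osp12 K) (level K) rho.
Proof.
split=> [b n|a b m n u]; first exact: osp_action_linear.
have [_ hr] := currents_affine_module hs hV.
have z1 (A B : V) c : A = B + c -> A - (-1) ^+ false *: B = c by move=> ->; lmod K.
have z2 (A B : V) c : A + B = c -> A - (-1) ^+ true *: B = c.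
  by move=> <-; rewrite expr1; lmod K.
have xe' : x m (mode e n u) = mode e n (x m u) by rewrite ex_rel.
have xf' : x m (mode f n u) = mode f n (x m u) + y (m + n) u.
  by rewrite fx_rel [n + m]addrC subrK.
have xh' : x m (mode h n u) = mode h n (x m u) - x (m + n) u.
  by rewrite hx_rel [n + m]addrC addrK.
have ye' : y m (mode e n u) = mode e n (y m u) + x (m + n) u.
  by rewrite ey_rel [n + m]addrC subrK.
have yf' : y m (mode f n u) = mode f n (y m u) by rewrite fy_rel.
have yh' : y m (mode h n u) = mode h n (y m u) + y (m + n) u.
  by rewrite hy_rel [n + m]addrC subrK.
have ev (a' b' : sl2_basis) : rho (osp12_even a') m (rho (osp12_even b') n u)
   - (-1) ^+ false *: rho (osp12_even b') n (rho (osp12_even a') m u) =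
   lcomb (fun c => rho c (m + n) u) (osp12_bracket K (osp12_even a') (osp12_even b'))
   + (if m + n == 0 then m%:~R * sl2_form K a' b' * level K else 0) *: u.
  have -> : osp12_bracket K (osp12_even a') (osp12_even b') =
    [seq (t.1, osp12_even t.2) | t <- sl2_bracket K a' b'] by case: a'.
  by rewrite /lcomb big_map; apply: (hr a' b' m n u).
case: a => [a||]; case: b => [b||]; first exact: ev.
- rewrite /= mulr0 mul0r if_same scale0r addr0; apply: z1.
  case: a; rewrite /lcomb ?big_cons big_nil /= ?addr0 ?scale1r ?scaleN1r -/x -/y;
    by [exact: ex_rel | exact: fx_rel | exact: hx_rel].
- rewrite /= mulr0 mul0r if_same scale0r addr0; apply: z1.
  case: a; rewrite /lcomb ?big_cons big_nil /= ?addr0 ?scale1r ?scaleN1r -/x -/y;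
    by [exact: ey_rel | exact: fy_rel | exact: hy_rel].
- rewrite /= mulr0 mul0r if_same scale0r addr0; apply: z1.
  case: b; rewrite /lcomb ?big_cons big_nil /= ?addr0 ?scale1r ?scaleN1r;
    by [exact: xe' | exact: xf' | exact: xh'].
- rewrite /= mulr0 mul0r if_same scale0r addr0; apply: z2.
  by rewrite /lcomb big_cons big_nil addr0; apply: xx_rel.
- apply: z2; rewrite /lcomb big_cons big_nil addr0 scale1r; exact: xy_rel.
- rewrite /= mulr0 mul0r if_same scale0r addr0; apply: z1.
  case: b; rewrite /lcomb ?big_cons big_nil /= ?addr0 ?scale1r ?scaleN1r;
    by [exact: ye' | exact: yf' | exact: yh'].
- apply: z2; rewrite /lcomb big_cons big_nil addr0 scale1r addrC [m + n]addrC xy_rel /=.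
  congr (_ + _ *: _); case: eqP => // hmn; have -> : m = - n by lia.
  by rewrite intrN; ring.
rewrite /= mulr0 mul0r if_same scale0r addr0; apply: z2.
by rewrite /lcomb big_cons big_nil addr0; apply: yy_rel.
Qed.

Lemma osp_action_vac b n : 0 <= n -> rho b n vac = 0.
Proof.
move=> hn; have hn1 : 0 <= n + 1 by lia.
by case: b => [b||] /=; rewrite ?modeNl !mode_annihil // ?oppr0 ?addr0.
Qed.

(** * Recovering G^+ and Gb^+ from osp(1|2), with degrees *)

Section GradedClosure.
Variable S : int -> set V.
Hypotheses (hS : forall n, is_subspace (S n))
  (hrho : forall n b m u, S n u -> S (n + mode_deg 4 1 b m) (rho b m u)).

Let Seq n n' u : S n u -> n = n' -> S n' u. Proof. by move=> hu <-. Qed.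
Let Se b n m u : S n u -> S (n - 4 * m - osp12_wt (osp12_even b)) (mode (s b) m u).
Proof. by move=> hu; apply: Seq (hrho (osp12_even b) m hu) _; rewrite /mode_deg; lia. Qed.

Let S_prod a b n u m (d : int) : d = n + 4 - 4 * m - (osp12_wt (osp12_even a) + osp12_wt
  (osp12_even b)) ->
  S n u -> S d (mode (mode (s a) (-1) (s b)) m u).
Proof.
move=> -> hu; refine (Y_iter_mem hV (hS _) (sl2_par hs a) (sl2_par hs b) _ _) => j.
  by apply: Seq (Se a _ (Se b _ hu)) _; lia.
by apply: Seq (Se b _ (Se a _ hu)) _; lia.
Qed.

(** Every product such as [e_(-1-j) f_j] in [L_sug(-1)] has degree 4. The family [S] is left
    arbitrary for the sake of two instances: a constant family in [osp_stable] and the principal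
    filtration in [osp_irreducible]. *)
Lemma graded_omega_sug n u : S n u -> S (n + 4) (mode om 0 u).
Proof.
move=> hu; rewrite /om /omega_sug !modeDl modeZl.
apply: (subspaceD (hS _)); first apply: (subspaceD (hS _)).
- by apply: (S_prod _ hu) => /=; lia.
- by apply: (S_prod _ hu) => /=; lia.
by apply: (subspaceZ _ (hS _)); apply: (S_prod _ hu) => /=; lia.
Qed.

(* Since L_sug(-1) is the translation operator of V2, bracketing with it and
   differentiating in z only differ on the explicit z in x(z) = G^+(z) - z Gb^+(z). *)
Lemma Gbp_of_x n u : mode Gbp n u = n%:~R *: x (n - 1) u + mode om 0 (x n u) - x n (mode om
  0 u).
Proof.
have cG G (i : G = Gp \/ G = Gbp) : conformal s G (3 / 2).
  exact: (conformal_G hs (fun n => n4r_e H i) (n4r_h0 H i) (fun n => n4r_h H i) (fun n =>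
    n4r_f H i) (n4r_D H i)).
rewrite !x_modeE modeDr modeNr.
rewrite !(conformal_mode0 hs _ _ (n4r_par H _) (cG _ _)) //.
by rewrite subrK addrK intrD; lmod K.
Qed.

Lemma graded_Gbp n m u : S n u -> S (n - 4 * m + 3) (mode Gbp m u).
Proof.
move=> hu; rewrite Gbp_of_x.
apply: (subspaceB (hS _)); first apply: (subspaceD (hS _)).
- by apply: (subspaceZ _ (hS _)); apply: Seq (hrho osp12_x _ hu) _; rewrite /mode_deg /=; lia.
- by apply: Seq (graded_omega_sug (hrho osp12_x _ hu)) _; rewrite /mode_deg /=; lia.
by apply: Seq (hrho osp12_x _ (graded_omega_sug hu)) _; rewrite /mode_deg /=; lia.
Qed.

Lemma graded_Gp n m u : S n u -> S (n - 4 * m - 1) (mode Gp m u).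
Proof.
move=> hu; have -> : mode Gp m u = x m u + mode Gbp (m + 1) u by rewrite x_modeE subrK.
apply: (subspaceD (hS _)).
  by apply: Seq (hrho osp12_x m hu) _; rewrite /mode_deg /=; lia.
by apply: Seq (graded_Gbp (m + 1) hu) _; lia.
Qed.

End GradedClosure.

(** Since the fields of V^(2) are expressed through osp(1|2) and [L_sug(-1)], a subspace stable
    under osp(1|2) is stable under all of V^(2). *)
Lemma osp_stable (S : set V) : is_subspace S ->
  (forall b m u, S u -> S (rho b m u)) -> forall v n u, S u -> S (mode v n u).
Proof.
move=> hS hrho v; pose S' (_ : int) := S.
have hS' n : is_subspace (S' n) by [].
have hr (n : int) b m u : S' n u -> S' (n + mode_deg 4 1 b m) (rho b m u) by apply: hrho.
have hp n u : S u -> S (mode Gp n u) by exact: (@graded_Gp S' hS' hr 0).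
have hb n u : S u -> S (mode Gbp n u) by exact: (@graded_Gbp S' hS' hr 0).
have hGs G (i : G = Gp \/ G = Gbp) : (forall n u, S u -> S (mode G n u)) ->
    forall n u, S u -> S (mode (mode f 0 G) n u).
  move=> hG0 n u hu; refine (Y_iter_mem hV hS (sl2_par hs sl2_f) (n4r_par H i) _ _) => j.
    by apply: (hrho (osp12_even sl2_f)); apply: hG0.
  by apply: hG0; apply: (hrho (osp12_even sl2_f)).
move: v (n4r_gen H v); apply: (generated_par_ind (P := [set v | forall n u,
  S u -> S (mode v n u)]%classic)).
- split=> [n u _|c v w hv hw n u hu]; first by rewrite mode0l; case: hS.
  by rewrite modeDl modeZl; have [_ q] := hS; apply: q; [apply: hv | apply: hw].
- by move=> n u hu; rewrite mode_vac; case: ifP => _ //; case: hS.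
- have pG' G (i : G = Gp \/ G = Gbp) : par true (mode f 0 G).
    exact: (mode_par 0 (sl2_par hs sl2_f) (n4r_par H i)).
  move=> v [[b ->]|[->|->|->|->]].
  + by split; [exact: (hrho (osp12_even b)) | exists false; apply: (sl2_par hs)].
  + by split=> //; exists true; apply: (n4r_par H).
  + by split=> //; exists true; apply: (n4r_par H).
  + by split; [apply: hGs | exists true; apply: pG'].
  split; last by exists true; apply: subspaceN (par_subspace V true) (pG' _ ib).
  by move=> n u hu; rewrite modeNl; apply: subspaceN => //; apply: hGs.
move=> p q a b n pa pb ha hb' k u hu.
refine (Y_iter_mem hV hS pa pb _ _) => j; first by apply: ha; apply: hb'.
by apply: hb'; apply: ha.
Qed.

Lemma osp_generates (S : set V) : is_subspace S ->
  (forall b m u, S u -> S (rho b m u)) -> S vac -> forall v, S v.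
Proof. by move=> hS hr h1 v; rewrite -[v]mode_create; apply: osp_stable. Qed.

Let T := mode om 1.
Let hT : linear T. Proof. exact: YrP. Qed.
Definition pos_energy : set V := eigen_sum T [set l | 0 < l]%classic.
Definition nonneg_energy : set V := eigen_sum T [set l | 0 <= l]%classic.

Lemma nonneg_energy_vac : nonneg_energy vac.
Proof.
apply: (eigen_sum1 (l := 0)); first exact: lexx.
by rewrite /T mode_annihil // scale0r.
Qed.

Lemma conformal_pos (k : K) a u n : (exists p, par p a) -> conformal s a k ->
  0 < k - n%:~R - 1 -> nonneg_energy u -> pos_energy (mode a n u).
Proof.
move=> [p pa] ca hk; apply: (eigen_sum_shift (d := k - n%:~R - 1)) => //.
- exact: YrP.
- by move=> v; apply: (conformal_mode1 hs n v pa ca).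
by move=> l /= hl; apply: ltr_wpDl.
Qed.

(** At index [- m - 1] the two terms of [x] raise the [L_sug(0)]-eigenvalue by [m + 3/2] and
    [m + 1/2]. The shift of the second term by one mode is harmless because the weight 3/2 exceeds
    1. *)
Lemma osp_pos_energy b m u : m < 0 -> nonneg_energy u -> pos_energy (rho b m u).
Proof.
have hP : is_subspace pos_energy := eigen_sum_subspace _ hT.
case: m => // m _ hu; rewrite NegzE.
have pG G (i : G = Gp \/ G = Gbp) : exists p, par p G by exists true; apply: n4r_par H _ i.
have cG G (i : G = Gp \/ G = Gbp) : conformal s G (3 / 2).
  exact: (conformal_G hs (fun n => n4r_e H i) (n4r_h0 H i) (fun n => n4r_h H i) (fun n =>
    n4r_f H i) (n4r_D H i)).
have pG' G (i : G = Gp \/ G = Gbp) : exists p, par p (mode f 0 G).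
  by exists true; exact: (mode_par 0 (sl2_par hs sl2_f) (n4r_par H i)).
have cG' G (i : G = Gp \/ G = Gbp) : conformal s (mode f 0 G) (3 / 2).
  exact: (conformal_G' hs (fun n => n4r_e H i) (n4r_h0 H i) (fun n => n4r_h H i) (fun n =>
    n4r_f H i) (n4r_D H i)).
have k1 : 0 < 3 / 2 - (- m.+1%:Z)%:~R - 1 :> K.
  rewrite (_ : _ - _ = m%:R + 3 / 2); last by rewrite intrN -[m.+1%:~R]/(m.+1%:R)
    -[m.+1]addn1 natrD; field.
  by apply: ltr_wpDl => //; apply: divr_gt0.
have k2 : 0 < 3 / 2 - (- m.+1%:Z + 1)%:~R - 1 :> K.
  rewrite (_ : _ - _ = m%:R + 1 / 2); last by rewrite intrD intrN -[m.+1%:~R]/(m.+1%:R)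
    -[m.+1]addn1 natrD; field.
  by apply: ltr_wpDl => //; apply: divr_gt0.
case: b => [b||] /=.
- apply: (conformal_pos (k := 1)) hu; first by exists false; apply: (sl2_par hs).
    exact: conformal_sl2.
  by rewrite (_ : _ - _ = m.+1%:R) ?ltr0n // intrN -[m.+1%:~R]/(m.+1%:R); ring.
- by apply: (subspaceB hP); [apply: (conformal_pos (pG _ ip) (cG _ ip)) | apply:
  (conformal_pos (pG _ ib) (cG _ ib))].
rewrite modeNl; apply: (subspaceB hP); apply: (subspaceN hP).
  exact: (conformal_pos (pG' _ ip) (cG' _ ip)).
exact: (conformal_pos (pG' _ ib) (cG' _ ib)).
Qed.

Lemma pos_nonneg u : pos_energy u -> nonneg_energy u.
Proof.
move=> [n [z [l [-> hx]]]]; exists n, z, l; split=> // i hi; have [h1 h2] := hx i hi.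
by split=> //; apply: ltW.
Qed.

Let mdeg b (m : int) : m < 0 -> 0 < mode_deg 4 1 b m.
Proof. by rewrite /mode_deg; case: b => [[]||] /=; lia. Qed.

Lemma neg_span_all u : exists n : nat, neg_span rho vac 4 1 true n%:Z u.
Proof.
have hw n n' w : n <= n' -> neg_span rho vac 4 1 true n w -> neg_span rho vac 4 1 true n' w.
  exact: neg_span_weak.
suff [n hn] : exists n, neg_span rho vac 4 1 true n u.
  by exists `|n|%N; apply: hw hn; rewrite abszE ler_norm.
move: u; apply: (osp_generates (S := [set u | exists n,
  neg_span rho vac 4 1 true n u]%classic)).
- split=> [|c u v [n hu] [m hv]]; first by exists 0; apply: neg_span_zero.
  exists (Num.max n m); apply: neg_span_lin.
    by apply: hw hu; rewrite le_max lexx.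
  by apply: hw hv; rewrite le_max lexx orbT.
- move=> b m u [n hu]; exists (n + mode_deg 4 1 b m).
  exact: (neg_span_rho osp_action_affine osp_action_vac hu).
by exists 0; apply: neg_span_vac.
Qed.

Lemma vac_pos_decomp u : exists c p, pos_energy p /\ u = c *: vac + p.
Proof.
have hP : is_subspace pos_energy := eigen_sum_subspace _ hT.
have [n hn] := neg_span_all u; elim: hn => {n u} [|n|c n u v _ [a [p [hp ->]]] _ [b [q [hq
  ->]]]|b m n u hm _ [c [p [hp ->]]]|//].
- by exists 1, 0; rewrite scale1r addr0; split=> //; case: hP.
- by exists 0, 0; rewrite scale0r addr0; split=> //; case: hP.
- exists (c * a + b), (c *: p + q); split; first by case: hP => _; apply.
  by lmod K.
exists 0, (rho b m (c *: vac + p)); rewrite scale0r add0r; split=> //.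
apply: osp_pos_energy => //; have [_ q] := eigen_sum_subspace [set l | 0 <= l]%classic hT.
by apply: q; [apply: nonneg_energy_vac | apply: pos_nonneg].
Qed.

Lemma osp_pos b m u : m < 0 -> pos_energy (rho b m u).
Proof.
move=> hm; apply: osp_pos_energy => //; have [c [p [hp ->]]] := vac_pos_decomp u.
have [_ q] := eigen_sum_subspace [set l | 0 <= l]%classic hT.
by apply: q; [apply: nonneg_energy_vac | apply: pos_nonneg].
Qed.

Lemma vac_not_pos : ~ pos_energy vac.
Proof.
move=> hv; have /eqP := n4r_vac H; apply.
by apply: (eigen_sum_inj (mu := 0) hT) hv _; rewrite /= ?ltxx // /T mode_annihil // scale0r.
Qed.

Lemma singular_is_vac u : (forall n, 0 <= n -> mode e n u = 0) ->
  (forall n, 1 <= n -> mode h n u = 0) -> (forall n, 1 <= n -> mode f n u = 0) ->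
  (forall n, 1 <= n -> mode Gp n u = 0) -> (forall n, 1 <= n -> mode Gbp n u = 0) ->
  exists c, u = c *: vac.
Proof.
move=> he hh hf hp hb; have h0 := n4r_sing H he hh (hf 1 erefl) hp hb.
have hTu : T u = (1 / 2) *: mode h 0 u.
  rewrite /T (omega_sug1_singular hs he hh hf).
  transitivity ((1 / 2) *: mode h 0 u + (1 / 2) *: (mode h 0 (mode h 0 u) + mode h 0 u)).
    by lmod K.
  by rewrite h0 scaler0 addr0.
have hTh v : T (mode h 0 v) = mode h 0 (T v).
  rewrite /T (conformal_mode1 hs 0 v (sl2_par hs sl2_h) (conformal_sl2 hs sl2_h)).
  by rewrite subr0 subrr scale0r addr0.
have hTT : T (T u + (1 / 2) *: u) = 0.
  rewrite (linD hT) (linZ hT) {2}hTu hTu (linZ hT) hTh hTu modeZr.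
  transitivity ((1 / 4) *: (mode h 0 (mode h 0 u) + mode h 0 u)); first by lmod K.
  by rewrite h0 scaler0.
have [c [p [pp eu]]] := vac_pos_decomp u.
have Tv : T vac = 0 by rewrite /T mode_annihil.
have hP : is_subspace pos_energy := eigen_sum_subspace _ hT.
(* [T (T + 1/2)] kills [u] and the vacuum, hence [p]. The eigenvalues 0 and then -1/2 are excluded
   in turn on sums of eigenvectors with positive eigenvalues. *)
have q0 : T p + (1 / 2) *: p = 0.
  apply: (eigen_sum_inj (mu := 0) (Lam := [set l | 0 < l]%classic) hT);
    first by rewrite /= ltxx.
    apply: (subspaceD hP); last exact: subspaceZ.
    apply: (eigen_sum_shift (d := 0)) pp => //; first by move=> v; rewrite scale0r addr0.
    by move=> l; rewrite addr0.
  have Tup : T u = T p by rewrite eu (linD hT) (linZ hT) Tv scaler0 add0r.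
  by move: hTT; rewrite !(linD hT) !(linZ hT) Tup scale0r.
have p0 : p = 0.
  apply: (eigen_sum_inj (mu := - (1 / 2)) (Lam := [set l | 0 < l]%classic) hT) pp _.
    move=> /=; rewrite oppr_gt0 => hlt; have hgt : 0 < 1 / 2 :> K by apply: divr_gt0.
    by have := lt_trans hlt hgt; rewrite ltxx.
  by rewrite scaleNr; apply/eqP; rewrite -addr_eq0; apply/eqP.
by exists c; rewrite eu p0 addr0.
Qed.

Lemma osp_irreducible (N : set V) : is_subspace N ->
  (forall b m u, N u -> N (rho b m u)) -> (exists u, N u /\ u != 0) -> forall v, N v.
Proof.
move=> hN hr [u [Nu u0]]; apply: osp_generates => //.
have hst := osp_stable hN hr.
have [n hn] := neg_span_all u; move: u Nu u0 hn.
elim/ltn_ind: n => n IH u Nu u0 hn.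
have [[n' [w [lt_n' Nw w0 hw]]]|hmin] := pselect (exists (n' : nat) w,
    [/\ (n' < n)%N, N w, w != 0 & neg_span rho vac 4 1 true n'%:Z w]).
  exact: IH lt_n' _ Nw w0 hw.
have haff := osp_action_affine; have hvac := osp_action_vac.
(* Below degree 0 the filtration is zero; from 0 up to [n - 1] the minimality of [n] applies. *)
have zero d w : d < 0 -> N w -> neg_span rho vac 4 1 true (n%:Z + d) w -> w = 0.
  move=> hd Nw hw; have [hneg|hpos] := ltP (n%:Z + d) 0.
    by have [+ _] := neg_span_le0 haff mdeg hw; apply.
  apply/eqP/negPn/negP => w0; apply: hmin; exists (absz (n%:Z + d)), w; split=> //;
    first by lia.
  by have -> : (absz (n%:Z + d))%:Z = n%:Z + d by lia.
have hS m : is_subspace (neg_span rho vac 4 1 true m) by apply: neg_span_subspace.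
have hSr m b k w : neg_span rho vac 4 1 true m w -> neg_span rho vac 4 1 true (m + mode_deg
  4 1 b k) (rho b k w).
  by move=> hw; apply: (neg_span_rho haff hvac hw).
have zr b m : mode_deg 4 1 b m < 0 -> rho b m u = 0.
  by move=> hd; apply: zero hd _ _; [apply: hr | apply: hSr].
have [c ec] : exists c, u = c *: vac.
  apply: singular_is_vac => m hm.
  - by apply: (zr (osp12_even sl2_e)); rewrite /mode_deg /=; lia.
  - by apply: (zr (osp12_even sl2_h)); rewrite /mode_deg /=; lia.
  - by apply: (zr (osp12_even sl2_f)); rewrite /mode_deg /=; lia.
  (* G^+ and Gb^+ are not currents of osp(1|2), so their degrees [- 4 m - 1] and [- 4 m + 3] come
     from [graded_Gp] and [graded_Gbp]; both are negative for [m >= 1]. *)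
  - apply: (zero (- (4 * m) - 1)); [by lia | exact: hst|].
    by rewrite addrA; apply: (graded_Gp hS hSr).
  - apply: (zero (- (4 * m) + 3)); [by lia | exact: hst|].
    by rewrite addrA; apply: (graded_Gbp hS hSr).
have c0 : c != 0 by apply: contraNneq u0 => c0; rewrite ec c0 scale0r.
by rewrite -[vac]scale1r -(mulVf c0) -scalerA -ec; apply: subspaceZ.
Qed.

End OspAction.

Lemma generated_mono (K : numFieldType) (V : vsa K) (S S' : set V) v :
  (forall w, S w -> generated S' w) -> generated S v -> generated S' v.
Proof.
move=> h; elim=> {v} [v /h //||c u v _ hu _ hv|u n v _ hu _ hv].
- exact: generated_vac.
- exact: generated_lin.
exact: generated_mode.
Qed.

Lemma generated_subspace (K : numFieldType) (V : vsa K) (S : set V) :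
  is_subspace (generated S).
Proof.
split=> [|c u v]; last exact: generated_lin.
have := generated_lin (-1) (generated_vac S) (generated_vac S).
by rewrite scaleN1r addNr.
Qed.

(** * The relations of V^(2), read off in the free field algebra *)

Section SmallN4.
Variables (K : numFieldType) (V2 : small_N4 K).
Let V : vsa K := V2.
Let A : vsa K := n4_ff V2.
Let inc : V -> A := @n4_incl _ V2.
Let ap : A := ffA_ap (n4_ff V2).
Let am : A := ffA_am (n4_ff V2).
Let c : A := ffA_c (n4_ff V2).
Let nu : A := ffA_nu (n4_ff V2).
Let E : int -> A := @ffA_E K (n4_ff V2).
Let H : free_field_rel ap am c nu E := free_field_relP (n4_ff V2).
Let s : sl2_basis -> V := @n4_sl2 _ V2.
Let Gp : V := n4_Gp V2.
Let Gbp : V := n4_Gbp V2.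

Let hom : is_vsa_hom inc. Proof. by case: (n4_inclP V2). Qed.
Let inj : injective inc. Proof. by case: (n4_inclP V2). Qed.
Let incm a n b : inc (mode a n b) = mode (inc a) n (inc b). Proof. by case: hom. Qed.
Let ilin : linear inc. Proof. by case: hom. Qed.
Let ivac : inc vac = vac. Proof. by case: hom. Qed.

Let ie : inc (s sl2_e) = E 2 := n4_eE V2.
Let ih : inc (s sl2_h) = ff_hvec c nu.
Proof. by rewrite /inc /s n4_hE ff_hE. Qed.
Let iF : inc (s sl2_f) = ff_fvec ap am nu E.
Proof. by rewrite /inc /s n4_fE ff_fE. Qed.
Let iGp : inc Gp = current E ap.
Proof. by rewrite /inc /Gp n4_GpE ff_GpE. Qed.
Let iGbp : inc Gbp = 2 *: current E am.
Proof. by rewrite /inc /Gbp n4_GbpE ff_GbpE. Qed.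

Lemma n4_GmE' : n4_Gm V2 = mode (s sl2_f) 0 Gp.
Proof. by apply: inj; rewrite incm /inc n4_GmE n4_fE n4_GpE. Qed.
Lemma n4_GbmE' : n4_Gbm V2 = - mode (s sl2_f) 0 Gbp.
Proof. by apply: inj; rewrite (linN ilin) incm /inc n4_GbmE n4_fE n4_GbpE. Qed.

Let iG G : G = Gp \/ G = Gbp -> exists a (k : K), (a = ap \/ a = am) /\ inc G = k *:
  current E a.
Proof.
case=> ->; first by exists ap, 1; rewrite scale1r; split; [left|].
by exists am, 2; split; [right|].
Qed.

(** The vanishing of zero modes and the nilpotence of the [c_j] are available on vectors generated
    by the free fields; this places V^(2) among them. *)
Let gen_ff u : generated (ff_gens ap am c nu E) (inc u).
Proof.
set S := ff_gens _ _ _ _ _.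
have [_ _ him] := n4_inclP V2.
have hS : is_subspace (generated S) := generated_subspace S.
have gE m : generated S (E m) by apply: generated_in; right; exists m.
have gap : generated S ap by apply: generated_in; left; apply: Or41.
have gam : generated S am by apply: generated_in; left; apply: Or42.
have gc : generated S c by apply: generated_in; left; apply: Or43.
have gnu : generated S nu by apply: generated_in; left; apply: Or44.
have gf : generated S (ff_f (n4_ff V2)).
  rewrite ff_fE; apply: (subspaceD hS); first apply: (subspaceB hS).
  - by apply: (subspaceZ _ hS); do 2?[apply: generated_mode => //].
  - by do 2![apply: generated_mode => //].
  by apply: (subspaceZ _ hS); apply: generated_mode.
have gGp : generated S (ff_Gp (n4_ff V2)) by rewrite ff_GpE; apply: generated_mode.
have gGbp : generated S (ff_Gbp (n4_ff V2)).
  by rewrite ff_GbpE; apply: (subspaceZ _ hS); apply: generated_mode.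
have hu := (him (inc u)).2 (ex_intro _ u erefl); apply: generated_mono hu => w
  [[->|->|->]|[->|->|->|->]] //.
- exact: gE.
- by rewrite ff_hE; apply: (subspaceB hS); apply: (subspaceZ _ hS).
- exact: generated_mode.
by apply: (subspaceN hS); apply: generated_mode.
Qed.

Lemma n4_generated v : generated
    ([set w | (exists b, w = s b) \/ [\/ w = Gp, w = Gbp, w = mode (s sl2_f) 0 Gp
       | w = - mode (s sl2_f) 0 Gbp]])%classic v.
Proof.
set S := (X in generated X _); have [_ _ him] := n4_inclP V2.
suff [v' [e hv']] : exists v', inc v' = inc v /\ generated S v'.
  by rewrite -(inj e).
have := (him (inc v)).2 (ex_intro _ v erefl); elim=> [w||k u w _ [u' [<- hu]] _ [w' [<-
  hw]]|u n w _ [u' [<- hu]] _ [w' [<- hw]]].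
- have hb b : generated S (s b) by apply: generated_in; left; exists b.
  case=> [[->|->|->]|[->|->|->|->]].
  + by exists (s sl2_e); split; [exact: n4_eE | apply: hb].
  + by exists (s sl2_h); split; [exact: n4_hE | apply: hb].
  + by exists (s sl2_f); split; [exact: n4_fE | apply: hb].
  + by exists Gp; split; [exact: n4_GpE | apply: generated_in; right; apply: Or41].
  + by exists Gbp; split; [exact: n4_GbpE | apply: generated_in; right; apply: Or42].
  + by exists (n4_Gm V2); split; [exact: n4_GmE | apply: generated_in; right; apply: Or43;
    exact: n4_GmE'].
  by exists (n4_Gbm V2); split; [exact: n4_GbmE | apply: generated_in; right; apply: Or44;
    exact: n4_GbmE'].
- by exists vac; split; [exact: ivac | exact: generated_vac].
- by exists (k *: u' + w'); split; [rewrite ilin | apply: generated_lin].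
by exists (mode u' n w'); split; [rewrite incm | apply: generated_mode].
Qed.

Lemma small_N4_rel : are_affine_currents (g := sl2 K) (level K) s -> n4_rel s Gp Gbp.
Proof.
move=> hs; have i0 : inc 0 = 0 := lin0 ilin.
split=> //.
- move=> G i; apply: (vsa_hom_reflect_par hom inj); have [a [k [ha ->]]] := iG i.
  exact: subspaceZ (par_subspace A true) (par_current H ha).
- move=> G n i hn; apply: inj; rewrite incm ie i0; have [a [k [ha ->]]] := iG i.
  by rewrite modeZr (current_e H ha hn) scaler0.
- move=> G i; apply: inj; rewrite incm ih; have [a [k [ha ->]]] := iG i.
  by rewrite modeZr (current_h0 H ha).
- move=> G n i hn; apply: inj; rewrite incm ih i0; have [a [k [ha ->]]] := iG i.
  by rewrite modeZr (current_h H ha hn) scaler0.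
- move=> G n i hn; apply: inj; rewrite incm iF i0; have [a [k [ha ->]]] := iG i.
  by rewrite modeZr (current_f H ha hn) scaler0.
- move=> G i; apply: inj; rewrite !incm iF i0; have [a [k [ha ->]]] := iG i.
  by rewrite !modeZr (current_f0f0 H ha) scaler0.
- move=> G i; apply: inj; rewrite /translation incm ivac (linD ilin) !(linZ ilin) !incm ie
  ih iF.
  have [a [k [ha ->]]] := iG i; rewrite modeZl -/(translation _) (current_translation H ha)
    !modeZr.
  lmod K.
- move=> G m n u i; apply: inj; rewrite (linD ilin) !incm i0.
  have [a [k [ha ->]]] := iG i; rewrite !modeZl !modeZr.
  transitivity ((k * k) *: (mode (current E a) m (mode (current E a) n (inc u)) +
     mode (current E a) n (mode (current E a) m (inc u)))); first by lmod K.
  by rewrite (current_sq_comm H _ _ _ ha) scaler0.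
- move=> m n u; apply: inj; rewrite (linD ilin) (linZ ilin) !incm iGp iGbp ie !modeZl !modeZr.
  rewrite -scalerDr (current_pm_comm H); lmod K.
- move=> u he hh hf hp hb; apply: inj; rewrite (linD ilin) !incm ih i0.
  apply: (singular_h0 H (gen_ff u)) => [n hn|n hn||n hn|n hn].
  + by rewrite -ie -incm he.
  + by rewrite -ih -incm hh.
  + by rewrite -iF -incm hf.
  + by rewrite -iGp -incm hp.
  have := congr1 inc (hb n hn); rewrite incm iGbp modeZl i0 => /eqP.
  by rewrite scaler_eq0 pnatr_eq0 /= => /eqP.
- exact: n4_generated.
apply/eqP => /(congr1 inc); rewrite ivac i0; apply/eqP; exact: ff_vac_neq0.
Qed.

End SmallN4.

(** * Comparison with the simple affine algebra *)

Section Isomorphism.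
Variables (K : numFieldType) (V : vsa K) (s : sl2_basis -> V) (Gp Gbp : V).
Hypothesis H : n4_rel s Gp Gbp.
Let rho := osp_action s Gp Gbp.
Let hs := n4r_currents H.

Lemma osp_action_par p b n u : par p u -> par (lpar (l := osp12 K) b (+) p) (rho b n u).
Proof.
move=> hu; have pG G (i : G = Gp \/ G = Gbp) := n4r_par H i.
have pG' G (i : G = Gp \/ G = Gbp) : par true (mode (s sl2_f) 0 G).
  exact: (mode_par 0 (sl2_par hs sl2_f) (pG _ i)).
have hS r : is_subspace (par r : set V) := par_subspace V r.
case: b => [b||] /=.
- exact: (mode_par n (sl2_par hs b) hu).
- by apply: (subspaceB (hS _)); apply: (mode_par _ (p := true) _ hu) => //; apply: pG;
  [left|right].
apply: (subspaceB (hS _)).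
  by apply: (subspaceN (hS _)); apply: (mode_par _ (pG' _ _) hu) => //; left.
by rewrite modeNl; apply: (subspaceN (hS _)); apply: (mode_par _ (pG' _ _) hu) => //; right.
Qed.

Lemma vsa_nonzero_vac (W : vsa K) : (exists v : W, v != 0) -> (vac : W) != 0.
Proof.
move=> [v v0]; apply/eqP => h; move/eqP: v0; apply.
by have := mode_vac (v := W) (-1) v; rewrite eqxx h mode0l.
Qed.

Section Universal.
Variables (U : vsa K) (iU : lbasis (osp12 K) -> U).
Hypothesis hU : is_universal_affine (level K) iU.
Variable psi : U -> V.
Hypotheses (plin : linear psi) (pvac : psi vac = vac)
  (prho : forall b n u, psi (mode (iU b) n u) = rho b n (psi u)).
Let hc : are_affine_currents (level K) iU := hU.1.
Let rlin b n : linear (rho b n) := osp_action_linear s Gp Gbp b n.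
Let hmU := mode_module U.

Lemma psi_surj v : exists u, psi u = v.
Proof.
apply: (osp_generates H (S := [set v | exists u, psi u = v]%classic)).
- split=> [|c _ _ [u <-] [w <-]]; first by exists 0; apply: lin0.
  by exists (c *: u + w); rewrite plin.
- by move=> b m _ [u <-]; exists (mode (iU b) m u).
by exists vac.
Qed.

(** The universal property says nothing about parity. The induction shows that each vector has
    homogeneous components whose images are homogeneous, and such components are unique. *)
Lemma psi_par p u : par p u -> par p (psi u).
Proof.
have hSU r : is_subspace (par r : set U) := par_subspace U r.
have hSV r : is_subspace (par r : set V) := par_subspace V r.
have [u0 [u1 [[a0 a1] [b0 b1] ->]]] : exists u0 u1, [/\ par false u0 /\ par false (psi u0),
    par true u1 /\ par true (psi u1) & u = u0 + u1].
  move: u; apply: (universal_affine_ind (S := [set u | exists u0 u1,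
    [/\ par false u0 /\ par false (psi u0),
    par true u1 /\ par true (psi u1) & u = u0 + u1]]%classic) hU).
  - split=> [|c _ _ [u0 [u1 [[a0 a1] [b0 b1] ->]]] [w0 [w1 [[c0 c1] [d0 d1] ->]]]].
      by exists 0, 0; rewrite addr0 (lin0 plin); split=> //; split; apply: par0.
    exists (c *: u0 + w0), (c *: u1 + w1); rewrite !plin.
    split; [split | split | lmod K].
    + by case: (hSU false) => _; apply.
    + by case: (hSV false) => _; apply.
    + by case: (hSU true) => _; apply.
    + by case: (hSV true) => _; apply.
  - exists vac, 0; rewrite addr0 (lin0 plin) pvac; split=> //; split;
    by [apply: vac_even | apply: par0].
  move=> b n _ [u0 [u1 [[a0 a1] [b0 b1] ->]]]; rewrite modeDr.
  have pb := hc.1 b; case eb: (lpar b) pb => pb.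
    exists (mode (iU b) n u1), (mode (iU b) n u0); rewrite !prho addrC.
    have q1 := osp_action_par b n b1; have q0 := osp_action_par b n a1.
    rewrite eb in q1 q0; split=> //; split=> //.
      exact: (mode_par n pb b0 erefl).
    exact: (mode_par n pb a0 erefl).
  exists (mode (iU b) n u0), (mode (iU b) n u1); rewrite !prho.
  have q1 := osp_action_par b n b1; have q0 := osp_action_par b n a1.
  rewrite eb in q1 q0; split=> //; split=> //.
    exact: (mode_par n pb a0 erefl).
  exact: (mode_par n pb b0 erefl).
case: p => hp.
  have u00 : u0 = 0.
    apply: par_direct => //; rewrite -[u0](addrK u1); exact: subspaceB.
  by rewrite u00 add0r.
have u10 : u1 = 0.
  apply: par_direct => //; rewrite -[u1](addKr u0) addrC; exact: subspaceB.
by rewrite u10 addr0.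
Qed.

(* A complement of the vacuum line. *)
Definition aug : set U := fun u => forall S : set U, is_subspace S ->
  (forall b m v, m < 0 -> S (mode (iU b) m v)) -> S u.

Lemma aug_subspace : is_subspace aug.
Proof.
split=> [S hS _|c u v hu hv S hS hm]; first by case: hS.
by case: (hS) => _; apply; [apply: hu | apply: hv].
Qed.

Lemma aug_mode b m v : m < 0 -> aug (mode (iU b) m v).
Proof. by move=> hm S _; apply. Qed.

Lemma aug_translation u : aug u -> aug (translation u).
Proof.
move=> hu; apply: (hu [set u | aug (translation u)]%classic); first split.
- by rewrite /translation /= mode0l; case: aug_subspace.
- move=> c v w hv hw; rewrite /= /translation modeDl modeZl.
  by case: aug_subspace => _; apply.
move=> b m v hm; rewrite /= translation_mode; apply: (subspaceB aug_subspace).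
  exact: aug_mode.
by apply: (subspaceZ _ aug_subspace); apply: aug_mode; lia.
Qed.

(** The energy is that of V^(2) and has no counterpart on [U]; it is nevertheless positive on the
    image of every negative mode. *)
Lemma aug_pos u : aug u -> pos_energy s (psi u).
Proof.
have hP : is_subspace (pos_energy s) by apply: eigen_sum_subspace;
  apply: YrP (mode_module V) _ _.
move=> hu; apply: (hu [set u | pos_energy s (psi u)]%classic).
- split=> [|c v w hv hw] /=; first by rewrite (lin0 plin); case: hP.
  by rewrite plin; case: hP => _; apply.
by move=> b m v hm; rewrite /= prho; apply: (osp_pos H).
Qed.

Lemma aug_not_vac u : aug u -> psi u <> vac.
Proof. by move=> /aug_pos + e; rewrite e; apply: (vac_not_pos H). Qed.

Let hneg_rho := currents_affine_module hc hmU.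
Let hneg_vac b (n : int) : 0 <= n -> mode (iU b) n vac = 0.
Proof. exact: mode_annihil. Qed.
Let hdeg b (m : int) : m < 0 -> 0 < mode_deg 1 0 b m.
Proof. by rewrite /mode_deg; lia. Qed.

Lemma universal_decomp u : exists c p, aug p /\ u = c *: vac + p.
Proof.
have hw n n' w : n <= n' -> neg_span (fun b => mode (iU b)) vac 1 0 true n w ->
    neg_span (fun b => mode (iU b)) vac 1 0 true n' w by exact: neg_span_weak.
have [n hn] : exists n, neg_span (fun b => mode (iU b)) vac 1 0 true n u.
  move: u; apply: (universal_affine_ind (S := [set u | exists n,
    neg_span (fun b => mode (iU b)) vac 1 0 true n u]%classic) hU).
  - split=> [|c u v [n hu] [m hv]]; first by exists 0; apply: neg_span_zero.
    exists (Num.max n m); apply: neg_span_lin.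
      by apply: hw hu; rewrite le_max lexx.
    by apply: hw hv; rewrite le_max lexx orbT.
  - by exists 0; apply: neg_span_vac.
  move=> b m u [n hu]; exists (n + mode_deg 1 0 b m).
  exact: (neg_span_rho hneg_rho hneg_vac hu).
elim: hn => {n u} [|n|c n u v _ [a [p [hp ->]]] _ [b [q [hq ->]]]|b m n u hm _ _|//].
- by exists 1, 0; rewrite scale1r addr0; split=> //; case: aug_subspace.
- by exists 0, 0; rewrite scale0r addr0; split=> //; case: aug_subspace.
- exists (c * a + b), (c *: p + q); split; first by case: aug_subspace => _; apply.
  by lmod K.
by exists 0, (mode (iU b) m u); rewrite scale0r add0r; split=> //; apply: aug_mode.
Qed.

Lemma ker_aug u : psi u = 0 -> aug u.
Proof.
have [c [p [hp ->]]] := universal_decomp u; rewrite plin pvac => /eqP;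
  rewrite addr_eq0 => /eqP e.
have [->|c0] := eqVneq c 0; first by rewrite scale0r add0r.
(* For [c != 0] this vector of [aug] would be sent to the vacuum. *)
case: (aug_not_vac (u := - c^-1 *: p)).
  exact: subspaceZ aug_subspace hp.
rewrite (linZ plin) scaleNr -scalerN -e scalerA mulVf // scale1r //.
Qed.

(* [ker psi] is only a left ideal; its closure under the translation operator is
   two-sided, by skew symmetry. *)
Definition tker : set U := fun u => forall S : set U, is_subspace S ->
  (forall v, psi v = 0 -> S v) -> (forall v, S v -> S (translation v)) -> S u.

Lemma tker_subspace : is_subspace tker.
Proof.
split=> [S hS _ _|c u v hu hv S hS h1 h2]; first by case: hS.
by case: (hS) => _; apply; [apply: hu | apply: hv].
Qed.
Lemma tker_ker u : psi u = 0 -> tker u.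
Proof. by move=> hu S _ h1 _; apply: h1. Qed.
Lemma tker_translation u : tker u -> tker (translation u).
Proof. by move=> hu S hS h1 h2; apply: (h2 u); exact: (hu S hS h1 h2). Qed.
Lemma tker_aug u : tker u -> aug u.
Proof. by apply; [exact: aug_subspace | exact: ker_aug | exact: aug_translation]. Qed.

Lemma tker_current b n u : tker u -> tker (mode (iU b) n u).
Proof.
move=> hu; move: b n; move: u hu.
suff h u : tker u -> [set u | forall b n, tker (mode (iU b) n u)]%classic u by move=> u /h.
apply.
- split=> [b n|c v w hv hw b n] /=; first by rewrite mode0r; case: tker_subspace.
  by rewrite modeDr modeZr; case: tker_subspace => _; apply; [apply: hv | apply: hw].
- by move=> v hv b n; apply: tker_ker; rewrite prho hv; apply: (lin0 (rlin b n)).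
move=> v hv b n.
have -> : mode (iU b) n (translation v) =
    translation (mode (iU b) n v) + n%:~R *: mode (iU b) (n - 1) v.
  by rewrite translation_mode subrK.
apply: (subspaceD tker_subspace); first by apply: tker_translation; apply: hv.
by apply: (subspaceZ _ tker_subspace); apply: hv.
Qed.

Lemma tker_left a n u : tker u -> tker (mode a n u).
Proof.
move: a (universal_affine_generated hU a) n u.
apply: (generated_par_ind (P := [set a | forall n u, tker u -> tker (mode a n u)]%classic)).
- split=> [n u _|c a b ha hb n u hu] /=; first by rewrite mode0l; case: tker_subspace.
  by rewrite modeDl modeZl; case: tker_subspace => _; apply; [apply: ha | apply: hb].
- by move=> n u hu; rewrite mode_vac; case: ifP => _ //; case: tker_subspace.
- move=> _ [b ->]; split; first by move=> n u; apply: tker_current.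
  by exists (lpar b); apply: hc.1.
move=> p q a b n pa pb ha hb k u hu.
refine (Y_iter_mem hmU tker_subspace pa pb _ _) => j; first by apply: ha; apply: hb.
by apply: hb; apply: ha.
Qed.

Lemma tker_par u : tker u -> exists u0 u1,
  [/\ par false u0 /\ tker u0, par true u1 /\ tker u1 & u = u0 + u1].
Proof.
have hSU r : is_subspace (par r : set U) := par_subspace U r.
move=> hu; apply: (hu [set u | exists u0 u1,
  [/\ par false u0 /\ tker u0, par true u1 /\ tker u1 & u = u0 + u1]]%classic).
- split=> [|c _ _ [u0 [u1 [[a0 a1] [b0 b1] ->]]] [w0 [w1 [[c0 c1] [d0 d1] ->]]]].
    by exists 0, 0; rewrite addr0; split=> //; split;
      first [apply: par0 | case: tker_subspace].
  exists (c *: u0 + w0), (c *: u1 + w1).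
  split; [split | split | lmod K].
  + by case: (hSU false) => _; apply.
  + by case: tker_subspace => _; apply.
  + by case: (hSU true) => _; apply.
  + by case: tker_subspace => _; apply.
- move=> v hv; have [v0 [v1 [p0 p1 ev]]] := @par_sum _ U v.
  have e : psi v0 + psi v1 = 0 by rewrite -(linD plin) -ev.
  have e0 : psi v0 = 0.
    apply: par_direct; first exact: psi_par p0.
    have -> : psi v0 = - psi v1 by apply/eqP; rewrite -addr_eq0 e.
    exact: subspaceN (par_subspace V true) (psi_par p1).
  exists v0, v1; split=> //; split=> //; apply: tker_ker => //.
  by move: e; rewrite e0 add0r.
move=> _ [u0 [u1 [[a0 a1] [b0 b1] ->]]].
exists (translation u0), (translation u1); rewrite /translation modeDl.
split=> //; split; try exact: tker_translation.
  exact: (mode_par _ a0 (@vac_even _ U)).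
exact: (mode_par _ b0 (@vac_even _ U)).
Qed.

(** Induction on [w]. At the vacuum [u_n vac] is 0 or a multiple of a translate of [u]; past a
    current, the commutator formula leaves [b_m u_n w] and modes of the vectors [b_j u], which lie
    in [tker] again. *)
Lemma tker_right u n w : tker u -> tker (mode u n w).
Proof.
have hS := tker_subspace.
move: w u n; apply: (universal_affine_ind (S := [set w | forall u n,
  tker u -> tker (mode u n w)]%classic) hU).
- split=> [u n _|c w w' hw hw' u n hu] /=; first by rewrite mode0r; case: hS.
  by rewrite modeDr modeZr; case: hS => _; apply; [apply: hw | apply: hw'].
- move=> u n hu; case: (ltP n 0) => hn; last by rewrite mode_annihil //; case: hS.
  have [k ek] : exists k : nat, n = - k.+1%:Z by exists (`|n|.-1)%N; lia.
  rewrite ek; elim: k u hu {ek} => [|k IH] u hu; first by rewrite mode_create.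
  rewrite translation_modeN; apply: (subspaceZ _ hS); apply: IH.
  exact: tker_translation.
move=> b m w hw u n hu.
have hom p v : par p v -> tker v -> tker (mode v n (mode (iU b) m w)).
  move=> pv hv; have [N hN] := Y_commT hmU m n w (hc.1 b) pv.
  have := hN N (leqnn N); set t := \sum_(j < N) _; set sg := (-1) ^+ _ => e.
  have -> : mode v n (mode (iU b) m w) = sg *: (mode (iU b) m (mode v n w) - t).
    rewrite -e opprB addrC subrK scalerA /sg -expr2 sqrr_sign scale1r //.
  apply: (subspaceZ _ hS); apply: (subspaceB hS).
    by apply: tker_current; apply: hw.
  apply: (subspace_sum _ hS) => j _; apply: (subspaceZ _ hS); apply: hw.
  exact: tker_current.
have [u0 [u1 [[p0 t0] [p1 t1] ->]]] := tker_par hu.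
by rewrite modeDl; apply: (subspaceD hS); [apply: hom p0 t0 | apply: hom p1 t1].
Qed.

(** * Equality of the kernels of [pi] and [psi] *)

Section Quotient.
Variables (L : vsa K) (pi : U -> L).
Hypotheses (hpi : is_vsa_hom pi) (surj : forall w, exists v, pi v = w)
  (graded : forall v, pi v = 0 -> exists t : seq U, v = \sum_(u <- t) u /\
     forall u, u \in t -> pi u = 0 /\ exists n, affine_weight iU n u)
  (simple : is_simple L).
Let pilin : linear pi. Proof. by case: hpi. Qed.
Let pim a n u : pi (mode a n u) = mode (pi a) n (pi u). Proof. by case: hpi. Qed.
Let pivac : pi vac = vac. Proof. by case: hpi. Qed.
Let L1 : (vac : L) != 0. Proof. by apply: vsa_nonzero_vac; case: simple. Qed.

(** Gradedness enters here: homogeneous components of nonzero weight lie in [aug], and one of weight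
    0 is a multiple of the vacuum, hence zero because [pi] does not kill the vacuum. *)
Lemma pi_ker_aug u : pi u = 0 -> aug u.
Proof.
move=> /graded[t [-> ht]]; rewrite big_seq; apply: (subspace_sum _ aug_subspace) => v /ht
  [pv [n hn]].
have hs' := affine_weight_neg_span hc hn.
have [hlt h0] := neg_span_le0 hneg_rho hdeg hs'.
have [n0|n0|n0] := ltgtP n 0.
- by rewrite hlt //; case: aug_subspace.
- apply: (neg_span_pos hs' _ aug_subspace); first by rewrite gt_eqF.
  by move=> b m w; apply: aug_mode.
have [c ec] := h0 n0; move: pv; rewrite ec (linZ pilin) pivac => /eqP.
by rewrite scaler_eq0 (negbTE L1) orbF => /eqP ->; rewrite scale0r; case: aug_subspace.
Qed.

Lemma pi_ker_psi u : pi u = 0 -> psi u = 0.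
Proof.
move=> hu; apply/eqP/negPn/negP => pu.
have [v [pv ev]] : [set v | exists w, pi w = 0 /\ psi w = v]%classic vac.
  apply: (osp_irreducible H); last by exists (psi u); split=> //; exists u.
  - split=> [|c _ _ [w [hw <-]] [w' [hw' <-]]].
      by exists 0; rewrite (lin0 pilin) (lin0 plin).
    by exists (c *: w + w'); rewrite pilin plin hw hw' scaler0 addr0.
  move=> b m _ [w [hw <-]]; exists (mode (iU b) m w).
  by rewrite pim hw mode0r prho.
exact: (aug_not_vac (pi_ker_aug pv)) ev.
Qed.

Lemma psi_ker_pi u : psi u = 0 -> pi u = 0.
Proof.
move=> hu; have [_ hI] := simple.
have [] := hI [set w | exists v, tker v /\ pi v = w]%classic.
- split.
  + split=> [|c _ _ [w [hw <-]] [w' [hw' <-]]].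
      by exists 0; split; [case: tker_subspace | exact: lin0].
    exists (c *: w + w'); rewrite pilin; split=> //.
    by case: tker_subspace => _; apply.
  + move=> _ [w [hw <-]]; have [w0 [w1 [[p0 t0] [p1 t1] ew]]] := tker_par hw.
    have hp p x : par p x -> par p (pi x) by case: hpi => _ h _ _; apply: h.
    exists (pi w0), (pi w1); split; last by rewrite ew (linD pilin).
      by split; [apply: hp | exists w0].
    by split; [apply: hp | exists w1].
  move=> a n _ [w [hw <-]]; have [a' <-] := surj a; rewrite -!pim.
  by split; [exists (mode a' n w); split=> //; apply: tker_left
            | exists (mode w n a'); split=> //; apply: tker_right].
- by apply; exists u; split=> //; apply: tker_ker.
move=> /(_ vac) [w [hw ew]].
(* If the ideal were everything, the vacuum would be the sum of [vac - w] and [w], both in [aug]. *)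
have d : aug (vac - w) by apply: pi_ker_aug; rewrite (linB pilin) ew pivac subrr.
case: (@aug_not_vac vac) => //.
by rewrite -(subrK w vac); apply: (subspaceD aug_subspace) => //; apply: tker_aug.
Qed.

Lemma quotient_iso : exists (phi : L -> V) (phi' : V -> L),
  [/\ cancel phi phi', cancel phi' phi, linear phi /\ phi vac = vac,
      (forall b n u, phi (mode (pi (iU b)) n u) = rho b n (phi u))
    & (forall p u, par p u -> par p (phi u)) /\ (forall p u, par p u -> par p (phi' u))].
Proof.
have ex w : exists v, exists u, pi u = w /\ psi u = v.
  by have [u hu] := surj w; exists (psi u), u.
have [phi hphi] : exists phi : L -> V, forall u, phi (pi u) = psi u.
  exists (fun w => sval (cid (ex w))) => u.
  have [u' [e1 <-]] := svalP (cid (ex (pi u))).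
  apply/eqP; rewrite -subr_eq0 -(linB plin); apply/eqP/pi_ker_psi.
  by rewrite (linB pilin) e1 subrr.
have philin : linear phi.
  move=> c w w'; have [u <-] := surj w; have [u' <-] := surj w'.
  by rewrite -pilin !hphi plin.
have ex' v : exists w, phi w = v.
  by have [u <-] := psi_surj v; exists (pi u).
have [phi' hphi'] : exists phi' : V -> L, cancel phi' phi.
  exists (fun v => sval (cid (ex' v))) => v; exact: (svalP (cid (ex' v))).
have z w : phi w = 0 -> w = 0.
  by have [u <-] := surj w; rewrite hphi; apply: psi_ker_pi.
have can : cancel phi phi'.
  by move=> w; apply/eqP; rewrite -subr_eq0; apply/eqP/z; rewrite (linB philin) hphi' subrr.
have pp p w : par p w -> par p (phi w).
  have hp p' x : par p' x -> par p' (pi x) by case: hpi => _ h _ _; apply: h.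
  have [u <-] := surj w; have [u0 [u1 [p0 p1 ->]]] := @par_sum _ U u.
  rewrite (linD pilin) (linD philin) !hphi; case: p => hpar.
    have e : pi u0 = 0.
      apply: par_direct; first exact: hp.
      rewrite -[pi u0](addrK (pi u1)); apply: subspaceB (par_subspace L true) hpar _.
      exact: hp.
    by rewrite (pi_ker_psi e) add0r; apply: psi_par.
  have e : pi u1 = 0.
    apply: par_direct; last exact: hp.
    rewrite -[pi u1](addKr (pi u0)) addrC; apply: subspaceB (par_subspace L false) hpar _.
    exact: hp.
  by rewrite (pi_ker_psi e) addr0; apply: psi_par.
exists phi, phi'; split=> //.
- by split=> //; rewrite -pivac hphi.
- by move=> b n w; have [u <-] := surj w; rewrite -pim !hphi prho.
split=> // p v pv; have [w0 [w1 [p0 p1 ew]]] := @par_sum _ L (phi' v).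
have ev : v = phi w0 + phi w1 by rewrite -(linD philin) -ew hphi'.
rewrite ew; case: p pv => pv.
  have -> : w0 = 0; last by rewrite add0r.
  apply: z; apply: par_direct; first exact: pp.
  have -> : phi w0 = v - phi w1 by rewrite ev addrK.
  exact: subspaceB (par_subspace V true) pv (pp _ _ p1).
have -> : w1 = 0; last by rewrite addr0.
apply: z; apply: par_direct; last exact: pp.
have -> : phi w1 = v - phi w0 by rewrite ev addrC addKr.
exact: subspaceB (par_subspace V false) pv (pp _ _ p0).
Qed.

End Quotient.
End Universal.

Lemma osp_isomorphism (L : vsa K) (i : lbasis (osp12 K) -> L) :
  is_simple_affine (level K) i -> exists (phi : L -> V) (phi' : V -> L),
  [/\ cancel phi phi', cancel phi' phi, linear phi /\ phi vac = vac,
      (forall b n u, phi (mode (i b) n u) = rho b n (phi u))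
    & (forall p u, par p u -> par p (phi u)) /\ (forall p u, par p u -> par p (phi' u))].
Proof.
move=> [U [iU [pi [hU [hpi surj] graded simple hi]]]].
have [psi [[plin pvac prho] _]] := hU.2 V rho vac (osp_action_affine H) (osp_action_vac s
  Gp Gbp).
have [phi [phi' [h1 h2 h3 h4 h5]]] := quotient_iso hU plin pvac prho hpi surj graded simple.
by exists phi, phi'; split=> // b n u; rewrite hi.
Qed.

End Isomorphism.

(** * The two module structures *)

Section Transport.
Variables (K : numFieldType) (L0 : vsa K) (i0 : lbasis (sl2 K) -> L0)
  (hL0 : is_simple_affine (level K) i0) (L : vsa K) (i : lbasis (osp12 K) -> L)
  (hL : is_simple_affine (level K) i) (V2 : small_N4 K)
  (jL : L0 -> L) (hjL : is_vsa_hom jL)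
  (jLE : forall a, jL (i0 a) = i (osp12_even a))
  (jV : L0 -> V2) (hjV : is_vsa_hom jV)
  (jVE : forall a, jV (i0 a) = n4_sl2 V2 a).
Let V : vsa K := V2.
Let s : sl2_basis -> V := @n4_sl2 _ V2.
Let Gp : V := n4_Gp V2.
Let Gbp : V := n4_Gbp V2.
Let rho := osp_action s Gp Gbp.

Lemma n4_currents : are_affine_currents (g := sl2 K) (level K) s.
Proof.
have -> : s = fun b => jV (i0 b) by apply/funext => b; rewrite jVE.
exact: hom_currents hjV (simple_affine_currents hL0).
Qed.
Let H : n4_rel s Gp Gbp := small_N4_rel n4_currents.
Let GmE : n4_Gm V2 = mode (s sl2_f) 0 Gp := n4_GmE' V2.
Let GbmE : n4_Gbm V2 = - mode (s sl2_f) 0 Gbp := n4_GbmE' V2.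

Lemma rho_yE n u : rho osp12_y n u = - mode (n4_Gm V2) n u - mode (n4_Gbm V2) (n + 1) u.
Proof. by rewrite GmE GbmE. Qed.

Lemma n4_conformal G : G = Gp \/ G = Gbp ->
  conformal s G (3 / 2) /\ conformal s (mode (s sl2_f) 0 G) (3 / 2).
Proof.
move=> j; have hs := n4_currents; split.
  exact: (conformal_G hs (fun n => n4r_e H j) (n4r_h0 H j) (fun n => n4r_h H j) (fun n =>
    n4r_f H j) (n4r_D H j)).
exact: (conformal_G' hs (fun n => n4r_e H j) (n4r_h0 H j) (fun n => n4r_h H j) (fun n =>
  n4r_f H j) (n4r_D H j)).
Qed.

Lemma Gbm_of_y n u : mode (n4_Gbm V2) n u = n%:~R *: rho osp12_y (n - 1) u
  + mode (omega_sug (s sl2_e) (s sl2_f) (s sl2_h)) 0 (rho osp12_y n u)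
  - rho osp12_y n (mode (omega_sug (s sl2_e) (s sl2_f) (s sl2_h)) 0 u).
Proof.
have hs := n4_currents.
have pG' G (j : G = Gp \/ G = Gbp) : par true (mode (s sl2_f) 0 G).
  exact: (mode_par 0 (sl2_par hs sl2_f) (n4r_par H j)).
rewrite !rho_yE GmE GbmE !modeNl !opprK modeDr modeNr.
rewrite (conformal_mode0 hs n u (pG' Gp (or_introl erefl)) (n4_conformal (or_introl erefl)).2).
rewrite (conformal_mode0 hs (n + 1) u (pG' Gbp (or_intror erefl)) (n4_conformal (or_intror
  erefl)).2).
by rewrite subrK addrK intrD; lmod K.
Qed.

(** * Both structures through a fixed isomorphism *)

Section Iso.
Variables (phi : L -> V) (psi : V -> L).
Hypotheses (phiK : cancel phi psi) (psiK : cancel psi phi) (philin : linear phi)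
  (phivac : phi vac = vac)
  (phirho : forall b n u, phi (mode (i b) n u) = rho b n (phi u))
  (phipar : forall p u, par p u -> par p (phi u))
  (psipar : forall p u, par p u -> par p (psi u)).

Lemma psilin : linear psi.
Proof. by move=> c u v; apply: (can_inj phiK); rewrite philin !psiK. Qed.

Definition osp_transport (a : L) (n : int) (u : V) : V := phi (mode a n (psi u)).
Definition n4_transport (v : V) (n : int) (u : L) : L := psi (mode v n (phi u)).

Lemma osp_transport_module : is_module osp_transport.
Proof. exact: transport_module (mode_module L) phiK psiK philin phipar psipar. Qed.
Lemma n4_transport_module : is_module n4_transport.
Proof. exact: transport_module (mode_module V) psiK phiK psilin psipar phipar. Qed.

Lemma osp_transport_current b n u : osp_transport (i b) n u = rho b n u.
Proof. by rewrite /osp_transport phirho psiK. Qed.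

Lemma sl2_gen v : generated [set w | exists b, w = i0 b]%classic v.
Proof. exact: simple_affine_generated hL0 v. Qed.
Let sl2_hom w : [set w | exists b, w = i0 b]%classic w -> exists p, par p w.
Proof. by move=> [b ->]; exists false; apply: (sl2_par (simple_affine_currents hL0)). Qed.

(** Two [L0]-module structures on V^(2) that agree on the currents agree on [L0]. So [phi], though
    not claimed to be a morphism of vertex algebras, respects the action of every vector of [L0]. *)
Lemma osp_transport_sl2 v : osp_transport (jL v) = mode (jV v).
Proof.
apply: (module_agree (pullback_module hjL osp_transport_module)
  (pullback_module hjV (mode_module V)) sl2_hom _ (sl2_gen v)) => w [b ->].
by apply/funext => n; apply/funext => u; rewrite jLE osp_transport_current jVE.
Qed.

Lemma n4_transport_sl2 v : n4_transport (jV v) = mode (jL v).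
Proof.
apply/funext => n; apply/funext => u; rewrite /n4_transport -osp_transport_sl2.
by rewrite /osp_transport !phiK.
Qed.

Lemma osp_transport_fields : osp_fields i jL jV osp_transport.
Proof.
split; first exact: osp_transport_sl2.
split; apply/funext => n; apply/funext => u; rewrite osp_transport_current //.
exact: rho_yE.
Qed.

Lemma osp_transport_irreducible : is_irreducible osp_transport.
Proof.
split; first by exists vac; exact: (n4r_vac H).
move=> N hN hst; have [[u hu]|hn] := pselect (exists u, N u /\ u != 0).
  right; apply: (osp_irreducible H hN) => [b m w hw|]; last by exists u.
  by have := hst (i b) m w hw; rewrite osp_transport_current.
by left=> u Nu; apply/eqP/negPn/negP => u0; apply: hn; exists u.
Qed.

Lemma n4_transport_irreducible : is_irreducible n4_transport.
Proof.
split; first by exists vac; apply: vsa_nonzero_vac; case: hL => ? [? [? [_ _ _ [h _] _]]].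
move=> N hN hst; have [[u [Nu u0]]|hn] := pselect (exists u, N u /\ u != 0); last first.
  by left=> u Nu; apply/eqP/negPn/negP => u0; apply: hn; exists u.
right; pose N' : set V := [set v | N (psi v)]%classic.
have hN' : is_subspace N'.
  split=> [|c v w hv hw]; first by rewrite /N' /= (lin0 psilin); case: hN.
  by rewrite /N' /= psilin; case: hN => _; apply.
have hst' v n w : N' w -> N' (mode v n w).
  by move=> hw; have := hst v n (psi w) hw; rewrite /n4_transport psiK.
have all : forall v, N' v.
  apply: (osp_irreducible H hN') => [b m w hw|].
    case: b => [b||] /=; first exact: hst'.
      by apply: (subspaceB hN'); apply: hst'.
    by apply: (subspaceB hN'); first apply: (subspaceN hN'); apply: hst'.
  exists (phi u); split; first by rewrite /N' /= phiK.
  by apply: contraNneq u0 => e; rewrite -[u]phiK e (lin0 psilin).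
by move=> w; have := all (phi w); rewrite /N' /= phiK.
Qed.

Lemma osp_transport_uniq Y' : is_module Y' -> osp_fields i jL jV Y' ->
  Y' = osp_transport.
Proof.
move=> hY' [f1 [f2 f3]]; have [g1 [g2 g3]] := osp_transport_fields.
apply/funext => a; have hc := simple_affine_currents hL.
apply: (module_agree hY' osp_transport_module _ _ (simple_affine_generated hL a)).
  by move=> w [b ->]; exists (lpar b); apply: hc.1.
by move=> w [[b||] ->]; rewrite ?f2 ?f3 ?g2 ?g3 // -jLE f1 g1.
Qed.

Let omL := omega_sug (i (osp12_even sl2_e)) (i (osp12_even sl2_f)) (i (osp12_even sl2_h)).
Let omV := omega_sug (s sl2_e) (s sl2_f) (s sl2_h).

(** Both Sugawara vectors are images of one vector of [L0], whose action [phi] respects. *)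
Lemma phi_omega u : phi (mode omL 0 u) = mode omV 0 (phi u).
Proof.
have eL : omL = jL (omega_sug (i0 sl2_e) (i0 sl2_f) (i0 sl2_h)).
  case: hjL => hl _ _ hm; rewrite /omL /omega_sug !(linD hl) (linZ hl).
  by rewrite !hm !jLE.
have eV : omV = jV (omega_sug (i0 sl2_e) (i0 sl2_f) (i0 sl2_h)).
  case: hjV => hl _ _ hm; rewrite /omV /omega_sug !(linD hl) (linZ hl).
  by rewrite !hm !jVE.
by rewrite eL eV -osp_transport_sl2 /osp_transport phiK.
Qed.

(** Zero modes are derivations, so the field of [L_sug(-1) x] is a commutator with [L_sug(-1)]. In
    this form it can be carried through [phi] and compared with [Gbp_of_x] and [Gbm_of_y]. *)
Lemma omL_comm b n u : mode (mode omL 0 (i b)) n u =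
  mode omL 0 (mode (i b) n u) - mode (i b) n (mode omL 0 u).
Proof.
have hc := simple_affine_currents hL.
have hcL : are_affine_currents (g := sl2 K) (level K) (fun a => i (osp12_even a)).
  have -> : (fun a => i (osp12_even a)) = fun a => jL (i0 a) by apply/funext => a; rewrite jLE.
  exact: hom_currents hjL (simple_affine_currents hL0).
have := Y_comm0 (mode_module L) n u (par_omega_sug hcL) (hc.1 b).
by rewrite /= expr0 scale1r -/omL => ->; rewrite addrAC subrr add0r.
Qed.

Lemma phi_current_D b n u :
  phi (n%:~R *: mode (i b) (n - 1) u + mode (mode omL 0 (i b)) n u) =
  n%:~R *: rho b (n - 1) (phi u) + mode omV 0 (rho b n (phi u)) - rho b n (mode omV 0 (phi u)).
Proof.
by rewrite omL_comm (linD philin) (linB philin) (linZ philin) phi_omega !phirho phi_omega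
  addrA.
Qed.

Lemma n4_transport_Gbp n u : n4_transport Gbp n u =
  n%:~R *: mode (i osp12_x) (n - 1) u + mode (mode omL 0 (i osp12_x)) n u.
Proof.
apply: (can_inj phiK); rewrite /n4_transport psiK (phi_current_D osp12_x).
exact: Gbp_of_x H _ _.
Qed.

Lemma n4_transport_Gbm n u : n4_transport (n4_Gbm V2) n u =
  n%:~R *: mode (i osp12_y) (n - 1) u + mode (mode omL 0 (i osp12_y)) n u.
Proof.
apply: (can_inj phiK); rewrite /n4_transport psiK (phi_current_D osp12_y).
exact: Gbm_of_y.
Qed.

Lemma n4_transport_Gp n u : n4_transport Gp n u =
  mode (i osp12_x) n u + n4_transport Gbp (n + 1) u.
Proof.
apply: (can_inj phiK); rewrite (linD philin) phirho /n4_transport !psiK.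
by rewrite /rho /= subrK.
Qed.

Lemma n4_transport_Gm n u : n4_transport (n4_Gm V2) n u =
  - mode (i osp12_y) n u - n4_transport (n4_Gbm V2) (n + 1) u.
Proof.
apply: (can_inj phiK); rewrite (linB philin) (linN philin) phirho /n4_transport !psiK.
by rewrite rho_yE; lmod K.
Qed.

Lemma n4_transport_fields : N4_fields i jL jV n4_transport.
Proof.
split; first exact: n4_transport_sl2.
(* The mode [n] of the derivative is [- n a_(n-1)], so its negative gives the summand [n a_(n-1)] of
   [phi_current_D]. *)
have ev b n u : (- dz (mode (i b)) + mode (mode omL 0 (i b))) n u =
    n%:~R *: mode (i b) (n - 1) u + mode (mode omL 0 (i b)) n u.
  by rewrite -[LHS]/(- - (n%:~R *: mode (i b) (n - 1) u) + _) opprK.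
have ev' b n u : mulz (dz (mode (i b)) - mode (mode omL 0 (i b))) n u =
    - ((n + 1)%:~R *: mode (i b) (n + 1 - 1) u + mode (mode omL 0 (i b)) (n + 1) u).
  by rewrite -[LHS]/(- ((n + 1)%:~R *: mode (i b) (n + 1 - 1) u) - _) opprD.
split; apply/funext => n; apply/funext => u.
- rewrite n4_transport_Gp n4_transport_Gbp.
  rewrite -[RHS]/(mode (i osp12_x) n u - mulz (dz (mode (i osp12_x)) - mode (mode omL 0 (i
    osp12_x))) n u).
  by rewrite ev' opprK.
- by rewrite ev n4_transport_Gbp.
- rewrite n4_transport_Gm n4_transport_Gbm.
  rewrite -[RHS]/(- mode (i osp12_y) n u + mulz (dz (mode (i osp12_y)) - mode (mode omL 0
    (i osp12_y))) n u).
  by rewrite ev'.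
by rewrite ev n4_transport_Gbm.
Qed.

Lemma n4_transport_uniq Y' : is_module Y' -> N4_fields i jL jV Y' -> Y' = n4_transport.
Proof.
move=> hY' [f1 [f2 f3 f4 f5]]; have [g1 [g2 g3 g4 g5]] := n4_transport_fields.
apply/funext => v; have hs := n4_currents.
apply: (module_agree hY' n4_transport_module _ _ (n4r_gen H v)).
  have pG G (j : G = Gp \/ G = Gbp) := n4r_par H j.
  have pG' G (j : G = Gp \/ G = Gbp) : par true (mode (s sl2_f) 0 G).
    exact: (mode_par 0 (sl2_par hs sl2_f) (pG _ j)).
  move=> w [[b ->]|[->|->|->|->]].
  - by exists false; apply: (sl2_par hs).
  - by exists true; apply: pG; left.
  - by exists true; apply: pG; right.
  - by exists true; apply: pG'; left.
  by exists true; apply: subspaceN (par_subspace V true) (pG' _ (or_intror erefl)).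
move=> w [[b ->]|[->|->|->|->]].
- by rewrite /s -jVE f1 g1.
- by rewrite f2 g2.
- by rewrite f3 g3.
- by rewrite -GmE f4 g4.
by rewrite -GbmE f5 g5.
Qed.

End Iso.

Lemma osp_n4_modules :
  (exists Y : V2 -> int -> L -> L,
     [/\ is_module Y, is_irreducible Y, N4_fields i jL jV Y
       & forall Y' : V2 -> int -> L -> L,
           is_module Y' -> N4_fields i jL jV Y' -> Y' = Y]) /\
  (exists Y : L -> int -> V2 -> V2,
     [/\ is_module Y, is_irreducible Y, osp_fields i jL jV Y
       & forall Y' : L -> int -> V2 -> V2,
           is_module Y' -> osp_fields i jL jV Y' -> Y' = Y]).
Proof.
have [phi [psi [phiK psiK [philin _] phirho [phipar psipar]]]] := osp_isomorphism H hL.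
split.
  exists (n4_transport phi psi); split.
  - exact: n4_transport_module.
  - exact: n4_transport_irreducible.
  - exact: n4_transport_fields.
  exact: n4_transport_uniq.
exists (osp_transport phi psi); split.
- exact: osp_transport_module.
- exact: osp_transport_irreducible.
- exact: osp_transport_fields.
exact: osp_transport_uniq.
Qed.

End Transport.

Theorem theorem5p1 (R : realType)
    (* L_{-3/2}(sl(2)) and L_{-3/2}(osp(1|2)) *)
    (L0 : vsa R[i]) (i0 : lbasis (sl2 R[i]) -> L0)
    (hL0 : is_simple_affine (level R[i]) i0)
    (L : vsa R[i]) (i : lbasis (osp12 R[i]) -> L)
    (hL : is_simple_affine (level R[i]) i)
    (V2 : small_N4 R[i])
    (* the copies of L_{-3/2}(sl(2)) generated by e, f, h *)
    (jL : L0 -> L) (hjL : is_vsa_hom jL)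
    (jLE : forall a, jL (i0 a) = i (osp12_even a))
    (jV : L0 -> V2) (hjV : is_vsa_hom jV)
    (jVE : forall a, jV (i0 a) = n4_sl2 V2 a) :
  (exists Y : V2 -> int -> L -> L,
     [/\ is_module Y, is_irreducible Y, N4_fields i jL jV Y
       & forall Y' : V2 -> int -> L -> L,
           is_module Y' -> N4_fields i jL jV Y' -> Y' = Y]) /\
  (exists Y : L -> int -> V2 -> V2,
     [/\ is_module Y, is_irreducible Y, osp_fields i jL jV Y
       & forall Y' : L -> int -> V2 -> V2,
           is_module Y' -> osp_fields i jL jV Y' -> Y' = Y]).
Proof. exact: (osp_n4_modules hL0 hL hjL jLE hjV jVE). Qed.
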